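(* Let $d=1$ and $n\in\mathbb{N}$. Let the initial data $(\xi_\varepsilon)_{\varepsilon\in(0,1)}$ satisfy Assumptions A1 and A2 (see context), and let $(\bar X_m)_{0\le m\le n}$ be the expansion coefficients and $(a_m(t,F))_{0\le m\le n}$ the weak expansion coefficients defined in the context. Then for every $F\in C^{n+1}(\mathbb{R})$ such that, for some $q,C>0$, $\max_{0\le i\le n+1}|F^{(i)}(x)|\le C(1+|x|^q)$ for all $x\in\mathbb{R}$, the following hold. (i) The limit $b_0(F):=\lim_{t\to\infty}a_0(t,F)$ exists and $$b_0(F)=\mathbb{E}\Bigl[\lim_{t\to\infty}F(\bar X_0(t))\Bigr]=F(1)\,\mathbb{P}(\xi_0>0)+F(-1)\,\mathbb{P}(\xi_0<0).$$ (ii) For $m\in\{1,\dots,n\}$ and $i\in\{1,\dots,m\}$ let $S_{m,i}(t):=\sum_{(j_1,\dots,j_i)\in\mathcal{D}_i^m}\prod_{k=1}^i\bar X_{j_k}(t)$, $t\ge0$. Then the conditional limits $$c_{m,i}:=\lim_{t\to\infty}\mathbb{E}[S_{m,i}(t)\mid\xi_0>0],\qquad \bar c_{m,i}:=\lim_{t\to\infty}\mathbb{E}[S_{m,i}(t)\mid\xi_0<0]$$ exist (each whenever the conditioning event has positive probability) and are uniquely determined by the recursion, for $m\in\{1,\dots,n\}$, $i\in\{1,\dots,m\}$, $$c_{m,i}=\frac{i-1}{2}c_{m-2,i-2}-\frac32c_{m,i+1}-\frac12c_{m,i+2},\qquad \bar c_{m,i}=\frac{i-1}{2}\bar c_{m-2,i-2}+\frac32\bar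 c_{m,i+1}-\frac12\bar c_{m,i+2},$$ with $c_{1,1}=\bar c_{1,1}=0$, $c_{2,2}=\bar c_{2,2}=\frac12$, and the conventions $c_{0,0}=\bar c_{0,0}=1$ and $c_{k,j}=\bar c_{k,j}=0$ whenever $(k,j)\notin\{(0,0)\}\cup\{(k,j):k\ge1,\ 1\le j\le k\}$. (The recursion is a nested induction: one increases $m$, and for each fixed $m$ computes backward in $i$ from $i=m$ to $1$.) (iii) For each $m\in\{1,\dots,n\}$ the limit $b_m(F):=\lim_{t\to\infty}a_m(t,F)$ exists and $$b_m(F)=\mathbb{P}(\xi_0>0)\sum_{i=1}^m\frac{c_{m,i}}{i!}F^{(i)}(1)+\mathbb{P}(\xi_0<0)\sum_{i=1}^m\frac{\bar c_{m,i}}{i!}F^{(i)}(-1).$$ In particular, $b_m(F)=0$ for all odd $m$.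
   Context: $\mathbb{N}=\{0,1,2,\dots\}$, $\mathbb{N}_+=\{1,2,\dots\}$. $(W_t)_{t\ge0}$ is a standard one-dimensional Brownian motion and the initial data are independent of $W$: the real random variables $(\xi_\varepsilon)_{\varepsilon\in(0,1)}$ together with $\xi_0,\dots,\xi_n$ below are jointly independent of $W$. The underlying dynamics is $\mathrm{d}X_\varepsilon=(X_\varepsilon-X_\varepsilon^3)\,\mathrm{d}t+\sqrt{2\varepsilon}\,\mathrm{d}W_t$, $X_\varepsilon(0)=\xi_\varepsilon$. For $m\in\mathbb{N}_+$ and $1\le i\le m$, $\mathcal{D}_i^m:=\{(j_1,\dots,j_i)\in(\mathbb{N}_+)^i: j_1+\dots+j_i=m\}$; $\mathcal{D}_i^m=\varnothing$ if $i>m$ or $i\le0$ or $m\le0$; sums over the empty set are $0$ (so $S_{m,i}:=0$ whenever $m<0$, $i<0$ or $i>m$). Assumption A1: there exist random variables $\xi_0,\dots,\xi_n$ such that for every $p\ge1$ and $0\le k\le n$, $\mathbb{E}|\xi_k|^{2p}<\infty$ and $\mathbb{E}\bigl|\xi_\varepsilon-\sum_{j=0}^k\varepsilon^{j/2}\xi_j\bigr|^{2p}\le C(k,p)\,\varepsilon^{(k+1)p}$ for all $\varepsilon\in(0,1)$, with $C(k,p)$ independent of $\varepsilon$. Assumption A2: there exist constants $r_{max}>r_{min}>0$ such that $r_{min}<|\xi_0|<r_{max}$ almost surely. Expansion coefficients ($d=1$): $\mathrm{d}\bar X_0=(\bar X_0-\bar X_0^3)\,\mathrm{d}t$, $\bar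 X_0(0)=\xi_0$; $\mathrm{d}\bar X_1=(1-3\bar X_0^2)\bar X_1\,\mathrm{d}t+\sqrt2\,\mathrm{d}W_t$, $\bar X_1(0)=\xi_1$; and for $m\ge2$, $\mathrm{d}\bar X_m=(1-3\bar X_0^2)\bar X_m\,\mathrm{d}t-\sum_{(i,j)\in\mathcal{D}_2^m}3\bar X_0\bar X_i\bar X_j\,\mathrm{d}t-\sum_{(i,j,k)\in\mathcal{D}_3^m}\bar X_i\bar X_j\bar X_k\,\mathrm{d}t$, $\bar X_m(0)=\xi_m$. Weak expansion coefficients: $a_0(t,F):=\mathbb{E}[F(\bar X_0(t))]$ and, for $1\le m\le n$, $a_m(t,F):=\mathbb{E}\bigl[\sum_{i=1}^m\frac1{i!}\sum_{(j_1,\dots,j_i)\in\mathcal{D}_i^m}F^{(i)}(\bar X_0(t))\prod_{k=1}^i\bar X_{j_k}(t)\bigr]$. If $\mathbb{P}(\xi_0>0)=0$ (resp. $\mathbb{P}(\xi_0<0)=0$), the numbers $c_{m,i}$ (resp. $\bar c_{m,i}$) in (iii) are understood as defined by the recursion. *)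

(* Defs.v *)
From HB Require Import structures.
From mathcomp Require Import all_boot all_order all_algebra.
From mathcomp Require Import all_classical all_reals all_analysis.

Set Implicit Arguments.
Unset Strict Implicit.
Unset Printing Implicit Defensive.

Import Order.TTheory GRing.Theory Num.Theory.
Import numFieldNormedType.Exports.

Local Open Scope classical_set_scope.
Local Open Scope ring_scope.

Section defs.
Context (R : realType) (d : measure_display) (T : measurableType d)
  (P : probability T R).

Definition mutually_independent (k : nat) (Y : 'I_k -> T -> R) : Prop :=
  forall B : 'I_k -> set R, (forall i, measurable (B i)) ->
    P (\bigcap_(i in [set: 'I_k]) (Y i @^-1` B i)) =
    (\prod_(i < k) P (Y i @^-1` B i))%E.

(* A process is indexed by all of R, but only times t >= 0 are constrained.
   The second argument of normal_prob is the standard deviation. *)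
Definition brownian_motion (W : R -> {RV P >-> R}) : Prop :=
  [/\ {ae P, forall w, W 0 w = 0},
      forall s t, 0 <= s -> s < t -> forall A : set R, measurable A ->
        P ((W t \- W s) @^-1` A) = normal_prob 0 (Num.sqrt (t - s)) A,
      forall (k : nat) (t : nat -> R), 0 <= t 0%N ->
        (forall i, t i <= t i.+1) ->
        mutually_independent (fun i : 'I_k => W (t i.+1) \- W (t i)) &
      {ae P, forall w, {within `[0, +oo[, continuous (fun t => W t w)}}].

Definition events_of (I : Type) (D : set I) (Y : I -> {RV P >-> R}) :
    set (set T) :=
  \bigcup_(i in D) preimage_set_system setT (Y i) measurable.

Definition independent_sigma (G H : set (set T)) : Prop :=
  forall A B, <<s G >> A -> <<s H >> B -> P (A `&` B) = (P A * P B)%E.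

(* The whole family (xieps, xi_0, ..., xi_n) is independent of the process W;
   no independence is required within the family. *)
Definition initial_data_independent (n : nat) (W xieps : R -> {RV P >-> R})
    (xi : nat -> {RV P >-> R}) : Prop :=
  independent_sigma
    (events_of `]0, 1[ xieps `|` events_of [set k | (k <= n)%N] xi)
    (events_of `[0, +oo[ W).

Definition assumption_A1 (n : nat) (xieps : R -> {RV P >-> R})
    (xi : nat -> {RV P >-> R}) : Prop :=
  forall (p : R) (k : nat), 1 <= p -> (k <= n)%N ->
    ('E_P[(fun w => `|xi k w| `^ (2 * p))%R] < +oo)%E /\
    exists C : R, forall eps : R, 0 < eps < 1 ->
      ('E_P[(fun w => `|xieps eps w
                        - \sum_(j < k.+1) eps `^ (j%:R / 2) * xi j w|
                      `^ (2 * p))%R]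
       <= (C * eps `^ (k.+1%:R * p))%:E)%E.

Definition assumption_A2 (xi : nat -> {RV P >-> R}) : Prop :=
  exists rmin rmax : R, [/\ 0 < rmin, rmin < rmax &
    {ae P, forall w, rmin < `|xi 0%N w| < rmax}].

Definition compositions (m i : nat) : {set {ffun 'I_i -> 'I_m.+1}} :=
  [set j : {ffun 'I_i -> 'I_m.+1} |
    [&& (0 < i)%N, [forall k, (0 < j k)%N] &
        (\sum_(k < i) j k)%N == m]]%SET.

Definition composition_sum (m i : nat) (x : nat -> R) : R :=
  \sum_(j in compositions m i) \prod_(k < i) x (j k).

(* For m = 1 both sums are empty. *)
Definition drift (m : nat) (x : nat -> R) : R :=
  if m is 0%N then x 0%N - x 0%N ^+ 3
  else (1 - 3 * x 0%N ^+ 2) * x m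
       - \sum_(j in compositions m 2) 3 * x 0%N * \prod_(k < 2) x (j k)
       - \sum_(j in compositions m 3) \prod_(k < 3) x (j k).

(* The noise is additive, so each SDE is a pathwise integral equation. *)
Definition expansion_coefficients (n : nat) (W : R -> {RV P >-> R})
    (xi : nat -> {RV P >-> R}) (X : nat -> R -> {RV P >-> R}) : Prop :=
  forall m : nat, (m <= n)%N ->
    {ae P, forall w,
      {within `[0, +oo[, continuous (fun t => X m t w)} /\
      forall t, 0 <= t ->
        X m t w = xi m w
          + \int[lebesgue_measure]_(s in `[0, t]) drift m (fun k => X k s w)
          + (if m == 1%N then Num.sqrt 2 * W t w else 0)}.

Definition weak_coefficient (X : nat -> R -> {RV P >-> R}) (m : nat) (t : R)
    (F : R -> R) : \bar R :=
  if m is 0%N then 'E_P[(fun w => F (X 0%N t w))%R]%E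
  else 'E_P[(fun w => \sum_(1 <= i < m.+1) (i`!%:R)^-1 *
         \sum_(j in compositions m i)
            derive1n i F (X 0%N t w) * \prod_(k < i) X (j k) t w)%R]%E.

Definition cond_expectation (Y : T -> R) (A : set T) : \bar R :=
  (((fine (P A))^-1)%:E * \int[P]_(w in A) (Y w)%:E)%E.

Definition C_class (k : nat) (F : R -> R) : Prop :=
  (forall i, (i < k)%N -> forall x, derivable (derive1n i F) x 1) /\
  continuous (derive1n k F).

Definition poly_growth (k : nat) (F : R -> R) : Prop :=
  exists q C : R, [/\ 0 < q, 0 < C & forall i x, (i <= k)%N ->
    `|derive1n i F x| <= C * (1 + `|x| `^ q)].

(* sg = 1 is the recursion for c, sg = -1 the one for c-bar. *)
Definition coeff_recursion (sg : R) (n : nat) (c : int -> int -> R) : Prop :=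
  [/\ c 0 0 = 1,
      forall k j : int, ~ (k = 0 /\ j = 0) -> ~ (1 <= k /\ 1 <= j <= k) ->
        c k j = 0,
      (1 <= n)%N -> c 1 1 = 0,
      (2 <= n)%N -> c 2 2 = 1 / 2 &
      forall m i : int, 1 <= m <= n%:Z -> 1 <= i <= m ->
        c m i = (i%:~R - 1) / 2 * c (m - 2) (i - 2)
                - sg * (3 / 2) * c m (i + 1) - 1 / 2 * c m (i + 2)].

Definition determined_by_recursion (sg : R) (n : nat) (c : int -> int -> R) :
    Prop :=
  coeff_recursion sg n c /\
  forall c' : int -> int -> R, coeff_recursion sg n c' ->
    forall m i : int, m <= n%:Z -> c' m i = c m i.

End defs.

(* Main.v *)
Require Import Defs.
From HB Require Import structures.
From mathcomp Require Import all_boot all_order all_algebra.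
From mathcomp Require Import all_classical all_reals all_analysis.
From mathcomp Require Import measurable_realfun.
From mathcomp Require Import ring lra zify.

Set Implicit Arguments.
Unset Strict Implicit.
Unset Printing Implicit Defensive.

Import Order.TTheory GRing.Theory Num.Theory.
Import numFieldNormedType.Exports.

Local Open Scope classical_set_scope.
Local Open Scope ring_scope.

(* Put Y_t = \sum_(1 <= j <= n) X_j(t) z^j, so that S_{m,i} is the coefficient
   of z^m in Y^i.  Ito's formula for Y^i, restricted to the sign event
   A = {sg * xi_0 > 0} on which X_0(t) tends to sg exponentially fast, says that
   u_{m,i}(t) = E[1_A S_{m,i}(t)] solves
     u_{m,i}' = i (E[1_A (1 - 3 X_0^2) S_{m,i}] - 3 E[1_A X_0 S_{m,i+1}]
                   - u_{m,i+2}) + i (i - 1) u_{m-2,i-2}.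
   By induction (m upwards, i downwards) this is u' = - 2 i u + g(t) with g
   convergent, whence the recursion for the limits.  Stochastic
   integrals are avoided: Ito's formula is replaced by a Taylor expansion of Y^i
   over [t, t + h], whose remainder is O(h^(3/2)) in mean because all the processes
   have moments bounded uniformly in time, and by the independence of
   W_{t+h} - W_t from the past; a discrete Gronwall argument then replaces the
   differential equation. *)

(** Uniform moments rest on one pathwise fact. The double-well equation is solved in closed form,
    and the linearised flow obeys |flow t / flow s| <= K exp(- 2 (t - s)) with the same K for all
    paths, because A2 keeps |xi_0| between two positive constants. This holds although the rate 1 -
    3 X_0^2 is positive near 0. Variation of constants then writes every X_m as an integral against
    an exponentially decaying kernel. The rate - 2 i is i (1 - 3): X_0^2 tends to 1 uniformly on A,
    and the difference 3 (1 - X_0^2) goes into g. The term i (i - 1) is twice the binomial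
    coefficient of i over 2, the factor 2 being the variance rate of sqrt 2 W; it comes with m - 2
    because only X_1 carries noise. The hypotheses hold almost surely whereas the estimates are
    pathwise, so the limits are computed for a version in which the hypotheses hold surely, then
    carried back across one null set. *)

(** * Tangent inequality and relaxation of a linear recursion *)

(** Convexity: [y ^+ p] lies above its tangent at [c]. The induction multiplies the previous
    inequality by [y] and adds a nonnegative multiple of [(c - y) ^+ 2]. Jensen's inequality below
    integrates this with [c] the weighted mean. *)
Lemma young_exprn (R : realFieldType) (p : nat) (c y : R) : 0 <= c -> 0 <= y ->
  p%:R * c ^+ p.-1 * y <= y ^+ p + (p%:R - 1) * c ^+ p.
Proof.
move=> c0 y0; elim: p => [|p IH]; first by rewrite !expr0; lra.
case: p IH => [|p] IH; first by rewrite !expr1 expr0; lra.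
have h := ler_wpM2r y0 IH.
have k0 : 0 <= p.+1%:R * c ^+ p * (c - y) ^+ 2.
  by rewrite mulr_ge0 ?sqr_ge0// mulr_ge0 ?exprn_ge0.
move: h k0; rewrite /= !exprS -!natr1.
set a := c ^+ p; set b := y ^+ p; set q := p%:R.
by move=> h k0; nra.
Qed.

Lemma near_pinftyE (R : realType) (P : R -> Prop) :
  (exists M, forall t, M <= t -> P t) -> \forall t \near +oo, P t.
Proof.
move=> [M h]; exists M; split; first exact: num_real.
by move=> t /ltW; exact: h.
Qed.

(* Freezing the step h and iterating backwards from t contracts |u - l| to the
   local error, which is o(1) as h tends to 0. *)
Lemma discrete_relaxation (R : realType) (u g : R -> R) (lam g0 C M : R) :
  0 < lam ->
  (forall t, 0 <= t -> `|u t| <= M) ->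
  (forall t h, 0 <= t -> 0 < h <= 1 ->
     `|u (t + h) - u t - h * (- lam * u t + g t)| <= C * (h * Num.sqrt h)) ->
  g t @[t --> +oo] --> g0 ->
  u t @[t --> +oo] --> g0 / lam.
Proof.
move=> lam0 uM hu hg.
have C0 : 0 <= C.
  have := hu 0 1 (lexx _); rewrite ltr01 lexx => /(_ isT).
  by rewrite sqrtr1 !mulr1; exact: le_trans.
have M0 : 0 <= M by apply: le_trans (uM 0 (lexx _)).
set l := g0 / lam.
pose w t := `|u t - l|.
have wM t : 0 <= t -> w t <= M + `|l|.
  by move=> t0; rewrite (le_trans (ler_normB _ _))// lerD2r uM.
apply/cvgrPdist_le => e e0.
(* The three caps serve in turn the hypothesis [h <= 1], the nonnegativity of the contraction factor
   [1 - lam * h], and [C * Num.sqrt h <= lam * e / 4]; [C + 1] avoids a division by zero. *)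
pose h := Num.min (Num.min 1 lam^-1) ((lam * e / 4 / (C + 1)) ^+ 2).
have h0 : 0 < h.
  rewrite /h !lt_min ltr01 invr_gt0 lam0/=.
  by rewrite exprn_gt0// divr_gt0// ?divr_gt0 ?mulr_gt0//; lra.
have h1 : h <= 1 by rewrite /h !ge_min lexx.
have hl : lam * h <= 1.
  by rewrite -ler_pdivlMl// mulr1 /h !ge_min lexx orbT.
have hs : C * Num.sqrt h <= lam * e / 4.
  have : Num.sqrt h <= lam * e / 4 / (C + 1).
    rewrite -[leRHS]ger0_norm; last by rewrite divr_ge0 ?divr_ge0 ?mulr_ge0//; lra.
    by rewrite -sqrtr_sqr ler_wsqrtr// /h !ge_min lexx !orbT.
  rewrite ler_pdivlMr; last lra.
  by have := sqrtr_ge0 h; nra.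
have /cvgrPdist_le /(_ (lam * e / 4)) := hg.
have le40 : 0 < lam * e / 4 by rewrite divr_gt0// mulr_gt0.
move=> /(_ le40) [T0 [_ hT0]].
pose T := Num.max (T0 + 1) 0.
(* The local error and the distance from [g t] to [g0] each cost at most [h * (lam * e / 4)]. The
   resulting affine recursion has fixed point [e / 2], so it is the excess over [e / 2] that
   contracts. *)
have step t : T <= t -> w (t + h) - e / 2 <= (1 - lam * h) * (w t - e / 2).
  move=> Tt.
  have t0 : 0 <= t by apply: le_trans Tt; rewrite le_max lexx orbT.
  have gt : `|g0 - g t| <= lam * e / 4.
    apply: hT0; apply: lt_le_trans Tt.
    by rewrite lt_max ltrDl ltr01.
  have hh : 0 < h <= 1 by rewrite h0 h1.
  have := hu t h t0 hh.
  have -> : u (t + h) - u t - h * (- lam * u t + g t) =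
     (u (t + h) - l) - (1 - lam * h) * (u t - l) + h * (g0 - g t).
    have -> : g0 = lam * l by rewrite /l mulrC divfK// gt_eqF.
    by ring.
  move=> H.
  have H1 : `|u (t + h) - l| <=
    (1 - lam * h) * `|u t - l| + h * `|g0 - g t| + C * (h * Num.sqrt h).
    have -> : u (t + h) - l = (1 - lam * h) * (u t - l) - h * (g0 - g t) +
      ((u (t + h) - l) - (1 - lam * h) * (u t - l) + h * (g0 - g t)) by ring.
    apply: le_trans (ler_normD _ _) _; apply: lerD => //.
    apply: le_trans (ler_normB _ _) _.
    by rewrite !normrM (ger0_norm (ltW h0)) ger0_norm// subr_ge0.
  rewrite -/(w t) -/(w (t + h)) in H1.
  have := ler_wpM2l (ltW h0) gt.
  have := ler_wpM2l (ltW h0) hs.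
  nra.
have iter k t : T <= t ->
    w (t + k%:R * h) - e / 2 <= (1 - lam * h) ^+ k * (M + `|l|).
  move=> Tt; elim: k => [|k IH].
    have := wM t; rewrite expr0 mul0r addr0.
    have t0 : 0 <= t by apply: le_trans Tt; rewrite le_max lexx orbT.
    by move=> /(_ t0); lra.
  have -> : t + k.+1%:R * h = t + k%:R * h + h by rewrite -natr1; ring.
  apply: le_trans (step _ _) _.
    by apply: le_trans Tt _; rewrite lerDl mulr_ge0// ltW.
  by rewrite exprS -mulrA ler_wpM2l// subr_ge0.
have : (fun k => (M + `|l|) * (1 - lam * h) ^+ k) @ \oo --> (M + `|l|) * 0.
  apply: cvgMr; apply: cvg_expr.
  rewrite ger0_norm ?subr_ge0//.
  by have : 0 < lam * h by [rewrite mulr_gt0|]; lra.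
rewrite mulr0 => /cvgrPdist_le /(_ (e / 2)); rewrite divr_gt0// => /(_ isT)[k _ hk].
have {}hk := hk k (leqnn _).
apply: near_pinftyE; exists (T + k%:R * h) => t tT.
have := iter k (t - k%:R * h); rewrite subrK lerBrDr => /(_ tT).
rewrite distrC -/(w t) mulrC.
move: hk; rewrite sub0r normrN => hk.
have := le_trans (ler_norm _) hk; lra.
Qed.

(** * Powers of the series and the recursion *)

Section powers_of_series.
Variable R : realType.
Implicit Types (x : nat -> R) (n m i k : nat).

(** The generating polynomial of the sequence without its term of index 0, around which everything
    is expanded. The zero constant coefficient limits the powers that can reach a given degree. *)
Definition tail_poly n x : {poly R} :=
  \poly_(j < n.+1) (if j is 0%N then 0 else x j).

Lemma coef_tail_poly n x j :
  (tail_poly n x)`_j = if (0 < j <= n)%N then x j else 0.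
Proof. by rewrite coef_poly ltnS; case: j => [|j] //=; case: ifP. Qed.

Lemma coef_tail_poly_trunc n m x i k : (k <= m)%N -> (m <= n)%N ->
  (tail_poly n x ^+ i)`_k = (tail_poly m x ^+ i)`_k.
Proof.
move=> + mn; elim: i k => [|i IH] k km; first by rewrite !expr0.
rewrite !exprS !coefM; apply: eq_bigr => -[j /= jk] _.
rewrite ltnS in jk; rewrite IH; last by rewrite (leq_trans (leq_subr _ _)).
congr (_ * _); rewrite !coef_tail_poly.
by rewrite (leq_trans jk km) (leq_trans (leq_trans jk km) mn).
Qed.

(** Distributivity gives a sum over all functions into ['I_m.+1]; those with a zero entry drop out
    with the constant coefficient. The case [i = 0] is excluded because [compositions m 0] is empty
    while the zeroth power is 1. *)
Lemma coef_tail_polyX n x m i : (0 < i)%N -> (m <= n)%N ->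
  (tail_poly n x ^+ i)`_m = composition_sum m i x.
Proof.
move=> i0 mn; rewrite (coef_tail_poly_trunc _ _ (leqnn m) mn).
rewrite /composition_sum /tail_poly.
have -> : (\poly_(j < m.+1) (if j is 0%N then 0 else x j)) ^+ i =
   \prod_(k < i) \sum_(j < m.+1) ((if val j is 0%N then 0 else x j) *: 'X^j).
  by rewrite poly_def big_const_ord iter_mulr_1.
rewrite bigA_distr_bigA coef_sum /= [RHS]big_mkcond/=.
apply: eq_bigr => f _.
rewrite scaler_prod coefZ -expr_sum coefXn inE i0 /=.
rewrite eq_sym; case: eqP => _; rewrite ?andbF ?mulr0// andbT mulr1.
case: ifP => [/forallP h|/negbT].
  by apply: eq_bigr => k _; have := h k; case: (val (f k)).
rewrite negb_forall => /existsP[k fk].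
rewrite (bigD1 k)//= ; move: fk; rewrite -eqn0Ngt => /eqP ->.
by rewrite mul0r.
Qed.

Lemma coef_tail_polyX_small n x m i : (m < i)%N -> (tail_poly n x ^+ i)`_m = 0.
Proof.
elim: i m => // i IH m; rewrite ltnS => mi.
rewrite exprS coefM big1// => -[[|j] jm] _ /=.
  by rewrite coef_tail_poly mul0r.
rewrite IH ?mulr0//; rewrite ltnS in jm.
by rewrite ltn_subLR// (leq_ltn_trans mi)// addSn ltnS leq_addl.
Qed.

(** With at least two positive parts, every part leaves room for another one. Hence the nonlinear
    terms of the equation of index [m] involve strictly smaller indices only. *)
Lemma compositions_lt m i (j : {ffun 'I_i -> 'I_m.+1}) (k : 'I_i) : (1 < i)%N ->
  j \in compositions m i -> (0 < j k < m)%N.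
Proof.
rewrite inE => i1 /and3P[_ /forallP j0 /eqP jm].
rewrite j0/= -[ltnRHS]jm.
have [k' kk'] : exists k' : 'I_i, k' != k.
  case: i i1 j k j0 jm => [|[|i]]// _ j k _ _.
  exists (if k == ord0 then ord_max else ord0).
  by case: (eqVneq k ord0) => [->|]; rewrite // eq_sym.
rewrite (bigD1 k)//= (bigD1 k')//= addnA addnAC -[ltnLHS]addn0 -addnA ltn_add2l.
by rewrite addn_gt0 j0 orbT.
Qed.

(** Degree [m] of f(x0 + Y) - f(x0) = (1 - 3 x0^2) Y - 3 x0 Y^2 - Y^3 with f(x) = x - x^3: the
    equations of the coefficients arise by matching powers in this identity. *)
Lemma drift_coef n x m : (m <= n)%N ->
  (tail_poly n (fun j => drift j x))`_m =
  (1 - 3 * x 0%N ^+ 2) * (tail_poly n x)`_m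
  - 3 * x 0%N * (tail_poly n x ^+ 2)`_m - (tail_poly n x ^+ 3)`_m.
Proof.
move=> mn; case: m mn => [|m] mn.
  rewrite !coef_tail_poly/= !coef_tail_polyX_small//; ring.
rewrite !coef_tail_polyX// !coef_tail_poly mn/=.
congr (_ - _ - _); rewrite /composition_sum mulr_sumr.
by apply: eq_bigr.
Qed.

(** The identity for the drift holds only up to degree [n], beyond which the cubic has further
    terms; coefficient [m] of the product does not see them. *)
Lemma drift_coefM n x k m : (m <= n)%N ->
  (tail_poly n x ^+ k * tail_poly n (fun j => drift j x))`_m =
  (1 - 3 * x 0%N ^+ 2) * (tail_poly n x ^+ k.+1)`_m
  - 3 * x 0%N * (tail_poly n x ^+ k.+2)`_m - (tail_poly n x ^+ k.+3)`_m.
Proof.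
move=> mn.
have -> : (tail_poly n x ^+ k * tail_poly n (fun j => drift j x))`_m =
  (tail_poly n x ^+ k * ((1 - 3 * x 0%N ^+ 2) *: tail_poly n x -
   (3 * x 0%N) *: tail_poly n x ^+ 2 - tail_poly n x ^+ 3))`_m.
  rewrite !coefM; apply: eq_bigr => -[j jm] _ /=.
  by rewrite drift_coef ?coefB ?coefZ// (leq_trans (leq_subr _ _)).
rewrite !mulrBr -!scalerAr !coefB !coefZ -exprSr -!exprD.
by rewrite addn2 addn3.
Qed.

End powers_of_series.

(** The part of [(y + s * e) ^+ i] of order at least three in [s], with [s ^+ 3] already divided
    out; the recursion keeps it a polynomial expression over any commutative ring. The truncated
    [i' - 2] is harmless, the binomial coefficient being 0 for [i' < 2]. *)
Fixpoint binomial_rest (A : comNzRingType) (y s e : A) (i : nat) : A :=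
  if i is i'.+1 then
    (y + s * e) * binomial_rest y s e i' + y ^+ (i' - 2) * e ^+ 3 *+ 'C(i', 2)
  else 0.

Lemma binomial_restE (A : comNzRingType) (y s e : A) i :
  (y + s * e) ^+ i = y ^+ i + y ^+ i.-1 * (s * e) *+ i
    + y ^+ (i - 2) * (s * e) ^+ 2 *+ 'C(i, 2) + s ^+ 3 * binomial_rest y s e i.
Proof.
elim: i => [|i IH]; first by rewrite /= bin0n mulr0 !mulr0n !expr0 !addr0.
rewrite exprS {}IH [binomial_rest _ _ _ i.+1]/= binS bin1.
have e1 : y * (y ^+ i.-1 *+ i) = y ^+ i *+ i.
  by case: i => [|i]; rewrite ?mulr0n ?mulr0// mulrnAr -exprS.
have e2 : y * (y ^+ (i - 2) *+ 'C(i, 2)) = y ^+ i.-1 *+ 'C(i, 2).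
  case: i {e1} => [|[|i]]; rewrite ?mulr0n ?mulr0// mulrnAr -exprS.
  by rewrite subSS subSS subn0.
have e3 : y ^+ (i.+1 - 2) = y ^+ i.-1 by rewrite subSS subn1.
rewrite e3 /= [y ^+ i.+1]exprS.
rewrite -(mulr_natr (y ^+ i.-1 * _)) -!(mulr_natr (y ^+ i * _)).
rewrite -!(mulr_natr (y ^+ (i - 2) * _)) -!(mulr_natr (y ^+ i.-1 * _)).
rewrite !natrD -[i.+1%:R]natr1.
rewrite -!(mulr_natr (y ^+ _)) in e1 e2.
set a := y ^+ i in e1 *; set b := y ^+ i.-1 in e1 e2 *.
set c := y ^+ (i - 2) in e2 *; set r := binomial_rest _ _ _ _.
set p := i%:R in e1 *; set q := ('C(i, 2))%:R in e2 *.
have -> : (y + s * e) * (a + b * (s * e) * p + c * (s * e) ^+ 2 * q + s ^+ 3 * r) =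
  y * a + (y * (b * p) + a) * (s * e) +
  (y * (c * q) + b * p) * (s * e) ^+ 2 +
  s ^+ 3 * ((y + s * e) * r + c * e ^+ 3 * q) by ring.
rewrite e1 e2; ring.
Qed.

(** * The recursion for the limits: existence, parity, uniqueness *)

Section coefficients.
Variables (R : realType) (sg : R).

(* The fuel N pays for the nested induction: every recursive call lowers
   2 m - i. *)
Fixpoint limit_coef_fuel (N m i : nat) : R :=
  if N is N'.+1 then
    if (m == 0%N) && (i == 0%N) then 1 else
    if (0 < i <= m)%N then
      (i%:R - 1) / 2 *
        (if (1 < i)%N then limit_coef_fuel N' (m - 2) (i - 2) else 0)
      - sg * (3 / 2) * limit_coef_fuel N' m i.+1
      - 1 / 2 * limit_coef_fuel N' m i.+2
    else 0
  else 0.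

Definition limit_coef m i := limit_coef_fuel (m + m).+1 m i.

(** [m + m < N + i] says that the fuel exceeds the quantity lowered by every call; beyond the
    diagonal the value is 0 whatever the fuel. *)
Lemma limit_coef_fuelE N N' m i :
  (m + m < N + i)%N -> (m + m < N' + i)%N -> (i <= m)%N ->
  limit_coef_fuel N m i = limit_coef_fuel N' m i.
Proof.
elim: N N' m i => [|N IH] [|N'] m i //=.
- by rewrite !add0n => h _ im; move: h; rewrite ltnNge (leq_trans im)// leq_addr.
- by rewrite !add0n => _ h im; move: h; rewrite ltnNge (leq_trans im)// leq_addr.
have big M k l : (k < l)%N -> limit_coef_fuel M k l = 0.
  case: M => //= M kl; rewrite [l == 0%N]gtn_eqF ?andbF//; last by case: l kl.
  by rewrite [(l <= k)%N]leqNgt kl andbF.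
move=> h h' im; case: ifP => // _; case: ifP => // /andP[i0 _].
congr (_ - _ - _); congr (_ * _).
- case: ifP => // i1; apply: IH.
  + by move: h; rewrite addSn ltnS; clear -i1 im; lia.
  + by move: h'; rewrite addSn ltnS; clear -i1 im; lia.
  + by rewrite leq_sub2r.
- have [i1m|] := leqP i.+1 m; last by move=> ?; rewrite !big.
  by apply: IH => //; rewrite addnS -addSn.
- have [i1m|] := leqP i.+2 m; last by move=> ?; rewrite !big.
  by apply: IH => //; lia.
Qed.

Lemma limit_coef00 : limit_coef 0 0 = 1. Proof. by []. Qed.

Lemma limit_coef0 m i : ~~ (0 < i <= m)%N -> (m, i) != (0, 0)%N ->
  limit_coef m i = 0.
Proof.
by move=> h; rewrite xpair_eqE /limit_coef /= => /negbTE ->; rewrite (negbTE h).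
Qed.

Lemma limit_coefE m i : (0 < i <= m)%N ->
  limit_coef m i =
   (i%:R - 1) / 2 * (if (1 < i)%N then limit_coef (m - 2) (i - 2) else 0)
   - sg * (3 / 2) * limit_coef m i.+1 - 1 / 2 * limit_coef m i.+2.
Proof.
move=> /andP[i0 im]; rewrite {1}/limit_coef /= i0 im/=.
have -> : (m == 0%N) = false by apply/negbTE; rewrite -lt0n (leq_trans i0).
have out k l : (k < l)%N -> limit_coef k l = 0.
  move=> kl; rewrite limit_coef0// ?xpair_eqE; first by rewrite [(l <= k)%N]leqNgt kl andbF.
  by rewrite negb_and [l == 0%N]gtn_eqF ?orbT//; case: l kl.
have big M k l : (k < l)%N -> limit_coef_fuel M k l = 0.
  case: M => //= M kl; rewrite [l == 0%N]gtn_eqF ?andbF//; last by case: l kl.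
  by rewrite [(l <= k)%N]leqNgt kl andbF.
congr (_ - _ - _); congr (_ * _).
- case: ifP => // i1; apply: limit_coef_fuelE; [lia|lia|lia].
- have [i1m|mi] := leqP i.+1 m; last by rewrite out// big.
  by apply: limit_coef_fuelE => //; lia.
- have [i1m|mi] := leqP i.+2 m; last by rewrite out// big.
  by apply: limit_coef_fuelE => //; lia.
Qed.

(** The recursion links row [m] only to itself and to row [m - 2], so odd rows never reach the
    normalisation at (0, 0). The inner induction runs backward in [i] from the diagonal, where the
    terms of indices i + 1 and i + 2 vanish. *)
Lemma limit_coef_odd m i : odd m -> limit_coef m i = 0.
Proof.
elim/ltn_ind: m i => m IHm i om.
have [k] := ubnP (m - i)%N; elim: k i => // k IHk i mik.
have [/[dup] im /andP[i0 im']|h] := boolP (0 < i <= m)%N; last first.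
  by apply: limit_coef0 => //; rewrite xpair_eqE; case: m om {IHm IHk h mik}.
have [E|ltim] := eqVneq i m; last first.
  have im1 : (i < m)%N by rewrite ltn_neqAle ltim.
  rewrite limit_coefE// IHk; last by lia.
  rewrite IHk; last by lia.
  rewrite !mulr0 !subr0; case: ifP => [i1|]; rewrite ?mulr0//.
  by rewrite IHm ?mulr0//; [lia|rewrite oddB ?om//; lia].
have out k' : (m < k')%N -> limit_coef m k' = 0.
  move=> h; apply: limit_coef0; first by rewrite [(k' <= m)%N]leqNgt h andbF.
  by rewrite xpair_eqE; case: m om {IHm IHk im im' E mik h}.
rewrite limit_coefE// ![limit_coef m _]out ?E; [|lia|lia].
rewrite !mulr0 !subr0; case: ifP => [i1|]; rewrite ?mulr0//.
by rewrite IHm ?mulr0//; [lia|rewrite oddB ?om//; lia].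
Qed.

Definition limit_coefz (m i : int) : R :=
  if (0 <= m) && (0 <= i) then limit_coef `|m|%N `|i|%N else 0.

Lemma limit_coefz_nat (m i : nat) : limit_coefz m i = limit_coef m i.
Proof. by []. Qed.

Lemma limit_coefz_recursion n : coeff_recursion sg n limit_coefz.
Proof.
have out (k j : int) : ~ (k = 0 /\ j = 0) -> ~ (1 <= k /\ 1 <= j <= k) ->
    limit_coefz k j = 0.
  move=> h1 h2; rewrite /limit_coefz; case: ifP => // /andP[k0 j0].
  apply: limit_coef0; first by apply/negP => h; apply: h2; lia.
  by apply/negP; rewrite xpair_eqE => /andP[/eqP a /eqP b]; apply: h1; lia.
have rec (m i : int) : 1 <= i -> i <= m ->
    limit_coefz m i = (i%:~R - 1) / 2 * limit_coefz (m - 2) (i - 2)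
                - sg * (3 / 2) * limit_coefz m (i + 1)
                - 1 / 2 * limit_coefz m (i + 2).
  case: i => [i|//]; case: m => [m|//] i1 im.
  rewrite limit_coefz_nat limit_coefE; last by lia.
  rewrite -[_ + 1]/((i + 1)%N%:Z) -[_ + 2]/((i + 2)%N%:Z) !limit_coefz_nat.
  rewrite addn1 addn2; congr (_ * _ - _ - _).
  (* For [i = 1] the index [i - 2] is negative, where [limit_coefz] has the default value 0. *)
  case: ifP => i2.
    by rewrite -limit_coefz_nat; congr limit_coefz; lia.
  rewrite /limit_coefz; case: ifP => //; lia.
split.
- by rewrite limit_coefz_nat limit_coef00.
- exact: out.
- by move=> _; rewrite limit_coefz_nat limit_coef_odd.
- move=> _; rewrite rec//.
  rewrite [limit_coefz _ (2 + 1)]out; [|lia|lia].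
  rewrite [limit_coefz _ (2 + 2)]out; [|lia|lia].
  by rewrite subrr [limit_coefz 0 0]limit_coef00; lra.
- by move=> m i _ /andP[i1 im]; exact: rec.
Qed.

(** Outside the triangle both solutions have prescribed values. Inside, induction on [m] and, for
    fixed [m], on the distance from [i] to [m] calls only values already compared. *)
Lemma coeff_recursion_unique n c c' :
  coeff_recursion sg n c -> coeff_recursion sg n c' ->
  forall m i : int, m <= n%:Z -> c' m i = c m i.
Proof.
move=> [c00 co _ _ crec] [c00' co' _ _ crec'] m i mn.
have [m0|m0] := ltP m 0; first by rewrite co ?co'//; lia.
have [M E] : exists M : nat, m = M by exists `|m|%N; lia.
subst m; clear m0.
elim/ltn_ind: M i mn => M IH i mn.
have [k] := ubnP `|M%:Z - i|%N; elim: k i => // k IHk i hk.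
have [/andP[i1 im]|h] := boolP ((1 <= i) && (i <= M%:Z)); last first.
  have [[-> ->]|h'] := pselect (M%:Z = 0 /\ i = 0); first by rewrite c00 c00'.
  rewrite co ?co'//; lia.
have big (j : int) : M%:Z < j -> c' M j = c M j by move=> ?; rewrite co ?co'//; lia.
rewrite (crec M i) 1?(crec' M i); [|lia|lia|lia|lia].
have -> : c' (M%:Z - 2) (i - 2) = c (M%:Z - 2) (i - 2).
  have [M2|M2] := ltnP M 2; first by rewrite co ?co'//; lia.
  have -> : M%:Z - 2 = (M - 2)%N by lia.
  by apply: IH; lia.
have -> : c' M (i + 1) = c M (i + 1).
  by have [?|?] := ltP M%:Z (i + 1); [exact: big|apply: IHk; lia].
have -> // : c' M (i + 2) = c M (i + 2).
by have [?|?] := ltP M%:Z (i + 2); [exact: big|apply: IHk; lia].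
Qed.

End coefficients.

(** * Uniform moment bounds *)

Section continuous_functions.
Variable R : realType.
Implicit Types f g : R -> R.

Lemma continuous_funM f g : continuous f -> continuous g ->
  continuous (fun x => f x * g x).
Proof. by move=> cf cg x; apply: cvgM; [exact: cf|exact: cg]. Qed.

Lemma continuous_funD f g : continuous f -> continuous g ->
  continuous (fun x => f x + g x).
Proof. by move=> cf cg x; apply: cvgD; [exact: cf|exact: cg]. Qed.

Lemma continuous_funN f : continuous f -> continuous (fun x => - f x).
Proof. by move=> cf x; apply: cvgN; exact: cf. Qed.

Lemma continuous_funB f g : continuous f -> continuous g ->
  continuous (fun x => f x - g x).
Proof. by move=> cf cg x; apply: cvgB; [exact: cf|exact: cg]. Qed.

Lemma continuous_fun_cst (k : R) : continuous (fun _ : R => k).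
Proof. by move=> x; exact: cvg_cst. Qed.

Lemma continuous_funX f n : continuous f -> continuous (fun x => f x ^+ n).
Proof.
move=> cf; elim: n => [|n IH]; first exact: continuous_fun_cst.
rewrite [X in continuous X](_ : _ = fun x => f x * f x ^+ n).
  exact: continuous_funM.
by apply/funext => x; rewrite exprS.
Qed.

Lemma continuous_fun_norm f : continuous f -> continuous (fun x => `|f x|).
Proof. by move=> cf x; apply: cvg_norm; exact: cf. Qed.

Lemma continuous_fun_comp f g : continuous f -> continuous g ->
  continuous (fun x => g (f x)).
Proof. by move=> cf cg x; apply: (cvg_comp f g (cf x)); exact: cg. Qed.

End continuous_functions.

Section real_expectation.
Context (R : realType) (d : measure_display) (T : measurableType d)
  (P : probability T R).
Implicit Types f g : T -> R.

Lemma integrable_funD f g : P.-integrable setT (EFin \o f) ->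
  P.-integrable setT (EFin \o g) ->
  P.-integrable setT (EFin \o (fun w => f w + g w)).
Proof. by move=> hf hg; exact: (integrableD measurableT hf hg). Qed.

Lemma integrable_funZ f k : P.-integrable setT (EFin \o f) ->
  P.-integrable setT (EFin \o (fun w => k * f w)).
Proof. by move=> hf; exact: (integrableZl measurableT k hf). Qed.

Lemma integrable_fun_cst k : P.-integrable setT (EFin \o (fun _ : T => k)).
Proof. exact: finite_measure_integrable_cst. Qed.

Lemma EFin_Rintegral f : P.-integrable setT (EFin \o f) ->
  (\int[P]_w f w)%:E = (\int[P]_w (f w)%:E)%E.
Proof. by move=> hf; rewrite /Rintegral fineK//; exact: integrable_fin_num hf. Qed.

Lemma Rintegral_probability_cst k : \int[P]_w k = k.
Proof.
rewrite Rintegral_cst// -[RHS]mulr1; congr (_ * _).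
exact: (congr1 fine (probability_setT P)).
Qed.

End real_expectation.

Section uniform_moments.
Context (R : realType) (d : measure_display) (T : measurableType d)
  (P : probability T R).

(** All orders are required, with a bound depending on the order alone, because this makes the class
    closed under products at the price of doubling the order. The integrals are taken in the
    extended reals, so that the bound itself yields integrability. *)
Definition unif_moments (I : Type) (D : set I) (Z : I -> T -> R) : Prop :=
  (forall i, D i -> measurable_fun setT (Z i)) /\
  forall p : nat, exists C : R, forall i, D i ->
    (\int[P]_w (`|Z i w| ^+ p)%:E <= C%:E)%E.

Lemma measurable_normX (f : T -> R) p : measurable_fun setT f ->
  measurable_fun setT (fun w => (`|f w| ^+ p)%:E).
Proof.
move=> mf; apply/measurable_EFinP; apply: measurable_funX.
exact: measurableT_comp.
Qed.

Lemma unif_moments_le (I : Type) (D : set I) (Z Z' : I -> T -> R) :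
  unif_moments D Z' -> (forall i, D i -> measurable_fun setT (Z i)) ->
  (forall i w, D i -> `|Z i w| <= `|Z' i w|) -> unif_moments D Z.
Proof.
move=> [mZ' hZ'] mZ ZZ'; split=> // p; have [C hC] := hZ' p.
exists C => i Di; apply: le_trans (hC i Di).
apply: ge0_le_integral => //; first exact: measurable_normX (mZ i Di).
- exact: measurable_normX (mZ' i Di).
- by move=> w _; rewrite lee_fin lerXn2r ?nnegrE// ZZ'.
Qed.

Lemma unif_moments_bounded (I : Type) (D : set I) (Z : I -> T -> R) (K : R) :
  (forall i, D i -> measurable_fun setT (Z i)) ->
  (forall i w, D i -> `|Z i w| <= K) -> unif_moments D Z.
Proof.
move=> mZ ZK; split=> // p; exists (K ^+ p) => i Di.
apply: (@le_trans _ _ (\int[P]_w (K ^+ p)%:E)%E).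
  apply: ge0_le_integral => //; first exact: measurable_normX (mZ i Di).
  by move=> w _; rewrite lee_fin lerXn2r ?nnegrE ?ZK// (le_trans _ (ZK i w Di)).
apply: (@le_trans _ _ ((K ^+ p)%:E * P setT)%E); first by rewrite integral_cst.
by rewrite probability_setT mule1.
Qed.

Lemma unif_moments_cst (I : Type) (D : set I) (K : R) :
  unif_moments D (fun _ _ => K).
Proof. exact: (@unif_moments_bounded _ _ _ `|K|). Qed.

Lemma unif_moments_reindex (I J : Type) (D : set I) (E : set J) (f : J -> I)
    (Z : I -> T -> R) :
  unif_moments D Z -> (forall j, E j -> D (f j)) -> unif_moments E (fun j => Z (f j)).
Proof.
move=> [mZ hZ] ED; split=> [j Ej|p]; first exact/mZ/ED.
by have [C hC] := hZ p; exists C => j Ej; exact/hC/ED.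
Qed.

(** The sum is at most twice the larger of the two absolute values, hence the factor [2 ^+ p]. *)
Lemma unif_momentsD (I : Type) (D : set I) (Z Z' : I -> T -> R) :
  unif_moments D Z -> unif_moments D Z' ->
  unif_moments D (fun i w => Z i w + Z' i w).
Proof.
move=> [mZ hZ] [mZ' hZ']; split=> [i Di|p].
  by apply: measurable_funD; [exact: mZ|exact: mZ'].
have [C hC] := hZ p; have [C' hC'] := hZ' p.
exists (2 ^+ p * (C + C')) => i Di.
have m1 := measurable_normX p (mZ i Di).
have m2 := measurable_normX p (mZ' i Di).
apply: (@le_trans _ _
    (\int[P]_w ((2 ^+ p)%:E * ((`|Z i w| ^+ p)%:E + (`|Z' i w| ^+ p)%:E)))%E).
  apply: ge0_le_integral => //.
  - by apply: measurable_normX; apply: measurable_funD; [exact: mZ|exact: mZ'].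
  - by apply: emeasurable_funM => //; apply: emeasurable_funD.
  - move=> w _; rewrite -EFinD -EFinM lee_fin.
    wlog le : Z Z' {hZ hZ' hC hC' m1 m2 mZ mZ'} / `|Z i w| <= `|Z' i w|.
      move=> h; have [?|/ltW?] := leP `|Z i w| `|Z' i w|; first exact: h.
      by rewrite addrC [X in _ * X]addrC; exact: h.
    apply: (@le_trans _ _ ((2 * `|Z' i w|) ^+ p)).
      rewrite lerXn2r ?nnegrE// ?mulr_ge0//.
      by rewrite (le_trans (ler_normD _ _))// mulr_natl mulr2n lerD2r.
    by rewrite exprMn ler_wpM2l ?exprn_ge0// lerDr exprn_ge0.
rewrite ge0_integralZl//; last 2 first.
- exact: emeasurable_funD.
- by move=> w _; rewrite -EFinD lee_fin addr_ge0 ?exprn_ge0.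
rewrite ge0_integralD// EFinM lee_wpmul2l ?lee_fin ?exprn_ge0//.
by rewrite EFinD leeD ?hC ?hC'.
Qed.

(** 2 a b <= a^2 + b^2, applied to the p-th powers of the factors. *)
Lemma unif_momentsM (I : Type) (D : set I) (Z Z' : I -> T -> R) :
  unif_moments D Z -> unif_moments D Z' ->
  unif_moments D (fun i w => Z i w * Z' i w).
Proof.
move=> [mZ hZ] [mZ' hZ']; split=> [i Di|p].
  by apply: measurable_funM; [exact: mZ|exact: mZ'].
have [C hC] := hZ (p * 2)%N; have [C' hC'] := hZ' (p * 2)%N.
exists (C + C') => i Di.
have m1 := measurable_normX (p * 2) (mZ i Di).
have m2 := measurable_normX (p * 2) (mZ' i Di).
apply: (@le_trans _ _
    (\int[P]_w ((`|Z i w| ^+ (p * 2))%:E + (`|Z' i w| ^+ (p * 2))%:E))%E).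
  apply: ge0_le_integral => //.
  - by apply: measurable_normX; apply: measurable_funM; [exact: mZ|exact: mZ'].
  - exact: emeasurable_funD.
  - move=> w _; rewrite -EFinD lee_fin normrM exprMn !exprM.
    have a0 : 0 <= `|Z i w| ^+ p by rewrite exprn_ge0.
    have b0 : 0 <= `|Z' i w| ^+ p by rewrite exprn_ge0.
    set a := _ ^+ p in a0 *; set b := `|Z' i w| ^+ p in b0 *.
    have := sqr_ge0 (a - b); nra.
by rewrite ge0_integralD// EFinD leeD ?hC ?hC'.
Qed.

Lemma unif_momentsZ (I : Type) (D : set I) (Z : I -> T -> R) (k : R) :
  unif_moments D Z -> unif_moments D (fun i w => k * Z i w).
Proof. exact/unif_momentsM/unif_moments_cst. Qed.

Lemma unif_momentsN (I : Type) (D : set I) (Z : I -> T -> R) :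
  unif_moments D Z -> unif_moments D (fun i w => - Z i w).
Proof.
move=> /(unif_momentsZ (-1)) h.
apply: unif_moments_le (h) _ _ => [i Di|i w _]; last by rewrite mulN1r.
by have := h.1 i Di; under eq_fun do rewrite mulN1r.
Qed.

Lemma unif_momentsB (I : Type) (D : set I) (Z Z' : I -> T -> R) :
  unif_moments D Z -> unif_moments D Z' ->
  unif_moments D (fun i w => Z i w - Z' i w).
Proof. by move=> h /unif_momentsN; exact: unif_momentsD. Qed.

Lemma unif_momentsX (I : Type) (D : set I) (Z : I -> T -> R) k :
  unif_moments D Z -> unif_moments D (fun i w => Z i w ^+ k).
Proof.
move=> h; elim: k => [|k IH]; first exact: unif_moments_cst.
by under eq_fun do under eq_fun do rewrite exprS; exact: unif_momentsM.
Qed.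

Lemma unif_moments_integrable (I : Type) (D : set I) (Z : I -> T -> R) i :
  unif_moments D Z -> D i -> P.-integrable setT (EFin \o Z i).
Proof.
move=> [mZ hZ] Di; apply/integrableP; split; first exact/measurable_EFinP/mZ.
have [C hC] := hZ 1%N; apply: le_lt_trans (ltry C).
exact: hC.
Qed.

Lemma unif_moments_Rintegral (I : Type) (D : set I) (Z : I -> T -> R) :
  unif_moments D Z ->
  exists C : R, forall i, D i -> `|\int[P]_w Z i w| <= C.
Proof.
move=> hZ; have [C hC] := hZ.2 1%N; exists C => i Di.
apply: le_trans (le_normr_Rintegral _ _) _ => //.
  exact: unif_moments_integrable hZ Di.
rewrite -lee_fin; apply: le_trans (hC i Di).
rewrite /Rintegral fineK//.
have /integrableP[m1 m2] := unif_moments_integrable hZ Di.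
by rewrite ge0_fin_numE// integral_ge0.
Qed.

End uniform_moments.

(** * Joint measurability of continuous processes and moments of their time integrals *)

Section processes.
Context (R : realType) (d : measure_display) (T : measurableType d).
Local Notation mu := (@lebesgue_measure R).

(** Freezing the time at the grid point just below makes preimages countable unions of measurable
    rectangles; by continuity of the paths these approximations converge pointwise as the mesh tends
    to 0. *)
Lemma measurable_process (Y : R -> T -> R) :
  (forall s, measurable_fun setT (Y s)) -> (forall w, continuous (Y^~ w)) ->
  measurable_fun setT (fun z : T * R => Y z.2 z.1).
Proof.
move=> mY cY.
pose st (n : nat) (s : R) : R := (Num.floor (n.+1%:R * s))%:~R / n.+1%:R.
apply: (@measurable_fun_cvg _ _ _ _ (fun n (z : T * R) => Y (st n z.2) z.1)).
- move=> n _ B mB; rewrite setTI.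
  have -> : (fun z : T * R => Y (st n z.2) z.1) @^-1` B =
    \bigcup_(k in [set: int])
      ((Y (k%:~R / n.+1%:R) @^-1` B) `*`
       [set s : R | Num.floor (n.+1%:R * s) = k]).
    apply/seteqP; split => [[w s]/= h|[w s] [k _ [/= h hk]]].
      by exists (Num.floor (n.+1%:R * s)).
    by rewrite /st hk.
  apply: countable_bigcupT_measurable => // k; apply: measurableX.
    by rewrite -[X in measurable X]setTI; exact: mY.
  have -> : [set s : R | Num.floor (n.+1%:R * s) = k] =
    `[k%:~R / n.+1%:R, (k + 1)%:~R / n.+1%:R[%classic.
    apply/seteqP; split => s /=; rewrite in_itv/=.
      move=> <-; rewrite ler_pdivrMr// ltr_pdivlMr// mulrC.
      by rewrite floor_le_tmp lt_succ_floor.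
    rewrite ler_pdivrMr// ltr_pdivlMr// mulrC => h.
    by apply: floor_def.
  exact: measurable_itv.
- move=> [w s] _ /=.
  suff h : (fun n => st n s) @ \oo --> s by exact: (cvg_comp _ _ h (cY w s)).
  apply/cvgrPdist_le => e e0.
  near=> n.
  have n0 : 0 < n.+1%:R :> R by [].
  have -> : s - st n s = (n.+1%:R * s - (Num.floor (n.+1%:R * s))%:~R) / n.+1%:R.
    by rewrite /st mulrBl mulrAC divff ?mul1r// gt_eqF.
  rewrite ger0_norm; last by rewrite divr_ge0// subr_ge0 floor_le_tmp.
  rewrite ler_pdivrMr//; apply: (@le_trans _ _ 1).
    by rewrite lerBlDl; apply: ltW; have := lt_succ_floor (n.+1%:R * s); rewrite intrD.
  rewrite -ler_pdivrMl// mulr1.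
  near: n; exists (Num.truncn e^-1).+1 => // n /= hn.
  apply: le_trans (ltW (truncnS_gt _)) _.
  by rewrite ler_nat (leq_trans hn).
Unshelve. all: by end_near. Qed.

(** Tonelli's theorem gives measurability of partial integrals of nonnegative functions, hence the
    split into positive and negative parts. *)
Lemma measurable_Rintegral_process (Y : R -> T -> R) (a b : R) :
  (forall s, measurable_fun setT (Y s)) -> (forall w, continuous (Y^~ w)) ->
  measurable_fun setT (fun w => \int[mu]_(s in `[a, b]) Y s w).
Proof.
move=> mY cY; have mz := measurable_process mY cY.
have mi : measurable_fun setT
    (fun z : T * R => (\1_(`[a, b]%classic : set R) z.2 : R)).
  by apply: measurableT_comp.
pose f (z : T * R) : \bar R := (Y z.2 z.1 * \1_(`[a, b]%classic : set R) z.2)%:E.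
have mf : measurable_fun setT f.
  by apply/measurable_EFinP; apply: measurable_funM.
have -> : (fun w => \int[mu]_(s in `[a, b]) Y s w) =
  fine \o (fun w => (\int[mu]_s f^\+ (w, s) - \int[mu]_s f^\- (w, s)))%E.
  apply/funext => w /=; rewrite Rintegral_mkcond /Rintegral; congr fine.
  rewrite integralE; congr (_ - _)%E; apply: eq_integral => s _;
    rewrite ?funeposE ?funenegE /f patchE indicE /=; case: ifP => _ //=;
    by rewrite ?mulr1 ?mulr0.
apply: measurableT_comp => //; apply: emeasurable_funB.
- apply: (measurable_fun_fubini_tonelli_F (m2 := mu) f^\+%E).
    exact: measurable_funepos.
  by move=> x; exact: funepos_ge0.
- apply: (measurable_fun_fubini_tonelli_F (m2 := mu) f^\-%E).
    exact: measurable_funeneg.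
  by move=> x; exact: funeneg_ge0.
Qed.

End processes.

Lemma continuous_integrable_itv (R : realType) (f : R -> R) (a b : R) :
  continuous f -> lebesgue_measure.-integrable `[a, b] (EFin \o f).
Proof.
move=> cf; apply: continuous_compact_integrable; first exact: segment_compact.
exact: continuous_subspaceT.
Qed.

(** The tangent inequality at [J], integrated against [k]. A mass at most 1, instead of equal to 1,
    suffices because [J] is nonnegative. *)
Lemma jensen_Rintegral (R : realType) (k g : R -> R) (a b : R) (p : nat) :
  continuous k -> continuous g -> (forall s, 0 <= k s) -> (forall s, 0 <= g s) ->
  \int[lebesgue_measure]_(s in `[a, b]) k s <= 1 ->
  (\int[lebesgue_measure]_(s in `[a, b]) (k s * g s)) ^+ p.+1 <=
  \int[lebesgue_measure]_(s in `[a, b]) (k s * g s ^+ p.+1).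
Proof.
move=> ck cg k0 g0 k1.
set J := \int[lebesgue_measure]_(s in `[a, b]) (k s * g s).
have J0 : 0 <= J by apply: Rintegral_ge0 => s _; rewrite mulr_ge0.
have ckg : continuous (fun s => k s * g s).
  exact: continuous_funM.
have ckgp : continuous (fun s => k s * g s ^+ p.+1).
  by apply: continuous_funM => //; exact: continuous_funX.
have h : \int[lebesgue_measure]_(s in `[a, b]) (p.+1%:R * J ^+ p * (k s * g s)) <=
  \int[lebesgue_measure]_(s in `[a, b]) (k s * g s ^+ p.+1 + p%:R * J ^+ p.+1 * k s).
  apply: le_Rintegral => //.
  - apply: continuous_integrable_itv.
    by apply: continuous_funM => //; exact: continuous_fun_cst.
  - apply: continuous_integrable_itv; apply: continuous_funD => //.
    by apply: continuous_funM => //; exact: continuous_fun_cst.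
  - move=> s _; have := ler_wpM2l (k0 s) (young_exprn p.+1 J0 (g0 s)).
    by rewrite -natr1 addrK /= => H; lra.
move: h; rewrite RintegralD//; last 2 first.
  exact: continuous_integrable_itv.
  apply: continuous_integrable_itv.
  by apply: continuous_funM => //; exact: continuous_fun_cst.
rewrite !RintegralZl//; [|exact: continuous_integrable_itv..].
rewrite -/J => h.
have := ler_wpM2l (mulr_ge0 (ler0n R p) (exprn_ge0 p.+1 J0)) k1.
move: h; rewrite mulr1 exprS -natr1.
by lra.
Qed.

Section moments_of_integrals.
Context (R : realType) (d : measure_display) (T : measurableType d)
  (P : probability T R).
Local Notation mu := (@lebesgue_measure R).

(** Jensen's inequality on each path for the weight [k i], then Tonelli's theorem to exchange time
    and expectation. The moments of [g] must be bounded uniformly over the times of the interval,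
    hence the index set of pairs. *)
Lemma unif_moments_integral (I : Type) (D : set I) (a b : I -> R)
    (k : I -> R -> R) (g : I -> R -> T -> R) :
  (forall i, D i -> continuous (k i)) -> (forall i s, D i -> 0 <= k i s) ->
  (forall i, D i -> \int[mu]_(s in `[a i, b i]) k i s <= 1) ->
  (forall i s, D i -> measurable_fun setT (g i s)) ->
  (forall i w, D i -> continuous (fun s => g i s w)) ->
  unif_moments P [set q | D q.1 /\ a q.1 <= q.2 <= b q.1]
    (fun q w => g q.1 q.2 w) ->
  unif_moments P D (fun i w => \int[mu]_(s in `[a i, b i]) (k i s * g i s w)).
Proof.
move=> ck k0 k1 mg cg [_ hg].
have mk i s : D i -> measurable_fun setT (fun w => k i s * g i s w).
  by move=> Di; apply: measurable_funM => //; exact: mg.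
have ckg i w : D i -> continuous (fun s => k i s * g i s w).
  by move=> Di; apply: continuous_funM; [exact: ck|exact: cg].
have mJ i : D i ->
    measurable_fun setT (fun w => \int[mu]_(s in `[a i, b i]) (k i s * g i s w)).
  move=> Di; apply: measurable_Rintegral_process => [s|w]; first exact: mk.
  exact: ckg.
split=> // p; case: p => [|p].
  exists 1 => i Di; under eq_integral do rewrite expr0.
  by rewrite integral_cst// mul1e probability_le1.
(* The absolute value is taken because [hC] forces no sign on [C] when there is no admissible
   time. *)
have [C hC] := hg p.+1; exists `|C| => i Di.
pose h s w := k i s * `|g i s w| ^+ p.+1.
have ch w : continuous (h^~ w).
  apply: continuous_funM; first exact: ck.
  by apply: continuous_funX; apply: continuous_fun_norm; exact: cg.
have cn w : continuous (fun s => `|g i s w|).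
  by apply: continuous_fun_norm; exact: cg.
have mh s : measurable_fun setT (h s).
  apply: measurable_funM => //; apply: measurable_funX.
  by apply: measurableT_comp => //; exact: mg.
have h0 s w : 0 <= h s w by rewrite mulr_ge0 ?k0// exprn_ge0.
have cCk : continuous (fun s => `|C| * k i s).
  by apply: continuous_funM; [exact: continuous_fun_cst|exact: ck].
have mCk : measurable_fun [set: R] (fun s => `|C| * k i s).
  exact: continuous_measurable_fun.
apply: (@le_trans _ _ (\int[P]_w \int[mu]_s (h s w * \1_`[a i, b i] s)%:E)%E).
  apply: ge0_le_integral => //.
  - exact: measurable_normX (mJ i Di).
  - apply: (measurable_fun_fubini_tonelli_F (m2 := mu)
      (fun z : T * R => (h z.2 z.1 * \1_`[a i, b i] z.2)%:E)).
      apply/measurable_EFinP; apply: measurable_funM.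
        exact: measurable_process.
      by apply: measurableT_comp.
    by move=> [w s] /=; rewrite lee_fin mulr_ge0.
  - move=> w _.
    apply: (@le_trans _ _
       ((\int[mu]_(s in `[a i, b i]) (k i s * `|g i s w|)) ^+ p.+1)%:E).
      rewrite lee_fin lerXn2r ?nnegrE//.
        by apply: Rintegral_ge0 => s _; rewrite mulr_ge0 ?k0.
      apply: le_trans (le_normr_Rintegral _ _) _ => //.
        by apply: continuous_integrable_itv; exact: ckg.
      rewrite le_eqVlt; apply/orP; left; apply/eqP; apply: eq_Rintegral => s _.
      by rewrite normrM ger0_norm// k0.
    apply: (@le_trans _ _ (\int[mu]_(s in `[a i, b i]) h s w)%:E).
      rewrite lee_fin jensen_Rintegral//; [exact: ck|by move=> s; exact: k0|exact: k1].
    rewrite /Rintegral fineK; last first.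
      exact: integrable_fin_num (continuous_integrable_itv _ _ (ch w)).
    rewrite integral_mkcond/=.
    rewrite le_eqVlt; apply/orP; left; apply/eqP; apply: eq_integral => s _.
    by rewrite patchE indicE; case: ifP => _; rewrite ?mulr1 ?mulr0.
rewrite (fubini_tonelli (m1 := P) (m2 := mu)
   (fun z : T * R => (h z.2 z.1 * \1_`[a i, b i] z.2)%:E)) /=; last 2 first.
  apply/measurable_EFinP; apply: measurable_funM; first exact: measurable_process.
  by apply: measurableT_comp.
  by move=> [w s] /=; rewrite lee_fin mulr_ge0.
apply: (@le_trans _ _ (\int[mu]_s (`|C| * k i s * \1_`[a i, b i] s)%:E)%E).
  apply: ge0_le_integral => //.
  - move=> s _; apply: integral_ge0 => w _; by rewrite lee_fin mulr_ge0.
  - apply: (measurable_fun_fubini_tonelli_G (m1 := P)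
      (fun z : T * R => (h z.2 z.1 * \1_`[a i, b i] z.2)%:E)).
      apply/measurable_EFinP; apply: measurable_funM.
        exact: measurable_process.
      by apply: measurableT_comp.
    by move=> [w s] /=; rewrite lee_fin mulr_ge0.
  - by apply/measurable_EFinP; apply: measurable_funM.
  - move=> s _; rewrite indicE; case: (boolP (s \in _)) => sab; last first.
      rewrite mulr0; under eq_integral do rewrite mulr0.
      by rewrite integral0.
    rewrite mulr1; under eq_integral do rewrite mulr1 /h EFinM.
    rewrite ge0_integralZl//; last 2 first.
      exact: measurable_normX (mg i s Di).
      by rewrite lee_fin k0.
    rewrite mulrC EFinM lee_wpmul2l ?lee_fin ?k0//.
    have := hC (i, s); move: sab; rewrite inE/= in_itv/= => sab.
    by move=> /(_ (conj Di sab)) /le_trans; apply; rewrite lee_fin ler_norm.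
rewrite [X in (X <= _)%E](_ : _ = (\int[mu]_(s in `[a i, b i]) (`|C| * k i s))%:E).
  rewrite lee_fin RintegralZl//; last by apply: continuous_integrable_itv; exact: ck.
  by rewrite -[leRHS]mulr1 ler_wpM2l// k1.
rewrite /Rintegral fineK; last first.
  exact: integrable_fin_num (continuous_integrable_itv _ _ cCk).
rewrite [RHS]integral_mkcond/=; apply: eq_integral => s _.
by rewrite patchE indicE; case: ifP => _; rewrite ?mulr1 ?mulr0.
Qed.

End moments_of_integrals.

(** * Gaussian moments *)

Section gaussian_moments.
Context (R : realType) (d : measure_display) (T : measurableType d)
  (P : probability T R).
Local Notation mu := (@lebesgue_measure R).

(** Change of variables holds with the Radon-Nikodym derivative of [normal_prob], which agrees
    almost everywhere with [normal_pdf] since both have the same integral over every measurable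
    set. *)
Lemma ge0_integral_normal_prob (m s : R) (f : R -> \bar R) :
  measurable_fun setT f -> (forall x, 0 <= f x)%E ->
  (\int[normal_prob m s]_x f x = \int[mu]_x (f x * (normal_pdf m s x)%:E))%E.
Proof.
move=> mf f0; have dom := @normal_prob_dominates R m s.
rewrite -(Radon_Nikodym_SigmaFinite.change_of_variables dom f0 measurableT mf).
have intf := Radon_Nikodym_SigmaFinite.f_integrable dom.
apply: ae_eq_integral => //.
- by apply: emeasurable_funM => //; exact: measurable_int (intf).
- by apply: emeasurable_funM => //; apply/measurable_EFinP; exact: measurable_normal_pdf.
- apply: ae_eqe_mul2l; apply: integral_ae_eq => //.
  + by apply/measurable_EFinP; exact: measurable_normal_pdf.
  + by move=> E _ mE; rewrite -Radon_Nikodym_SigmaFinite.f_integral.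
Qed.

Variables (Z : T -> R) (s : R).
Hypotheses (s0 : 0 < s) (mZ : measurable_fun setT Z).
Hypothesis lawZ : forall A, measurable A -> P (Z @^-1` A) = normal_prob 0 s A.

Lemma ge0_integral_gaussian (f : R -> \bar R) :
  measurable_fun setT f -> (forall x, 0 <= f x)%E ->
  (\int[P]_w f (Z w) = \int[mu]_x (f x * (normal_pdf 0 s x)%:E))%E.
Proof.
move=> mf f0; rewrite -ge0_integral_normal_prob//.
have mZ' : measurable_fun setT (Z : T -> measurableTypeR R) by [].
rewrite -(@eq_measure_integral _ _ R setT (normal_prob 0 s)
  (measure_function_pushforward__canonical__measure_function_Measure P mZ')); last first.
  by move=> A mA _; exact: lawZ.
by rewrite ge0_integral_pushforward.
Qed.

(* Multiplying the density by the exponential gives b times the density of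
   N(0, (s b)^2). *)
Lemma gaussian_expR_sqr (b : R) : 0 < b ->
  (\int[P]_w (expR ((1 - b ^- 2) / 2 * (Z w / s) ^+ 2))%:E = b%:E)%E.
Proof.
move=> b0.
have key (x : R) : expR ((1 - b ^- 2) / 2 * (x / s) ^+ 2) * normal_pdf 0 s x =
    b * normal_pdf 0 (s * b) x.
  have sn0 : s != 0 by rewrite gt_eqF.
  have bn0 : b != 0 by rewrite gt_eqF.
  rewrite !normal_pdfE ?mulf_neq0//.
  have -> : normal_peak s = b * normal_peak (s * b).
    rewrite /normal_peak exprMn.
    rewrite [X in b * (Num.sqrt X)^-1](_ : _ = b ^+ 2 * (s ^+ 2 * pi *+ 2)).
      rewrite sqrtrM ?sqr_ge0// sqrtr_sqr gtr0_norm// invfM.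
      by rewrite mulrA divff// mul1r.
    by rewrite mulrnAr; congr (_ *+ _); ring.
  have <- : expR ((1 - b ^- 2) / 2 * (x / s) ^+ 2) * normal_fun 0 s x =
      normal_fun 0 (s * b) x.
    rewrite /normal_fun -expRD; congr expR; rewrite !subr0.
    by field; rewrite sn0 bn0.
  by ring.
rewrite (ge0_integral_gaussian
  (f := fun x => (expR ((1 - b ^- 2) / 2 * (x / s) ^+ 2))%:E)); last 2 first.
- apply/measurable_EFinP; apply: measurableT_comp => //.
  apply: measurable_funM => //; apply: measurable_funX.
  exact: measurable_funM.
- by move=> x; rewrite lee_fin expR_ge0.
transitivity (\int[mu]_x (b%:E * (normal_pdf 0 (s * b) x)%:E))%E; last first.
  rewrite integralZl//; last exact: integrable_normal_pdf.
  by rewrite integral_normal_pdf mule1.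
apply: eq_integral => x _; rewrite -!EFinM; congr EFin; exact: key.
Qed.

(* The exponential tilt shifts the density. *)
Lemma gaussian_expR (r : R) :
  (\int[P]_w (expR (r * Z w))%:E = (expR (r ^+ 2 * s ^+ 2 / 2))%:E)%E.
Proof.
rewrite (ge0_integral_gaussian (f := fun x => (expR (r * x))%:E)); last 2 first.
- by apply/measurable_EFinP; apply: measurableT_comp.
- by move=> x; rewrite lee_fin expR_ge0.
transitivity (\int[mu]_x ((expR (r ^+ 2 * s ^+ 2 / 2))%:E *
    (normal_pdf (r * s ^+ 2) s x)%:E))%E; last first.
  rewrite integralZl//; last exact: integrable_normal_pdf.
  by rewrite integral_normal_pdf mule1.
apply: eq_integral => x _; rewrite -!EFinM; congr EFin.
have sn0 : s != 0 by rewrite gt_eqF.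
rewrite !normal_pdfE// mulrCA [RHS]mulrCA; congr (_ * _).
rewrite /normal_fun -!expRD; congr expR.
by field.
Qed.

(** u <= exp u at u = |y| / p gives |y|^p <= p^p exp |y|, and 1 + y^2 / 4 - |y| is a square. The
    rate 1/4 stays below the rate 1/2 of the Gaussian density, so the bound is integrable. *)
Lemma exprn_le_expR_sqr (p : nat) (y : R) :
  `|y| ^+ p <= p%:R ^+ p * expR 1 * expR (y ^+ 2 / 4).
Proof.
have le1 : `|y| <= 1 + y ^+ 2 / 4.
  by rewrite -(real_normK (num_real y)); have := sqr_ge0 (`|y| / 2 - 1); nra.
apply: (@le_trans _ _ (p%:R ^+ p * expR `|y|)); last first.
  by rewrite -mulrA -expRD ler_wpM2l ?exprn_ge0// ler_expR.
case: p => [|p]; first by rewrite !expr0 mul1r -expR0 ler_expR.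
have -> : expR `|y| = expR (`|y| / p.+1%:R) ^+ p.+1.
  by rewrite -expRM_natl mulrC divfK.
rewrite -exprMn lerXn2r ?nnegrE ?mulr_ge0 ?expR_ge0//.
have h := ler_wpM2l (ler0n R p.+1) (expR_ge1Dx (`|y| / p.+1%:R)).
rewrite mulrDr mulr1 [_ * (_ / _)]mulrC divfK// in h.
by apply: le_trans h; rewrite lerDr.
Qed.

(** The choice b = sqrt 2 turns the exponent (1 - b^-2) / 2 of [gaussian_expR_sqr] into 1/4. The
    bound is free of [s], hence uniform over all increments. *)
Lemma gaussian_moment_le (p : nat) :
  (\int[P]_w (`|Z w / s| ^+ p)%:E <=
   (p%:R ^+ p * expR 1 * Num.sqrt 2)%:E)%E.
Proof.
have q0 : 0 < Num.sqrt 2 :> R by rewrite sqrtr_gt0.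
have e : (1 - Num.sqrt 2 ^- 2) / 2 = 1 / 4 :> R.
  by rewrite sqr_sqrtr//; lra.
rewrite EFinM -(gaussian_expR_sqr q0) e -ge0_integralZl//; last first.
  apply/measurable_EFinP; apply: measurableT_comp => //.
  apply: measurable_funM => //; apply: measurable_funX.
  exact: measurable_funM.
apply: ge0_le_integral => //.
- by apply: measurable_normX; apply: measurable_funM.
- apply: measurable_funeM; apply/measurable_EFinP; apply: measurableT_comp => //.
  apply: measurable_funM => //; apply: measurable_funX.
  exact: measurable_funM.
- move=> w _; rewrite -EFinM lee_fin; apply: le_trans (exprn_le_expR_sqr _ _) _.
  by rewrite mul1r mulrC [4^-1 * _]mulrC mulrC.
Qed.

Lemma gaussian_unif_moments :
  unif_moments P [set: unit] (fun _ w => Z w / s).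
Proof.
split=> [_ _|p]; first exact: measurable_funM.
by eexists => _ _; exact: gaussian_moment_le.
Qed.

Lemma gaussian_unif_moments_unscaled : unif_moments P [set: unit] (fun _ => Z).
Proof.
have -> : (fun _ : unit => Z) = (fun _ w => s * (Z w / s)).
  by apply/funext => _; apply/funext => w; rewrite mulrC divfK// gt_eqF.
exact/unif_momentsZ/gaussian_unif_moments.
Qed.

(** Integrating 1 + r Z <= exp (r Z) gives r m <= exp (r^2 s^2 / 2) - 1, which is of order r^2;
    small r of either sign then forces m = 0. *)
Lemma gaussian_mean : \int[P]_w Z w = 0.
Proof.
have iZ : P.-integrable setT (EFin \o Z).
  exact: (unif_moments_integrable gaussian_unif_moments_unscaled (i := tt)).
set m := \int[P]_w Z w.
have key r : r * m <= expR (r ^+ 2 * s ^+ 2 / 2) - 1.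
  have iD : P.-integrable setT (EFin \o (fun w => 1 + r * Z w)).
    by apply: integrable_funD; [exact: integrable_fun_cst|exact: integrable_funZ].
  rewrite lerBrDl -lee_fin -gaussian_expR.
  have -> : (1 + r * m)%:E = (\int[P]_w (1 + r * Z w)%:E)%E.
    rewrite -EFin_Rintegral// RintegralD//; last exact: integrable_funZ.
      by rewrite RintegralZl// Rintegral_probability_cst.
    exact: integrable_fun_cst.
  apply: le_integral => //.
  - apply/integrableP; split.
      by apply/measurable_EFinP; apply: measurableT_comp => //; exact: measurable_funM.
    under eq_integral do rewrite gee0_abs ?lee_fin ?expR_ge0//.
    by rewrite gaussian_expR ltry.
  - by move=> w _; rewrite lee_fin expR_ge1Dx.
(* exp u - 1 <= 2 u for 0 <= u <= 1/2, a consequence of exp (- u) >= 1 - u. *)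
have key2 r : r ^+ 2 * s ^+ 2 <= 1 -> r * m <= r ^+ 2 * s ^+ 2.
  move=> h; apply: le_trans (key r) _.
  set u := r ^+ 2 * s ^+ 2 / 2.
  have u0 : 0 <= u by rewrite /u divr_ge0// mulr_ge0 ?sqr_ge0.
  have -> : r ^+ 2 * s ^+ 2 = 2 * u by rewrite /u; lra.
  have u1 : u <= 1 / 2 by rewrite /u; lra.
  have := expR_ge1Dx (- u); have := expRxMexpNx_1 u.
  have := expR_gt0 u; set a := expR u; set b := expR (- u) => a0 ab hb.
  nra.
have s2 : 0 < s ^+ 2 by rewrite exprn_gt0.
have bound e : 0 < e -> e * s <= 1 -> `|m| <= e * s ^+ 2.
  move=> e0 es.
  have es2 : e ^+ 2 * s ^+ 2 <= 1.
    by rewrite -exprMn exprn_ile1// mulr_ge0 ?ltW.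
  have h1 := key2 e es2.
  have := key2 (- e); rewrite sqrrN => /(_ es2) h2.
  rewrite ler_norml; apply/andP; split.
    rewrite -(ler_pM2l e0); move: h2; rewrite mulNr; lra.
  by rewrite -(ler_pM2l e0); move: h1; lra.
apply/eqP; rewrite -normr_eq0 eq_le normr_ge0 andbT.
apply/ler_addgt0Pr => e e0; rewrite add0r.
pose e' := Num.min (e / s ^+ 2) s^-1.
have e'0 : 0 < e' by rewrite lt_min divr_gt0//= invr_gt0.
apply: le_trans (bound e' e'0 _) _.
  by rewrite -ler_pdivlMr// div1r ge_min lexx orbT.
by rewrite -ler_pdivlMr// ge_min lexx.
Qed.

(** The same device for the square: 1 + x <= exp x gives 1 + (1 - b^-2) / 2 v <= b for every b > 0,
    with equality at b = 1. Letting b tend to 1 from both sides pins v to 1. *)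
Lemma gaussian_variance : \int[P]_w (Z w ^+ 2) = s ^+ 2.
Proof.
have iY : P.-integrable setT (EFin \o (fun w => (Z w / s) ^+ 2)).
  exact: (unif_moments_integrable (unif_momentsX 2 gaussian_unif_moments) (i := tt)).
set v := \int[P]_w (Z w / s) ^+ 2.
have v0 : 0 <= v by apply: Rintegral_ge0 => w _; rewrite sqr_ge0.
suff v1 : v = 1.
  transitivity (\int[P]_w (s ^+ 2 * (Z w / s) ^+ 2)).
    apply: eq_Rintegral => w _; rewrite -exprMn mulrC divfK//.
    by rewrite gt_eqF.
  by rewrite RintegralZl// -/v v1 mulr1.
have key b : 0 < b -> 1 + (1 - b ^- 2) / 2 * v <= b.
move=> b0; rewrite -lee_fin -(gaussian_expR_sqr b0).
  have iD : P.-integrable setT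
      (EFin \o (fun w => 1 + (1 - b ^- 2) / 2 * (Z w / s) ^+ 2)).
    by apply: integrable_funD; [exact: integrable_fun_cst|exact: integrable_funZ].
  have -> : (1 + (1 - b ^- 2) / 2 * v)%:E =
    (\int[P]_w (1 + (1 - b ^- 2) / 2 * (Z w / s) ^+ 2)%:E)%E.
    rewrite -EFin_Rintegral// RintegralD//; last exact: integrable_funZ.
      by rewrite RintegralZl// Rintegral_probability_cst.
    exact: integrable_fun_cst.
  apply: le_integral => //.
  - apply/integrableP; split.
      apply/measurable_EFinP; apply: measurableT_comp => //.
      apply: measurable_funM => //; apply: measurable_funX.
      exact: measurable_funM.
    under eq_integral do rewrite gee0_abs ?lee_fin ?expR_ge0//.
    by rewrite gaussian_expR_sqr// ltry.
  - by move=> w _; rewrite lee_fin expR_ge1Dx.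
have key2 b : 0 < b -> (b - 1) * ((b + 1) * v) <= (b - 1) * (2 * b ^+ 2).
  move=> b0; have b2 : 0 < 2 * b ^+ 2 by rewrite mulr_gt0// exprn_gt0.
  have := key b b0; rewrite -(ler_pM2l b2) => h.
  have -> : (b - 1) * ((b + 1) * v) =
    2 * b ^+ 2 * (1 + (1 - b ^- 2) / 2 * v) - 2 * b ^+ 2.
    by field; rewrite gt_eqF.
  lra.
have up e : 0 < e -> v <= 1 + e * 3.
  move=> e0; wlog e1 : e e0 / e <= 1.
    move=> h; have [e1|/ltW e1] := leP e 1; first exact: h.
    by apply: le_trans (h 1 ltr01 (lexx 1)) _; lra.
  have := key2 (1 + e) (addr_gt0 ltr01 e0).
  have -> : 1 + e - 1 = e by ring.
  rewrite ler_pM2l// => h; nra.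
have dn e : 0 < e -> e <= 1 / 2 -> 1 - e * 2 <= v.
  move=> e0 e1; have := key2 (1 - e); rewrite subr_gt0.
  have -> : 1 - e - 1 = - e by ring.
  rewrite !mulNr lerN2 ler_pM2l// => h.
  have {}h := h (le_lt_trans e1 _).
  have : 2 * (1 - e) ^+ 2 <= (1 - e + 1) * v by apply: h; lra.
  nra.
apply/eqP; rewrite eq_le; apply/andP; split.
  apply/ler_addgt0Pr => e e0; have := up (e / 3); rewrite divfK//; apply.
  by rewrite divr_gt0.
apply/ler_addgt0Pr => e e0.
have := dn (Num.min (e / 2) (1 / 2)).
rewrite lt_min !divr_gt0//= ge_min lexx orbT => /(_ isT isT).
have : Num.min (e / 2) (1 / 2) <= e / 2 by rewrite ge_min lexx.
lra.
Qed.

End gaussian_moments.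

(** * Variation of constants and the double-well equation *)

Section real_derivatives.
Variable R : realType.
Implicit Types (f g : R -> R) (s a b : R).

Lemma is_derive_funM f g s a b : is_derive s 1 f a -> is_derive s 1 g b ->
  is_derive s 1 (fun y => f y * g y) (a * g s + f s * b).
Proof.
move=> hf hg; have h := is_deriveM hf hg.
by apply: (is_derive_eq h); rewrite /GRing.scale/= addrC [_ * a]mulrC.
Qed.

Lemma is_derive_funD f g s a b : is_derive s 1 f a -> is_derive s 1 g b ->
  is_derive s 1 (fun y => f y + g y) (a + b).
Proof. by move=> hf hg; exact: is_deriveD hf hg. Qed.

Lemma is_derive_funB f g s a b : is_derive s 1 f a -> is_derive s 1 g b ->
  is_derive s 1 (fun y => f y - g y) (a - b).
Proof. by move=> hf hg; exact: is_deriveB hf hg. Qed.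

Lemma is_derive_fun_cst (k : R) s : is_derive s 1 (fun _ : R => k) 0.
Proof. exact: is_derive_cst. Qed.

Lemma is_derive_funZ f s a (k : R) : is_derive s 1 f a ->
  is_derive s 1 (fun y => k * f y) (k * a).
Proof.
move=> hf; apply: (is_derive_eq (is_derive_funM (is_derive_fun_cst k s) hf)).
by rewrite mul0r add0r.
Qed.

Lemma is_derive_funX f s a n : is_derive s 1 f a ->
  is_derive s 1 (fun y => f y ^+ n.+1) (n.+1%:R * f s ^+ n * a).
Proof.
move=> hf; elim: n => [|n IH].
  by apply: (is_derive_eq hf); rewrite expr0 !mul1r.
have h := is_derive_funM hf IH.
rewrite [X in is_derive _ _ X](_ : _ = fun y => f y * f y ^+ n.+1); last first.
  by apply/funext => y; rewrite -exprS.
by apply: (is_derive_eq h); rewrite !exprS -!natr1; ring.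
Qed.

Lemma is_derive_funV f s a : f s != 0 -> is_derive s 1 f a ->
  is_derive s 1 (fun y => (f y)^-1) (- a / f s ^+ 2).
Proof.
move=> fs hf; apply: (is_derive_eq (is_deriveV fs hf)).
by rewrite /GRing.scale/= !mulNr mulrC.
Qed.

Lemma is_derive_fun_expR (k : R) s :
  is_derive s 1 (fun y => expR (k * y)) (k * expR (k * s)).
Proof.
have h : is_derive s 1 (fun y => k * y) k.
  by apply: (is_derive_eq (is_derive_funZ k (is_derive_id s (1 : R)))); rewrite mulr1.
by apply: (is_derive_eq (is_derive1_comp (is_derive_expR (k * s)) h)); rewrite mulrC.
Qed.

Lemma continuous_fun_expR (k : R) : continuous (fun y => expR (k * y)).
Proof.
apply: continuous_fun_comp; last exact: continuous_expR.
by apply: continuous_funM; [exact: continuous_fun_cst|move=> x; exact: cvg_id].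
Qed.

Lemma continuous_funV f : continuous f -> (forall s, f s != 0) ->
  continuous (fun y => (f y)^-1).
Proof. by move=> cf f0 s; apply: cvgV; [exact: f0|exact: cf]. Qed.

(** The fundamental theorem is applied on [[0, s + 1]] to make [s] an interior point; near [s > 0]
    only nonnegative times occur. *)
Lemma is_derive_Rintegral f g (c s : R) : continuous f ->
  (forall t, 0 <= t -> g t = c + \int[lebesgue_measure]_(y in `[0, t]) f y) ->
  0 < s -> is_derive s 1 g (f s).
Proof.
move=> cf hg s0.
have ss1 : s < s + 1 by rewrite ltrDl.
have [d1 d2] := continuous_FTC1_closed ss1
  (continuous_integrable_itv 0 (s + 1) cf) s0 (cf s).
pose F := fun x => \int[lebesgue_measure]_(t in `[0, x]) f t.
have hF : is_derive s 1 F (f s) by rewrite -d2 derive1E; exact: derivableP.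
have h : is_derive s 1 (fun x => c + F x) (f s).
  by apply: (is_derive_eq (is_derive_funD (is_derive_fun_cst c s) hF)); rewrite add0r.
apply: (near_eq_is_derive _ h); near=> y; apply/esym/hg.
by apply: ltW; near: y; exact: lt_nbhsr.
Unshelve. all: by end_near. Qed.

Lemma Rintegral_derive f g a b : a <= b -> continuous f -> continuous g ->
  (forall s, a < s < b -> is_derive s 1 g (f s)) ->
  \int[lebesgue_measure]_(y in `[a, b]) f y = g b - g a.
Proof.
rewrite le_eqVlt => /predU1P[<- _ _ _|ab cf cg hg].
  by rewrite set_itv1 Rintegral_set1 subrr.
rewrite /Rintegral (continuous_FTC2 (F := g) ab)//.
- exact: continuous_subspaceT.
- split.
  + by move=> s; rewrite in_itv/= => /hg [].
  + by apply: cvg_at_right_filter; exact: cg.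
  + by apply: cvg_at_left_filter; exact: cg.
- move=> s; rewrite in_itv/= => /hg h.
  by rewrite derive1E; exact: derive_val.
Qed.

(** The derivative [2 * a * x ^+ 2] of the square is nonpositive, so a square starting at 0 stays at
    0; the sign of [a] replaces Gronwall's lemma. *)
Lemma linear_ode_zero (a x : R -> R) : continuous a -> continuous x ->
  (forall s, a s <= 0) -> x 0 = 0 ->
  (forall s, 0 < s -> is_derive s 1 x (a s * x s)) ->
  forall t, 0 <= t -> x t = 0.
Proof.
move=> ca cx a0 x0 hx t t0; apply/eqP; rewrite -sqrf_eq0 eq_le sqr_ge0 andbT.
have : \int[lebesgue_measure]_(s in `[0, t]) (2 * a s * x s ^+ 2) = x t ^+ 2 - x 0 ^+ 2.
  apply: (Rintegral_derive (g := fun s => x s ^+ 2)) => //.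
  - apply: continuous_funM; last exact: continuous_funX.
    by apply: continuous_funM => //; exact: continuous_fun_cst.
  - exact: continuous_funX.
  - move=> s /andP[s0 _]; apply: (is_derive_eq (is_derive_funX 1 (hx s s0))).
    by rewrite expr1; ring.
rewrite x0 expr0n subr0 => <-.
rewrite -oppr_ge0 -mulN1r -RintegralZl//.
  apply: Rintegral_ge0 => s _; have := a0 s; have := sqr_ge0 (x s); nra.
apply: continuous_integrable_itv.
apply: continuous_funM; last exact: continuous_funX.
by apply: continuous_funM => //; exact: continuous_fun_cst.
Qed.

(** [E] solves the homogeneous equation, so the derivative of [x / E] is [r / E]. *)
Lemma variation_of_constants (al r x E : R -> R) (x0 : R) :
  continuous al -> continuous r -> continuous x -> continuous E ->
  (forall s, E s != 0) -> E 0 = 1 ->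
  (forall s, 0 < s -> is_derive s 1 E (al s * E s)) ->
  forall t, 0 <= t ->
  (forall s, 0 <= s <= t -> x s = x0 +
     \int[lebesgue_measure]_(y in `[0, s]) (al y * x y + r y)) ->
  x t = E t * x0 + \int[lebesgue_measure]_(s in `[0, t]) (E t / E s * r s).
Proof.
move=> cal cr cx cE E0 E01 hE t t0 hx.
pose w s := x0 + \int[lebesgue_measure]_(y in `[0, s]) (al y * x y + r y).
have cf : continuous (fun y => al y * x y + r y).
  by apply: continuous_funD => //; exact: continuous_funM.
have hx' s : 0 < s < t -> is_derive s 1 x (al s * x s + r s).
  move=> /andP[s0 st]; apply: (near_eq_is_derive (f := w)); last first.
    by apply: (is_derive_Rintegral cf _ s0) => u u0.
  near=> y; apply/esym/hx; apply/andP; split; apply: ltW.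
    by near: y; exact: lt_nbhsr.
  by near: y; exact: lt_nbhsl.
have cEi : continuous (fun s => (E s)^-1) by exact: continuous_funV.
have key : \int[lebesgue_measure]_(s in `[0, t]) (r s / E s) = x t / E t - x 0 / E 0.
  apply: (Rintegral_derive (g := fun s => x s / E s)) => //.
  - exact: continuous_funM.
  - exact: continuous_funM.
  - move=> s s0t.
    have hEi := is_derive_funV (E0 s) (hE s (proj1 (andP s0t))).
    apply: (is_derive_eq (is_derive_funM (hx' s s0t) hEi)).
    by field; exact: E0.
have -> : \int[lebesgue_measure]_(s in `[0, t]) (E t / E s * r s) =
    E t * \int[lebesgue_measure]_(s in `[0, t]) (r s / E s).
  rewrite -RintegralZl//; last first.
    by apply: continuous_integrable_itv; exact: continuous_funM.
  by apply: eq_Rintegral => s _; rewrite mulrAC mulrA [E t * r s]mulrC.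
have xx0 : x 0 = x0.
  by rewrite hx ?lexx// set_itv1 Rintegral_set1 addr0.
rewrite key E01 xx0 divr1 mulrBr [E t * (_ / _)]mulrC divfK//; ring.
Unshelve. all: by end_near. Qed.

End real_derivatives.

(** * The double-well equation and its linearised flow in closed form *)

Section double_well.
Variables (R : realType) (xi lo hi : R) (x : R -> R).
Implicit Types s t : R.
Hypotheses (lo0 : 0 < lo) (lo1 : lo <= 1) (hi1 : 1 <= hi).
Hypothesis hxi : lo <= `|xi| <= hi.
Hypothesis cx : continuous x.
Hypothesis x_neg : forall s, s <= 0 -> x s = x 0.
Hypothesis hx : forall s, 0 <= s ->
  x s = xi + \int[lebesgue_measure]_(y in `[0, s]) (x y - x y ^+ 3).

(** For v = 1 / x^2 the equation x' = x - x^3 becomes the linear v' = 2 - 2 v; this is xi^2 v(s).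
    For s >= 0 it is a convex combination of xi^2 and 1, whence the normalisation
    [lo <= 1 <= hi]. *)
Definition dw_den s : R := xi ^+ 2 + (1 - xi ^+ 2) * expR (- 2 * s).

Let xi0 : xi != 0.
Proof. by rewrite -normr_gt0; case/andP: hxi => h _; exact: lt_le_trans h. Qed.

Let hi0 : 0 < hi. Proof. exact: lt_le_trans hi1. Qed.

Let lo_xi2 : lo ^+ 2 <= xi ^+ 2.
Proof.
case/andP: hxi => h _.
by rewrite -(real_normK (num_real xi)) lerXn2r ?nnegrE ?(ltW lo0).
Qed.

Let xi2_hi : xi ^+ 2 <= hi ^+ 2.
Proof.
case/andP: hxi => _ h.
by rewrite -(real_normK (num_real xi)) lerXn2r ?nnegrE ?(ltW hi0).
Qed.

Let lo2_1 : lo ^+ 2 <= 1. Proof. by rewrite exprn_ile1// ltW. Qed.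
Let hi2_1 : 1 <= hi ^+ 2. Proof. by rewrite exprn_ege1. Qed.

Let e01 s : 0 <= s -> 0 < expR (- 2 * s) <= 1.
Proof. by move=> s0; rewrite expR_gt0 -expR0 ler_expR mulNr oppr_le0 mulr_ge0. Qed.

Let den_lo s : 0 <= s -> lo ^+ 2 <= dw_den s.
Proof.
move=> /e01; rewrite /dw_den; move: (expR _) => e /andP[e0 e1].
have -> : xi ^+ 2 + (1 - xi ^+ 2) * e = lo ^+ 2 + (1 - e) * (xi ^+ 2 - lo ^+ 2) +
  e * (1 - lo ^+ 2) by ring.
by rewrite -addrA lerDl addr_ge0// mulr_ge0// ?subr_ge0// ltW.
Qed.

Let den_hi s : 0 <= s -> dw_den s <= hi ^+ 2.
Proof.
move=> /e01; rewrite /dw_den; move: (expR _) => e /andP[e0 e1].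
have -> : hi ^+ 2 = xi ^+ 2 + (1 - xi ^+ 2) * e + ((1 - e) * (hi ^+ 2 - xi ^+ 2) +
  e * (hi ^+ 2 - 1)) by ring.
by rewrite lerDl addr_ge0// mulr_ge0// ?subr_ge0// ltW.
Qed.

Let den_gt0 s : 0 <= s -> 0 < dw_den s.
Proof. by move=> /den_lo; apply: lt_le_trans; rewrite exprn_gt0. Qed.

Let cx3 : continuous (fun y => x y - x y ^+ 3).
Proof. by apply: continuous_funB => //; exact: continuous_funX. Qed.

Let dx s : 0 < s -> is_derive s 1 x (x s - x s ^+ 3).
Proof. by move=> s0; apply: (is_derive_Rintegral cx3 _ s0) => t t0; exact: hx. Qed.

Let x00 : x 0 = xi.
Proof. by rewrite hx// set_itv1 Rintegral_set1 addr0. Qed.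

(* x^2 dw_den - xi^2 solves a linear equation with nonpositive rate. *)
Lemma dw_sqr s : 0 <= s -> x s ^+ 2 * dw_den s = xi ^+ 2.
Proof.
move=> s0; apply/eqP; rewrite -subr_eq0; apply/eqP; move: s s0.
apply: (@linear_ode_zero _ (fun s => - 2 * x s ^+ 2)
  (fun s => x s ^+ 2 * dw_den s - xi ^+ 2)).
- by apply: continuous_funM; [exact: continuous_fun_cst|exact: continuous_funX].
- apply: continuous_funB; last exact: continuous_fun_cst.
  apply: continuous_funM; first exact: continuous_funX.
  apply: continuous_funD; first exact: continuous_fun_cst.
  by apply: continuous_funM; [exact: continuous_fun_cst|exact: continuous_fun_expR].
- by move=> s; rewrite mulNr oppr_le0 mulr_ge0// sqr_ge0.
- by rewrite x00 /dw_den mulr0 expR0; ring.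
- move=> s s0.
  have dd : is_derive s 1 dw_den ((1 - xi ^+ 2) * (- 2 * expR (- 2 * s))).
    apply: (is_derive_eq (is_derive_funD (is_derive_fun_cst (xi ^+ 2) s)
      (is_derive_funZ (1 - xi ^+ 2) (is_derive_fun_expR (- 2) s)))).
    by rewrite add0r.
  have h := is_derive_funB (is_derive_funM (is_derive_funX 1 (dx s0)) dd)
    (is_derive_fun_cst (xi ^+ 2) s).
  by apply: (is_derive_eq h); rewrite /dw_den; ring.
Qed.

Lemma dw_neq0 s : x s != 0.
Proof.
have [s0|/ltW s0] := leP 0 s; last by rewrite x_neg// x00.
apply/eqP => xs; have := dw_sqr s0; rewrite xs expr0n mul0r => /esym/eqP.
by rewrite sqrf_eq0 (negbTE xi0).
Qed.

(** [x] never vanishes, so by the intermediate value theorem it keeps the sign of [xi]. *)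
Lemma dw_ratio_gt0 s : 0 < x s / xi.
Proof.
rewrite lt_neqAle eq_sym mulf_neq0 ?invr_eq0 ?dw_neq0//= leNgt; apply/negP => h.
have [s0|/ltW s0] := leP 0 s; last first.
  by move: h; rewrite x_neg// x00 divff// ltr10.
have c : continuous (fun y => x y / xi).
  by apply: continuous_funM => //; exact: continuous_fun_cst.
have iv : Num.min (x 0 / xi) (x s / xi) <= 0 <= Num.max (x 0 / xi) (x s / xi).
  by rewrite x00 divff// ge_min le_max ler01 (ltW h) orbT.
have [y _ /eqP] := IVT s0 (continuous_subspaceT c) iv.
by rewrite mulf_eq0 invr_eq0 (negbTE xi0) (negbTE (dw_neq0 y)).
Qed.

(** Gives the solution as a function of [xi] and [s] alone, from which [X 0] will be seen to be
    measurable with respect to the initial datum. *)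
Lemma dw_formula s : 0 <= s -> x s = xi * Num.sqrt (dw_den s)^-1.
Proof.
move=> s0; have -> : (dw_den s)^-1 = (x s / xi) ^+ 2.
  have := dw_sqr s0; have := den_gt0 s0 => d0 h.
  rewrite expr_div_n -h; field.
  by rewrite dw_neq0 gt_eqF.
by rewrite sqrtr_sqr gtr0_norm ?dw_ratio_gt0// mulrC divfK.
Qed.

Lemma dw_abs_le s : `|x s| <= hi / lo.
Proof.
have [s0|/ltW s0] := leP 0 s; last first.
  rewrite x_neg// x00; case/andP: hxi => _ /le_trans; apply.
  by rewrite ler_pdivlMr// ler_piMr// ltW.
rewrite -[leRHS]ger0_norm; last by rewrite divr_ge0// ltW.
rewrite -ler_sqr ?nnegrE// !real_normK ?num_real//.
rewrite expr_div_n ler_pdivlMr ?exprn_gt0//.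
apply: le_trans xi2_hi; rewrite -(dw_sqr s0) ler_wpM2l ?sqr_ge0//.
exact: den_lo.
Qed.

(** [x ^+ 2 * dw_den] takes the same value at both times, and [dw_den] lies between [lo ^+ 2] and
    [hi ^+ 2]. *)
Lemma dw_ratio_le s t : 0 <= s -> 0 <= t -> `|x t| <= hi / lo * `|x s|.
Proof.
move=> s0 t0; rewrite -[hi / lo]ger0_norm; last by rewrite divr_ge0// ltW.
rewrite -normrM -ler_sqr ?nnegrE// !real_normK ?num_real//.
rewrite exprMn expr_div_n mulrAC ler_pdivlMr ?exprn_gt0//.
apply: (@le_trans _ _ (xi ^+ 2)).
  rewrite -(dw_sqr t0) ler_wpM2l ?sqr_ge0//; exact: den_lo.
by rewrite -(dw_sqr s0) mulrC ler_wpM2r ?sqr_ge0//; exact: den_hi.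
Qed.

(** As [x] has the sign of [sg], |x + sg| >= 1 and thus |x - sg| <= |x^2 - 1|; the latter is
    explicit, x^2 - 1 = (xi^2 - 1) exp (- 2 s) / dw_den s. *)
Lemma dw_limit (sg : R) s : sg ^+ 2 = 1 -> 0 < sg * xi -> 0 <= s ->
  `|x s - sg| <= (hi / lo) ^+ 2 * expR (- 2 * s).
Proof.
move=> sg2 sgxi s0.
have xsg : 0 < x s * sg.
  have -> : x s * sg = x s / xi * (sg * xi) by field.
  by rewrite mulr_gt0// dw_ratio_gt0.
have h1 : `|x s - sg| <= `|x s ^+ 2 - 1|.
  have -> : x s ^+ 2 - 1 = (x s - sg) * (x s + sg).
    by rewrite -sg2; ring.
  rewrite normrM ler_peMr//.
  rewrite -(@ler_pXn2r _ 2)// ?nnegrE// expr1n real_normK ?num_real//.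
  have -> : (x s + sg) ^+ 2 = x s ^+ 2 + 2 * (x s * sg) + sg ^+ 2 by ring.
  by rewrite sg2 lerDr addr_ge0 ?sqr_ge0// mulr_ge0// ltW.
apply: le_trans h1 _.
have d0 := den_gt0 s0.
have -> : x s ^+ 2 - 1 = (xi ^+ 2 - 1) * expR (- 2 * s) / dw_den s.
  apply: (mulIf (lt0r_neq0 d0)); rewrite divfK ?gt_eqF// mulrBl dw_sqr// mul1r.
  by rewrite /dw_den; ring.
rewrite !normrM normfV (gtr0_norm d0) (gtr0_norm (expR_gt0 _)).
rewrite mulrAC ler_wpM2r ?expR_ge0// expr_div_n.
rewrite ler_pM ?invr_ge0 ?(ltW d0)//; last first.
  by rewrite lef_pV2 ?posrE ?exprn_gt0//; exact: den_lo.
by rewrite ler_norml; apply/andP; split; move: (sqr_ge0 xi) xi2_hi hi2_1; lra.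
Qed.

(* Solves E' = (1 - 3 x^2) E, E(0) = 1, because x' = x (1 - x^2) gives
   (log x^3)' = 3 - 3 x^2. *)
Definition dw_flow s : R := expR (- 2 * s) * (x s / xi) ^+ 3.

Lemma dw_flow_continuous : continuous dw_flow.
Proof.
apply: continuous_funM; first exact: continuous_fun_expR.
apply: continuous_funX; apply: continuous_funM => //.
exact: continuous_fun_cst.
Qed.

Lemma dw_flow_neq0 s : dw_flow s != 0.
Proof.
apply: mulf_neq0; first by rewrite gt_eqF ?expR_gt0.
by apply: expf_neq0; rewrite gt_eqF ?dw_ratio_gt0.
Qed.

Lemma dw_flow0 : dw_flow 0 = 1.
Proof. by rewrite /dw_flow mulr0 expR0 x00 divff// expr1n mul1r. Qed.

Lemma dw_flow_derive s : 0 < s ->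
  is_derive s 1 dw_flow ((1 - 3 * x s ^+ 2) * dw_flow s).
Proof.
move=> s0.
have d1 := is_derive_funX 2 (is_derive_funM (dx s0) (is_derive_fun_cst xi^-1 s)).
apply: (is_derive_eq (is_derive_funM (is_derive_fun_expR (- 2) s) d1)).
by rewrite /dw_flow; field.
Qed.

(** The rate 2 is - f'(1) = - f'(-1) for f(x) = x - x^3. The excursions of 1 - 3 x^2 above - 2 are
    absorbed by [(x t / x s) ^+ 3], which is bounded by [dw_ratio_le]. *)
Lemma dw_flow_ratio s t : 0 <= s <= t ->
  `|dw_flow t / dw_flow s| <= (hi / lo) ^+ 3 * expR (- 2 * (t - s)).
Proof.
move=> /andP[s0 st]; have t0 := le_trans s0 st.
have -> : dw_flow t / dw_flow s = expR (- 2 * (t - s)) * (x t / x s) ^+ 3.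
  have -> : - 2 * (t - s) = - 2 * t + - (- 2 * s) by ring.
  rewrite expRD expRN /dw_flow.
  by field; rewrite dw_neq0 xi0 !gt_eqF ?expR_gt0.
rewrite normrM (gtr0_norm (expR_gt0 _)) mulrC ler_wpM2r ?expR_ge0//.
rewrite normrX lerXn2r ?nnegrE ?(divr_ge0 (ltW hi0) (ltW lo0))//.
rewrite normrM normfV ler_pdivrMr ?normr_gt0 ?dw_neq0//.
exact: dw_ratio_le.
Qed.

End double_well.

(** * The past of the Brownian motion *)

Section independence.
Context (R : realType) (d : measure_display) (T : measurableType d)
  (P : probability T R).

(** Independence on rectangles identifies the joint law of [(G, Z)] with the product of the laws, by
    uniqueness of the product measure; Fubini's theorem then factors the integral. *)
Lemma Rintegral_independentM (G Z : T -> R) :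
  measurable_fun setT G -> measurable_fun setT Z ->
  (forall B C, measurable B -> measurable C ->
    P (G @^-1` B `&` Z @^-1` C) = (P (G @^-1` B) * P (Z @^-1` C))%E) ->
  P.-integrable setT (EFin \o G) -> P.-integrable setT (EFin \o Z) ->
  P.-integrable setT (EFin \o (fun w => G w * Z w)) ->
  \int[P]_w (G w * Z w) = \int[P]_w G w * \int[P]_w Z w.
Proof.
move=> mG mZ ind iG iZ iGZ.
pose G' : {mfun T >-> R} := HB.pack G (isMeasurableFun.Build _ _ _ _ _ mG).
pose Z' : {mfun T >-> R} := HB.pack Z (isMeasurableFun.Build _ _ _ _ _ mZ).
have mGZ : measurable_fun setT (fun w => (G w, Z w)) by exact: measurable_fun_pair.
pose GZ' : {mfun T >-> (R * R)%type} :=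
  HB.pack (fun w => (G w, Z w)) (isMeasurableFun.Build _ _ _ _ _ mGZ).
pose f (z : R * R) : \bar R := (z.1 * z.2)%:E.
have mf : measurable_fun setT f by apply/measurable_EFinP; exact: measurable_funM.
have prodE X : measurable X ->
    (distribution P G' \x distribution P Z')%E X = distribution P GZ' X.
  by apply: product_measure_unique => A B mA mB; exact: ind.
have e1 : (\int[P]_w (G w * Z w)%:E =
    \int[distribution P G' \x distribution P Z']_z f z)%E.
  rewrite -[LHS](integral_distribution (X := GZ') mf iGZ).
  by apply: eq_measure_integral => A mA _; exact/esym/prodE.
have iprod : (distribution P G' \x distribution P Z')%E.-integrable setT f.
  apply/integrableP; split => //.
  rewrite (_ : (\int[_]_x _ = \int[distribution P GZ']_z `|f z|)%E); last first.
    by apply: eq_measure_integral => A mA _; exact: prodE.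
  rewrite ge0_integral_distribution//; last exact: measurableT_comp.
  by case/integrableP : iGZ.
rewrite /Rintegral e1 -integral12_prod_meas1//.
have iZ' : (\int[distribution P Z']_y y%:E = (\int[P]_w Z w)%:E)%E.
  by rewrite integral_distribution// EFin_Rintegral.
have iG' : (\int[distribution P G']_y y%:E = (\int[P]_w G w)%:E)%E.
  by rewrite integral_distribution// EFin_Rintegral.
have idZ : (distribution P Z').-integrable setT EFin.
  by apply: (@integrable_pushforward _ _ _ _ _ _ mZ) => //.
have idG : (distribution P G').-integrable setT EFin.
  by apply: (@integrable_pushforward _ _ _ _ _ _ mG) => //.
transitivity (fine (\int[distribution P G']_x (x * \int[P]_w Z w)%:E)%E).
  congr fine; apply: eq_integral => x _; rewrite /fubini_F /f/=.
  under eq_integral do rewrite EFinM.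
  by rewrite integralZl// iZ' EFinM.
rewrite (eq_integral (fun x : R => x%:E * (\int[P]_w Z w)%:E)%E); last first.
  by move=> x _; rewrite EFinM.
by rewrite integralZr// iG'.
Qed.

Lemma measure_ae_eq (A B N : set T) : measurable A -> measurable B ->
  measurable N -> P N = 0%E -> (forall w, ~ N w -> (A w <-> B w)) -> P A = P B.
Proof.
move=> mA mB mN N0.
suff h (C D : set T) : measurable C -> measurable D ->
    (forall w, ~ N w -> (C w <-> D w)) -> (P C <= P D)%E.
  move=> AB; apply/eqP; rewrite eq_le !h// => w /AB; tauto.
move=> mC mD CD; apply: (@le_trans _ _ (P (D `|` N))).
  apply: le_measure; rewrite ?inE//; first exact: measurableU.
  by move=> w Cw; have [?|/CD[+ _]] := pselect (N w); [right|left; auto].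
by rewrite -[leRHS]adde0 -N0; exact: measureU2.
Qed.

(** Dynkin's argument: for fixed [E], the events independent of [E] form a lambda-system containing
    the pi-system [G]. *)
Lemma independent_g_sigma (G : set (set T)) (E : set T) :
  setI_closed G -> G `<=` measurable -> measurable E ->
  (forall A, G A -> P (A `&` E) = (P A * P E)%E) ->
  forall A, <<s G >> A -> measurable A /\ P (A `&` E) = (P A * P E)%E.
Proof.
move=> GI Gm mE GE.
apply: lambda_system_subset => //; last by move=> A GA; split; [exact: Gm|exact: GE].
apply/dynkin_lambda_system; split.
- by split => //; rewrite setTI (probability_setT P) mul1e.
- move=> A [mA AE]; split; first exact: measurableC.
  have PE : P E \is a fin_num by exact: fin_num_measure.
  have PA : P A \is a fin_num by exact: fin_num_measure.
  rewrite setIC -setDE measureD//; last by rewrite ltey_eq PE.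
  rewrite [X in (_ - X)%E](_ : _ = (P A * P E)%E); last by rewrite setIC.
  rewrite probability_setC// muleBl//.
  by rewrite mul1e.
- move=> F tF HF; split; first by apply: bigcupT_measurable => n; exact: (HF n).1.
  have mF n := (HF n).1.
  rewrite setI_bigcupl measure_bigcup//; last 2 first.
    by move=> n _; exact: measurableI.
    exact: trivIset_setIr.
  have PE : P E = (fine (P E))%:E by rewrite fineK// fin_num_measure.
  rewrite measure_bigcup// [RHS]muleC PE -nneseriesZl//.
  by apply: eq_eseriesr => n _; rewrite -PE muleC; exact: (HF n).2.
Qed.

Variables (n : nat) (W xieps : R -> {RV P >-> R}) (xi : nat -> {RV P >-> R}).
Hypothesis hW : brownian_motion W.
Hypothesis hindep : initial_data_independent n W xieps xi.

(* Only differences W s - W 0 are used: W 0 vanishes merely almost surely. *)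
Definition past_events (l : seq R) : set (set T) :=
  \bigcup_(s in [set` l])
    preimage_set_system setT (fun w => W s w - W 0 w) measurable.

Lemma past_eventsS l l' : {subset l <= l'} -> past_events l `<=` past_events l'.
Proof. by move=> ll' A [s sl h]; exists s => //; exact: ll'. Qed.

Lemma g_sigmaS (G : set (set T)) (H : set (set T)) :
  G `<=` <<s H >> -> <<s G >> `<=` <<s H >>.
Proof.
by move=> GH; apply: smallest_sub => //; exact: smallest_sigma_algebra.
Qed.

Lemma past_events_sub_path l : (forall s, s \in l -> 0 <= s) ->
  <<s past_events l >> `<=` <<s events_of `[0, +oo[ W >>.
Proof.
move=> l0; apply: g_sigmaS => A [s /= sl [B mB <-]].
pose TW := g_sigma_algebraType (events_of `[0, +oo[ W).
have mW u : 0 <= u -> measurable_fun setT (W u : TW -> R).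
  move=> u0 _ C mC; apply: sub_sigma_algebra.
  by exists u => /=; [rewrite in_itv/= u0|exists C].
have : measurable_fun setT (fun w : TW => W s w - W 0 w).
  by apply: measurable_funB; apply: mW => //; exact: l0.
exact.
Qed.

Lemma path_sub_measurable :
  <<s events_of `[0, +oo[ W >> `<=` (measurable : set (set T)).
Proof.
apply: smallest_sub; first exact: sigma_algebra_measurable.
by move=> A [s _ [B mB <-]]; exact: (measurable_funP (W s)).
Qed.

Definition increment_event (t h : R) (B : set R) : set T :=
  [set w | B (W (t + h) w - W t w)].

Lemma measurable_increment_event t h B : measurable B ->
  measurable (increment_event t h B).
Proof.
move=> mB; have : measurable_fun setT (fun w => W (t + h) w - W t w).
  exact: measurable_funB.
by move=> /(_ measurableT _ mB); rewrite setTI.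
Qed.

(** The times are sorted into a grid ending with [t] and [t + h], whose increments are independent
    by hypothesis. Boxes in all increments but the last form a pi-system, and the sigma-algebra it
    generates contains the past. *)
Lemma past_events_independent (t h : R) (l : seq R) (B : set R) :
  0 <= t -> 0 < h -> (forall s, s \in l -> 0 <= s <= t) -> measurable B ->
  forall V, <<s past_events l >> V ->
    P (V `&` increment_event t h B) = (P V * P (increment_event t h B))%E.
Proof.
move=> t0 h0 l0t mB.
pose L := rcons (sort <=%R l) t.
pose K := size L.
(* Index 0 is time 0 and index [K] is [t]. The default value of [nth] puts [tau] at [t + h] from
   [K.+1] on, so that it is monotone on all naturals, as the hypothesis on increments demands. *)
pose tau i := nth (t + h) (0 :: L) i.
have Lt s : s \in L -> 0 <= s <= t.
  by rewrite mem_rcons inE mem_sort => /orP[/eqP ->|/l0t//]; rewrite t0 lexx.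
have sL : path <=%R 0 L.
  rewrite /L rcons_path; apply/andP; split.
    rewrite path_min_sorted; first exact: (sort_sorted (@le_total _ R)).
    by apply/allP => s; rewrite mem_sort => /l0t/andP[].
  have := mem_last 0 (sort <=%R l); rewrite inE mem_sort.
  by move=> /orP[/eqP ->//|/l0t/andP[]].
have tau0 : tau 0%N = 0 by [].
have tauK : tau K = t by rewrite /tau /K /L size_rcons /= nth_rcons ltnn eqxx.
have tauS i : (K < i)%N -> tau i = t + h.
  by move=> Ki; rewrite /tau nth_default.
have tau_mono i : tau i <= tau i.+1.
  have [iK|Ki] := ltnP i K; first by move/(pathP (t + h)): sL => /(_ i iK).
  rewrite (tauS i.+1)//; move: Ki; rewrite leq_eqVlt => /predU1P[<-|/tauS ->//].
  by rewrite tauK lerDl ltW.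
pose D i w := W (tau i.+1) w - W (tau i) w.
have DK w : D K w = W (t + h) w - W t w by rewrite /D tauK tauS.
have mD i : measurable_fun setT (D i) by exact: measurable_funB.
pose box (C : nat -> set R) : set T := [set w | forall i, (i < K)%N -> C i (D i w)].
pose G : set (set T) :=
  [set A | exists2 C : nat -> set R, (forall i, measurable (C i)) & A = box C].
have mbox (C : nat -> set R) : (forall i, measurable (C i)) -> measurable (box C).
  move=> mC.
  have -> : box C = \bigcap_i (if (i < K)%N then D i @^-1` C i else setT).
    apply/seteqP; split => w /= h1 i; first by move=> _; case: ifP => // /h1.
    by move=> iK; have := h1 i I; rewrite iK.
  apply: bigcapT_measurable => i; case: ifP => // _.
  by rewrite -[X in measurable X]setTI; exact: mD.
case: hW => _ _ mut _.
have boxE (C : nat -> set R) (B' : set R) :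
    (forall i, measurable (C i)) -> measurable B' ->
    P (box C `&` increment_event t h B') =
    ((\prod_(i < K) P (D i @^-1` C i)) * P (increment_event t h B'))%E.
  move=> mC mB'.
  have := mut K.+1 tau; rewrite tau0 lexx => /(_ isT tau_mono).
  move=> /(_ (fun i : 'I_K.+1 => if (i < K)%N then C i else B')).
  have mC' : forall i : 'I_K.+1, measurable (if (i < K)%N then C i else B').
    by move=> i; case: ifP.
  move=> /(_ mC').
  rewrite big_ord_recr/= ltnn.
  have -> : (W (tau K.+1) \- W (tau K)) @^-1` B' = increment_event t h B'.
    by apply/seteqP; split => w /=; rewrite /increment_event /= tauK tauS.
  have -> : \bigcap_(i in [set: 'I_K.+1])
     (W (tau i.+1) \- W (tau i)) @^-1` (if (i < K)%N then C i else B') =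
     box C `&` increment_event t h B'.
    apply/seteqP; split => w /=.
      move=> hw; split; last first.
        by have := hw ord_max I; rewrite /= ltnn /increment_event /= tauK tauS.
      by move=> i iK; have := hw (Ordinal (ltnW iK : (i < K.+1)%N)) I; rewrite /= iK.
    move=> [hb hi] i _ /=; case: ifP => iK; first exact: hb.
    have -> : i = K :> nat.
      by apply/eqP; rewrite eqn_leq -ltnS ltn_ord leqNgt iK.
    by rewrite tauK tauS.
  move=> ->; congr (_ * _)%E; apply: eq_bigr => i _; by rewrite ltn_ord.
have incT : increment_event t h setT = setT by apply/seteqP; split.
have GI : setI_closed G.
  move=> A A' [C mC ->] [C' mC' ->].
  exists (fun i => C i `&` C' i); first by move=> i; exact: measurableI.
  apply/seteqP; split => w /=; first by move=> [h1 h2] i iK; split; [exact: h1|exact: h2].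
  by move=> h1; split=> i iK; have [] := h1 i iK.
have Gm : G `<=` measurable by move=> A [C mC ->]; exact: mbox.
have GE A : G A -> P (A `&` increment_event t h B) =
    (P A * P (increment_event t h B))%E.
  move=> [C mC ->]; rewrite boxE//; congr (_ * _)%E.
  (* [boxE] with [setT] for the last increment gives the probability of the box alone. *)
  by rewrite -[in RHS](setIT (box C)) -incT boxE// incT probability_setT mule1.
have VG : <<s past_events l >> `<=` <<s G >>.
  apply: g_sigmaS => A [s /= sl [C mC <-]].
  pose TG := g_sigma_algebraType G.
  have mDG i : (i < K)%N -> measurable_fun setT (D i : TG -> R).
    move=> iK _ C' mC'; apply: sub_sigma_algebra; rewrite setTI.
    exists (fun j => if j == i then C' else setT); first by move=> j; case: ifP.
    apply/seteqP; split => w /=.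
      by move=> hw j jK; case: eqVneq => [->|].
    by move=> /(_ i iK); rewrite eqxx.
  (* [W s - W 0] is a telescoping sum of grid increments. *)
  have mS j : (j <= K)%N -> measurable_fun setT (fun w : TG => W (tau j) w - W 0 w).
    elim: j => [_|j IH jK].
      by rewrite tau0; under eq_fun do rewrite subrr; exact: measurable_cst.
    rewrite [X in measurable_fun _ X](_ : _ =
      fun w => (W (tau j) w - W 0 w) + D j w); last first.
      by apply/funext => w; rewrite /D; ring.
    by apply: measurable_funD; [exact: (IH (ltnW jK))|exact: (mDG _ jK)].
  have sL' : s \in L by rewrite mem_rcons inE mem_sort sl orbT.
  have jK : ((index s L).+1 <= K)%N by rewrite index_mem.
  have := mS _ jK; rewrite /tau /= nth_index//.
  by move=> /(_ measurableT C mC).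
move=> V /VG hV.
exact: (independent_g_sigma GI Gm (measurable_increment_event t h mB) GE hV).2.
Qed.

(* A generating pi-system of the past at time t, completed by null sets; finitely
   many times suffice for each event. *)
Definition history (t : R) : set (set T) :=
  [set A | measurable A /\ exists U l V N,
    [/\ <<s events_of `]0, 1[ xieps `|` events_of [set k | (k <= n)%N] xi >> U,
        (forall s, s \in l -> 0 <= s <= t), <<s past_events l >> V &
        [/\ measurable N, P N = 0%E & forall w, ~ N w -> (A w <-> (U `&` V) w)]]].

Lemma initial_sub_measurable :
  <<s events_of `]0, 1[ xieps `|` events_of [set k | (k <= n)%N] xi >> `<=`
  (measurable : set (set T)).
Proof.
apply: smallest_sub; first exact: sigma_algebra_measurable.
move=> A [] [s _ [B mB <-]]; first exact: (measurable_funP (xieps s)).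
exact: (measurable_funP (xi s)).
Qed.

Lemma historyI t : setI_closed (history t).
Proof.
move=> A A' [mA [U [l [V [N [hU hl hV [mN N0 hA]]]]]]].
move=> [mA' [U' [l' [V' [N' [hU' hl' hV' [mN' N0' hA']]]]]]].
split; first exact: measurableI.
exists (U `&` U'), (l ++ l'), (V `&` V'), (N `|` N'); split.
- exact: (@measurableI _ (g_sigma_algebraType
    (events_of `]0, 1[ xieps `|` events_of [set k | (k <= n)%N] xi))).
- by move=> s; rewrite mem_cat => /orP[/hl|/hl'].
- have hV1 : <<s past_events (l ++ l') >> V.
    apply: (g_sigmaS _ hV) => B hB; apply: sub_sigma_algebra.
    by apply: past_eventsS hB => s sl; rewrite mem_cat sl.
  have hV2 : <<s past_events (l ++ l') >> V'.
    apply: (g_sigmaS _ hV') => B hB; apply: sub_sigma_algebra.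
    by apply: past_eventsS hB => s sl; rewrite mem_cat sl orbT.
  exact: (@measurableI _ (g_sigma_algebraType (past_events (l ++ l')))).
- split; first exact: measurableU.
    by apply: null_set_setU.
  move=> w nN; have /hA h1 : ~ N w by move=> ?; apply: nN; left.
  have /hA' h2 : ~ N' w by move=> ?; apply: nN; right.
  by split => [[/h1[? ?] /h2[? ?]]|[[? ?] [? ?]]]; split => //;
    [apply/h1|apply/h2].
Qed.

(** Two independences are chained on generators: the initial event [U] splits off from [V] and the
    increment taken together, both being path events, and then [V] splits off from the increment. *)
Lemma history_independent (t h : R) (B : set R) : 0 <= t -> 0 < h -> measurable B ->
  forall A, <<s history t >> A ->
    measurable A /\
    P (A `&` increment_event t h B) = (P A * P (increment_event t h B))%E.
Proof.
move=> t0 h0 mB; have mE := measurable_increment_event t h mB.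
apply: independent_g_sigma => //; first exact: historyI.
  by move=> A [].
move=> A [mA [U [l [V [N [hU hl hV [mN N0 hA]]]]]]].
have pV : <<s events_of `[0, +oo[ W >> V.
  by apply: past_events_sub_path hV => s /hl/andP[].
have pE : <<s events_of `[0, +oo[ W >> (increment_event t h B).
  have : <<s past_events [:: t; t + h] >> (increment_event t h B).
    pose TW := g_sigma_algebraType (past_events [:: t; t + h]).
    have mW u : u \in [:: t; t + h] ->
        measurable_fun setT (fun w : TW => W u w - W 0 w).
      by move=> ul _ C mC; apply: sub_sigma_algebra; exists u => //; exists C.
    have : measurable_fun setT
        (fun w : TW => (W (t + h) w - W 0 w) - (W t w - W 0 w)).
      by apply: measurable_funB; apply: mW; rewrite !inE eqxx ?orbT.
    move=> /(_ measurableT B mB); rewrite setTI.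
    congr (<<s _ >> _); apply/seteqP; rewrite /increment_event.
    by split => w /=; (have -> : W (t + h) w - W 0 w - (W t w - W 0 w) =
      W (t + h) w - W t w by ring).
  apply: past_events_sub_path => s; rewrite !inE => /orP[] /eqP -> //.
  by rewrite addr_ge0// ltW.
have mU := initial_sub_measurable hU.
have mV := path_sub_measurable pV.
have mUV : measurable (U `&` V) by exact: measurableI.
rewrite (@measure_ae_eq (A `&` increment_event t h B)
  (U `&` V `&` increment_event t h B) N)//; last 3 first.
- exact: measurableI.
- exact: measurableI.
- by move=> w /hA h1; split => -[/h1 ? ?].
rewrite (@measure_ae_eq A (U `&` V) N)// -setIA.
rewrite hindep//; last first.
  exact: (@measurableI _ (g_sigma_algebraType (events_of `[0, +oo[ W))).
by rewrite (past_events_independent t0 h0 hl mB hV) hindep// muleA.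
Qed.

Lemma history_initial t (A N : set T) (k : nat) (B : set R) :
  (k <= n)%N -> measurable B -> measurable A -> measurable N -> P N = 0%E ->
  (forall w, ~ N w -> (A w <-> B (xi k w))) -> history t A.
Proof.
move=> kn mB mA mN N0 hA; split=> //.
exists (xi k @^-1` B), [::], setT, N; split=> //.
- apply: sub_sigma_algebra; right; exists k => //; exists B => //.
  by rewrite setTI.
- exact: (@measurableT _ (g_sigma_algebraType (past_events [::]))).
- by split=> // w /hA; rewrite setIT.
Qed.

Lemma history_path t (A N : set T) (s : R) (B : set R) :
  0 <= s <= t -> measurable B -> measurable A -> measurable N -> P N = 0%E ->
  (forall w, ~ N w -> (A w <-> B (W s w - W 0 w))) -> history t A.
Proof.
move=> st mB mA mN N0 hA; split=> //.
exists setT, [:: s], [set w | B (W s w - W 0 w)], N; split=> //.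
- exact: (@measurableT _ (g_sigma_algebraType
    (events_of `]0, 1[ xieps `|` events_of [set k | (k <= n)%N] xi))).
- by move=> s'; rewrite inE => /eqP ->.
- apply: sub_sigma_algebra; exists s; first by rewrite /= inE.
  by exists B => //; rewrite setTI.
- by split=> // w /hA; rewrite setTI.
Qed.

End independence.

(** * The expansion coefficients *)

Section closed_classes.
Variables (R : realType) (U : Type) (Cl : (U -> R) -> Prop).

(** Drifts and composition sums are polynomials in the [X j]. Abstract closure lets one argument
    serve continuity in time, measurability, uniform moments and half-Hoelder continuity; [U] is
    accordingly a set of times, a sample space or a product. *)
Definition subalgebra_class :=
  [/\ forall k, Cl (fun=> k),
      forall f g, Cl f -> Cl g -> Cl (fun u => f u + g u) &
      forall f g, Cl f -> Cl g -> Cl (fun u => f u * g u)].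

Hypothesis clP : subalgebra_class.

Let cl_cst k : Cl (fun=> k). Proof. by case: clP. Qed.
Let clD f g : Cl f -> Cl g -> Cl (fun u => f u + g u). Proof. by case: clP => _ + _; apply. Qed.
Let clM f g : Cl f -> Cl g -> Cl (fun u => f u * g u). Proof. by case: clP => _ _; apply. Qed.

Lemma subalgebra_class_sum (J : Type) (r : seq J) (Q : pred J) (F : J -> U -> R) :
  (forall j, Q j -> Cl (F j)) -> Cl (fun u => \sum_(j <- r | Q j) F j u).
Proof.
move=> cF; elim: r => [|j r IH].
  by under eq_fun do rewrite big_nil; exact: cl_cst.
under eq_fun do rewrite big_cons.
by case E : (Q j) => //; apply: clD => //; exact: cF.
Qed.

Lemma subalgebra_class_prod (J : Type) (r : seq J) (F : J -> U -> R) :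
  (forall j, Cl (F j)) -> Cl (fun u => \prod_(j <- r) F j u).
Proof.
move=> cF; elim: r => [|j r IH].
  by under eq_fun do rewrite big_nil; exact: cl_cst.
by under eq_fun do rewrite big_cons; exact: clM.
Qed.

Lemma subalgebra_classX k f : Cl f -> Cl (fun u => f u ^+ k).
Proof.
move=> cf; elim: k => [|k IH]; first exact: cl_cst.
by under eq_fun do rewrite exprS; exact: clM.
Qed.

Lemma subalgebra_classB f g : Cl f -> Cl g -> Cl (fun u => f u - g u).
Proof.
move=> cf cg; have := clD cf (clM (cl_cst (-1)) cg).
by under eq_fun do rewrite mulN1r.
Qed.

Lemma subalgebra_class_composition_sum m i (x : nat -> U -> R) : (1 < i)%N ->
  (forall j, (0 < j < m)%N -> Cl (x j)) ->
  Cl (fun u => composition_sum m i (fun j => x j u)).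
Proof.
move=> i1 cx; apply: (@subalgebra_class_sum _ _ _
  (fun (j : {ffun 'I_i -> 'I_m.+1}) u => \prod_(k < i) x (j k) u)) => j hj.
apply: (@subalgebra_class_prod _ _ (fun k => x (j k))) => k.
exact/cx/compositions_lt/hj.
Qed.

(** For [m >= 1], the source term of the linear equation of [x m]; it depends on smaller indices
    only. *)
Definition drift_rest m (x : nat -> R) : R :=
  - 3 * x 0%N * composition_sum m 2 x - composition_sum m 3 x.

Lemma subalgebra_class_drift_rest m (x : nat -> U -> R) : Cl (x 0%N) ->
  (forall j, (0 < j < m)%N -> Cl (x j)) ->
  Cl (fun u => drift_rest m (fun j => x j u)).
Proof.
move=> cx0 cx; apply: subalgebra_classB; last exact: subalgebra_class_composition_sum.
apply: clM; last exact: subalgebra_class_composition_sum.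
by apply: clM => //; exact: cl_cst.
Qed.

End closed_classes.

Lemma driftE (R : realType) m (x : nat -> R) : (0 < m)%N ->
  drift m x = (1 - 3 * x 0%N ^+ 2) * x m + drift_rest m x.
Proof.
case: m => // m _; rewrite /drift_rest /drift /composition_sum addrA.
rewrite mulNr mulNr mulr_sumr; congr (_ - _); congr (_ - _).
Qed.

Lemma drift_rest1 (R : realType) (x : nat -> R) : drift_rest 1 x = 0.
Proof.
rewrite /drift_rest -!(@coef_tail_polyX _ 1)// !coef_tail_polyX_small//.
by rewrite mulr0 subr0.
Qed.

Lemma subalgebra_class_drift (R : realType) (U : Type) (Cl : (U -> R) -> Prop) m
    (x : nat -> U -> R) : subalgebra_class Cl ->
  (forall j, (j <= m)%N -> Cl (x j)) -> Cl (fun u => drift m (fun j => x j u)).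
Proof.
move=> clP cx; have [c0 cD cM] := clP.
case: m cx => [|m] cx.
  by apply: subalgebra_classB => //; [exact: cx|apply: subalgebra_classX => //; exact: cx].
under eq_fun do rewrite driftE//.
apply: (cD); last first.
  apply: subalgebra_class_drift_rest => //; first exact: cx.
  by move=> j /andP[_ /ltnW]; exact: cx.
apply: (cM); last exact: cx.
apply: subalgebra_classB => //; apply: (cM) => //.
by apply: subalgebra_classX => //; exact: cx.
Qed.

Lemma continuous_class (R : realType) :
  subalgebra_class (fun f : R -> R => continuous f).
Proof.
split; [exact: continuous_fun_cst|exact: continuous_funD|exact: continuous_funM].
Qed.

Lemma measurable_class (R : realType) d (T : measurableType d) :
  subalgebra_class (fun f : T -> R => measurable_fun setT f).
Proof.
split; [by move=> k; exact: measurable_cst|exact: measurable_funD|exact: measurable_funM].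
Qed.

Lemma unif_moments_class (R : realType) d (T : measurableType d)
    (P : probability T R) (I : Type) (D : set I) :
  subalgebra_class (fun f : I * T -> R => unif_moments P D (fun i w => f (i, w))).
Proof.
split; [exact: unif_moments_cst|by move=> f g; exact: unif_momentsD|].
by move=> f g; exact: unif_momentsM.
Qed.

(** The inverse is written as [f] times a real power of [f ^+ 2], real powers being measurable; at
    zeros of [f] both sides are 0 because the inverse of 0 is 0. *)
Lemma measurable_fun_inv (R : realType) d (T : measurableType d) (f : T -> R) :
  measurable_fun setT f -> measurable_fun setT (fun w => (f w)^-1).
Proof.
move=> mf; rewrite [X in measurable_fun _ X](_ : _ =
    fun w => f w * (f w ^+ 2) `^ (-1)).
  apply: measurable_funM => //.
  apply: (measurableT_comp (measurable_powR (-1 : R))).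
  exact: measurable_funX.
apply/funext => w; have [->|f0] := eqVneq (f w) 0; first by rewrite invr0 mul0r.
by rewrite powR_inv1 ?sqr_ge0// expr2 invfM mulrA divff// mul1r.
Qed.

(** Clamping the time to [[a, b]] leaves the integral unchanged and makes the integrand measurable
    at every time. This is for the past at a given time, with respect to which processes are
    measurable only up to that time. *)
Lemma measurable_Rintegral_itv (R : realType) d (T : measurableType d)
    (Y : R -> T -> R) (a b : R) : a <= b ->
  (forall s, a <= s <= b -> measurable_fun setT (Y s)) ->
  (forall w, continuous (Y^~ w)) ->
  measurable_fun setT (fun w => \int[lebesgue_measure]_(s in `[a, b]) Y s w).
Proof.
move=> ab mY cY.
pose c s := Num.max a (Num.min b s).
have cc : continuous c.
  move=> s; apply: continuous_max; first exact: cvg_cst.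
  by apply: continuous_min; [exact: cvg_cst|exact: cvg_id].
rewrite [X in measurable_fun _ X](_ : _ =
   fun w => \int[lebesgue_measure]_(s in `[a, b]) Y (c s) w).
  apply: (@measurable_Rintegral_process _ _ _ (fun s => Y (c s))).
    by move=> s; apply: mY; rewrite /c le_max lexx/= ge_max ab ge_min lexx.
  by move=> w; exact: (continuous_fun_comp cc (cY w)).
apply/funext => w; apply: eq_Rintegral => s; rewrite inE/= in_itv/= => /andP[sa sb].
by rewrite /c min_r// max_r.
Qed.

(** * Representation formulas and adaptedness *)

Section regular_expansion.
Context (R : realType) (d : measure_display) (T : measurableType d)
  (P : probability T R).
Variables (n : nat) (W : R -> T -> R) (xi : nat -> T -> R) (X : nat -> R -> T -> R).
Variables (lo hi : R).

(* A version of the data in which every almost sure property holds surely,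
   with processes frozen at negative times. *)
Record regular_expansion : Prop := RegularExpansion {
  lo_gt0 : 0 < lo;
  lo_le1 : lo <= 1;
  hi_ge1 : 1 <= hi;
  xi0_bounds : forall w, lo <= `|xi 0%N w| <= hi;
  xi_moments : forall k, (k <= n)%N -> unif_moments P [set: unit] (fun=> xi k);
  W_measurable : forall s, measurable_fun setT (W s);
  W_continuous : forall w, continuous (W^~ w);
  W_at0 : forall w, W 0 w = 0;
  W_increments : forall s t, 0 <= s -> s < t -> forall A, measurable A ->
    P ((fun w => W t w - W s w) @^-1` A) = normal_prob 0 (Num.sqrt (t - s)) A;
  X_measurable : forall m s, (m <= n)%N -> measurable_fun setT (X m s);
  X_continuous : forall m w, (m <= n)%N -> continuous (fun s => X m s w);
  X_frozen : forall m s w, (m <= n)%N -> s <= 0 -> X m s w = X m 0 w;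
  X_equation : forall m t w, (m <= n)%N -> 0 <= t ->
    X m t w = xi m w
      + \int[lebesgue_measure]_(s in `[0, t]) drift m (fun k => X k s w)
      + (if m == 1%N then Num.sqrt 2 * W t w else 0);
  W_filtration : forall t, 0 <= t -> exists H : set (set T),
    [/\ forall k, (k <= n)%N ->
          measurable_fun setT (xi k : g_sigma_algebraType H -> R),
        forall s, 0 <= s <= t ->
          measurable_fun setT (W s : g_sigma_algebraType H -> R) &
        forall h B, 0 < h -> measurable B -> forall A, <<s H >> A ->
          measurable A /\
          P (A `&` [set w | B (W (t + h) w - W t w)%R]) =
            (P A * P [set w | B (W (t + h) w - W t w)%R])%E] }.

Hypothesis reg : regular_expansion.
Let lo0 := lo_gt0 reg.
Let lo1 := lo_le1 reg.
Let hi1 := hi_ge1 reg.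
Let hi0 : 0 < hi. Proof. exact: lt_le_trans ltr01 hi1. Qed.
Let bxi w := xi0_bounds reg w.
Let cX0 w : continuous (fun s => X 0 s w).
Proof. exact: (X_continuous reg). Qed.
Let X0neg w s : s <= 0 -> X 0 s w = X 0 0 w.
Proof. exact: (X_frozen reg). Qed.
Let X0eq w s : 0 <= s -> X 0 s w = xi 0%N w +
  \int[lebesgue_measure]_(y in `[0, s]) (X 0 y w - X 0 y w ^+ 3).
Proof. by move=> s0; rewrite {1}(X_equation reg)// addr0. Qed.

Definition flow s w := dw_flow (xi 0%N w) (fun y => X 0 y w) s.
Let K := (hi / lo) ^+ 3.

Let K0 : 0 <= K. Proof. by rewrite exprn_ge0// divr_ge0// ltW. Qed.

Lemma X0_le s w : `|X 0 s w| <= hi / lo.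
Proof. exact: (dw_abs_le lo0 lo1 hi1 (bxi w) (@cX0 w) (X0neg w) (X0eq w)). Qed.

Lemma X0_limit (sg : R) s w : sg ^+ 2 = 1 -> 0 < sg * xi 0%N w -> 0 <= s ->
  `|X 0 s w - sg| <= (hi / lo) ^+ 2 * expR (- 2 * s).
Proof.
exact: (dw_limit lo0 lo1 hi1 (bxi w) (@cX0 w) (X0neg w) (X0eq w)).
Qed.

Lemma flow_continuous w : continuous (flow^~ w).
Proof. exact: dw_flow_continuous. Qed.

Lemma flow_neq0 s w : flow s w != 0.
Proof. exact: (dw_flow_neq0 lo0 (bxi w) (@cX0 w) (X0neg w) (X0eq w)). Qed.

Lemma flow0 w : flow 0 w = 1.
Proof. exact: (dw_flow0 lo0 (bxi w) (X0eq w)). Qed.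

Lemma flow_ratio_le s t w : 0 <= s <= t ->
  `|flow t w / flow s w| <= K * expR (- 2 * (t - s)).
Proof.
exact: (dw_flow_ratio lo0 lo1 hi1 (bxi w) (@cX0 w) (X0neg w) (X0eq w)).
Qed.

Lemma flow_le t w : 0 <= t -> `|flow t w| <= K * expR (- 2 * t).
Proof.
move=> t0; have := @flow_ratio_le 0 t w; rewrite lexx t0 => /(_ isT).
by rewrite flow0 divr1 subr0.
Qed.

Let linear_rate w := fun s => 1 - 3 * X 0 s w ^+ 2.

Lemma linear_rate_continuous w : continuous (linear_rate w).
Proof.
apply: continuous_funB; first exact: continuous_fun_cst.
by apply: continuous_funM; [exact: continuous_fun_cst|exact: continuous_funX].
Qed.

Lemma drift_rest_continuous m w : (m <= n)%N ->
  continuous (fun s => drift_rest m (fun k => X k s w)).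
Proof.
move=> mn.
apply: (@subalgebra_class_drift_rest _ _ _ (continuous_class R) m
  (fun k s => X k s w)) => // j /andP[_ jm].
by apply: (X_continuous reg); exact: leq_trans (ltnW jm) mn.
Qed.

Lemma drift_continuous m w : (m <= n)%N ->
  continuous (fun s => drift m (fun k => X k s w)).
Proof.
move=> mn; apply: (@subalgebra_class_drift _ _ _ m (fun k s => X k s w)
  (continuous_class R)) => j jm.
by apply: (X_continuous reg); exact: leq_trans jm mn.
Qed.

Lemma X_representation m t w : (1 < m <= n)%N -> 0 <= t ->
  X m t w = flow t w * xi m w + \int[lebesgue_measure]_(s in `[0, t])
    (flow t w / flow s w * drift_rest m (fun k => X k s w)).
Proof.
move=> /andP[m1 mn] t0.
apply: (@variation_of_constants _ (linear_rate w)
  (fun s => drift_rest m (fun k => X k s w)) (fun s => X m s w) (flow^~ w)) => //.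
- exact: linear_rate_continuous.
- exact: drift_rest_continuous.
- exact: (X_continuous reg).
- exact: flow_continuous.
- by move=> s; exact: flow_neq0.
- exact: flow0.
- by move=> s s0; apply: (dw_flow_derive lo0 (bxi w) (@cX0 w) (X0eq w) s0).
- move=> s /andP[s0 _]; rewrite {1}(X_equation reg)// gtn_eqF// addr0.
  congr (_ + _); apply: eq_Rintegral => y _.
  by rewrite driftE// (ltn_trans _ m1).
Qed.

(* The equation of X 1 becomes an ODE with continuous data after adding the
   remaining increment of the noise, which vanishes at the final time. *)
Lemma X1_representation t w : (1 <= n)%N -> 0 <= t ->
  X 1 t w = flow t w * (xi 1%N w + Num.sqrt 2 * W t w) +
   \int[lebesgue_measure]_(s in `[0, t])
    (flow t w / flow s w *
      (- (1 - 3 * X 0 s w ^+ 2) * (Num.sqrt 2 * (W t w - W s w)))).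
Proof.
move=> n1 t0.
have cW : continuous (W^~ w) by exact: (W_continuous reg).
have cV : continuous (fun s => Num.sqrt 2 * (W t w - W s w)).
  apply: continuous_funM; first exact: continuous_fun_cst.
  by apply: continuous_funB => //; exact: continuous_fun_cst.
transitivity (X 1 t w + Num.sqrt 2 * (W t w - W t w)).
  by rewrite subrr mulr0 addr0.
apply: (@variation_of_constants _ (linear_rate w)
  (fun s => - (1 - 3 * X 0 s w ^+ 2) * (Num.sqrt 2 * (W t w - W s w)))
  (fun s => X 1 s w + Num.sqrt 2 * (W t w - W s w)) (flow^~ w)
  (xi 1%N w + Num.sqrt 2 * W t w)) => //.
- exact: linear_rate_continuous.
- apply: continuous_funM => //; apply: continuous_funN.
  exact: linear_rate_continuous.
- by apply: continuous_funD => //; exact: (X_continuous reg).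
- exact: flow_continuous.
- by move=> s; exact: flow_neq0.
- exact: flow0.
- by move=> s s0; apply: (dw_flow_derive lo0 (bxi w) (@cX0 w) (X0eq w) s0).
- move=> s /andP[s0 _]; rewrite {1}(X_equation reg)// eqxx.
  rewrite [X in _ = _ + X](_ : _ =
    \int[lebesgue_measure]_(s0 in `[0, s]) drift 1 (fun k => X k s0 w)); first by ring.
  apply: eq_Rintegral => y _; rewrite driftE// drift_rest1 /linear_rate.
  by ring.
Qed.

Section measurability_for_a_sub_sigma_algebra.
Context (d' : measure_display) (T' : measurableType d') (e : T' -> T) (t0 : R).
Hypothesis mxi : forall k, (k <= n)%N -> measurable_fun setT (fun w => xi k (e w)).
Hypothesis mW : forall s, 0 <= s <= t0 -> measurable_fun setT (fun w => W s (e w)).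

(** Adaptedness: [T'] will be [T] with a smaller sigma-algebra and [e] the identity. The integral
    equation is implicit in [X m]; the closed formula for [X 0] and the variation-of-constants
    formulas instead express it through [xi], the path of [W] up to [t0] and smaller indices. *)
Lemma X_measurable_sub m s : (m <= n)%N -> 0 <= s <= t0 ->
  measurable_fun setT (fun w => X m s (e w)).
Proof.
have m0 u : 0 <= u -> measurable_fun setT (fun w => X 0 u (e w)).
  move=> u0.
  rewrite [X in measurable_fun _ X](_ : _ = fun w =>
     xi 0%N (e w) * (dw_den (xi 0%N (e w)) u) `^ (- 2^-1)).
    apply: measurable_funM; first exact: mxi.
    apply: (measurableT_comp (measurable_powR (- 2^-1 : R))).
    apply: measurable_funD; first by apply: measurable_funX; exact: mxi.
    apply: measurable_funM => //; apply: measurable_funB => //.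
    by apply: measurable_funX; exact: mxi.
  apply/funext => w.
  have den0 : 0 <= dw_den (xi 0%N (e w)) u.
    have h := dw_sqr (@cX0 (e w)) (X0eq (e w)) u0.
    rewrite leNgt; apply/negP => dneg.
    have := sqr_ge0 (X 0 u (e w)); rewrite le_eqVlt => /predU1P[h0|h0].
      have /andP[b _] := bxi (e w).
      move: h; rewrite -h0 mul0r => /esym/eqP; rewrite sqrf_eq0 => /eqP x0.
      by move: b; rewrite x0 normr0 leNgt lo0.
    have := sqr_ge0 (xi 0%N (e w)); rewrite -h leNgt => /negP; apply.
    by rewrite pmulr_rlt0.
  rewrite {1}(dw_formula lo0 lo1 (bxi (e w)) (@cX0 (e w)) (X0neg (e w)) (X0eq (e w)) u0).
  by rewrite powRN powR12_sqrt// sqrtrV.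
have mflow u : 0 <= u -> measurable_fun setT (fun w => flow u (e w)).
  move=> u0; apply: measurable_funM => //; apply: measurable_funX.
  by apply: measurable_funM; [exact: m0|apply: measurable_fun_inv; exact: mxi].
elim/ltn_ind: m s => -[_ s _ /andP[s0 _]|m IH s mn /andP[s0 st]]; first exact: m0.
have mint (r : R -> T -> R) : (forall u, 0 <= u <= s ->
      measurable_fun setT (fun w => r u (e w))) ->
    (forall w, continuous (r^~ w)) ->
    measurable_fun setT (fun w => \int[lebesgue_measure]_(u in `[0, s])
      (flow s (e w) / flow u (e w) * r u (e w))).
  move=> mr cr; apply: (@measurable_Rintegral_itv _ _ _
      (fun u w => flow s (e w) / flow u (e w) * r u (e w))) => //.
    move=> u us; have /andP[u0 _] := us; apply: measurable_funM; last exact: mr.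
    by apply: measurable_funM; [exact: mflow|apply: measurable_fun_inv; exact: mflow].
  move=> w; apply: continuous_funM => //; apply: continuous_funM.
    exact: continuous_fun_cst.
  apply: continuous_funV; first exact: flow_continuous.
  by move=> u; exact: flow_neq0.
have m2 : measurable_fun setT (fun w => flow s (e w)) by exact: mflow.
case: m IH mn => [_ n1|m IH mn].
  under eq_fun do rewrite X1_representation//.
  apply: measurable_funD.
    apply: measurable_funM => //; apply: measurable_funD; first exact: mxi.
    by apply: measurable_funM => //; apply: mW; rewrite s0 st.
  apply: (mint (fun u w => - (1 - 3 * X 0 u w ^+ 2) * (Num.sqrt 2 * (W s w - W u w)))).
    move=> u /andP[u0 us]; apply: measurable_funM; last first.
      apply: measurable_funM => //; apply: measurable_funB; apply: mW.
        by rewrite s0 st.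
      by rewrite u0 (le_trans us st).
    apply: (measurable_comp (F := setT) measurableT) => //=.
    apply: measurable_funB => //; apply: measurable_funM => //.
    by apply: measurable_funX; exact: m0.
  move=> w; apply: continuous_funM.
    by apply: continuous_funN; exact: linear_rate_continuous.
  apply: continuous_funM; first exact: continuous_fun_cst.
  apply: continuous_funB; first exact: continuous_fun_cst.
  exact: (W_continuous reg).
under eq_fun do rewrite X_representation//.
apply: measurable_funD; first by apply: measurable_funM => //; exact: mxi.
apply: (mint (fun u w => drift_rest m.+2 (fun k => X k u w))); last first.
  by move=> w; exact: drift_rest_continuous.
move=> u /andP[u0 us].
apply: (@subalgebra_class_drift_rest _ _ _ (measurable_class R T') m.+2
  (fun k w => X k u (e w))); first exact: m0.
move=> j /andP[_ jm]; apply: IH => //; first by rewrite (leq_trans (ltnW jm)).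
by rewrite u0 (le_trans us).
Qed.

End measurability_for_a_sub_sigma_algebra.
End regular_expansion.

(** Exponential decay beats the growth of the Brownian standard deviation, uniformly in time. *)
Lemma sqrt_expR_le1 (R : realType) (u : R) : 0 <= u ->
  expR (- u) * Num.sqrt u <= 1.
Proof.
move=> u0; have h1 : Num.sqrt u <= expR u.
  apply: le_trans (expR_ge1Dx u); have := sqr_sqrtr u0.
  set r := Num.sqrt u; have := sqr_ge0 (r - 1); nra.
rewrite -[leRHS](expRxMexpNx_1 u) mulrC ler_wpM2r ?expR_ge0//.
Qed.

Lemma Rintegral_expR_le1 (R : realType) (t : R) : 0 <= t ->
  \int[lebesgue_measure]_(s in `[0, t]) (expR (- t) * expR (1 * s)) <= 1.
Proof.
move=> t0; have cE : continuous (fun s : R => expR (- t) * expR (1 * s)).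
  by apply: continuous_funM; [exact: continuous_fun_cst|exact: continuous_fun_expR].
have hd s : 0 < s < t -> is_derive s 1 (fun s : R => expR (- t) * expR (1 * s))
    (expR (- t) * expR (1 * s)).
  move=> _; have h := is_derive_funZ (expR (- t)) (is_derive_fun_expR 1 s).
  by apply: (is_derive_eq h); rewrite mul1r.
rewrite (Rintegral_derive t0 cE cE hd).
by rewrite !mul1r ?mulr0 -expRD addNr expR0 mulr1 lerBlDr lerDl expR_ge0.
Qed.

Lemma Rintegral_continuousB (R : realType) (f : R -> R) (a b : R) :
  continuous f -> 0 <= a -> a <= b ->
  \int[lebesgue_measure]_(s in `[0, b]) f s -
  \int[lebesgue_measure]_(s in `[0, a]) f s =
  \int[lebesgue_measure]_(s in `[a, b]) f s.
Proof.
move=> cf a0 ab; rewrite Rintegral_itvB ?bnd_simp//; last exact: continuous_integrable_itv.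
rewrite Rintegral_itv_obnd_cbnd//.
apply: (integrableS _ _ _ (continuous_integrable_itv a b cf)) => //.
exact: subset_itv_oc_cc.
Qed.

(** * Moments of the expansion coefficients, uniformly in time *)

Section moment_bounds.
Context (R : realType) (d : measure_display) (T : measurableType d)
  (P : probability T R).
Variables (n : nat) (W : R -> T -> R) (xi : nat -> T -> R) (X : nat -> R -> T -> R).
Variables (lo hi : R).
Hypothesis reg : regular_expansion P n W xi X lo hi.
Let hilo0 : 0 <= hi / lo.
Proof.
have lo0 := lo_gt0 reg; have hi1 := hi_ge1 reg.
by rewrite divr_ge0// ltW// (lt_le_trans ltr01).
Qed.

Lemma flow_bounds : exists K : R, [/\ 0 <= K,
  forall s t w, 0 <= s <= t ->
    `|flow xi X t w / flow xi X s w| <= K * expR (- 2 * (t - s)) &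
  forall t w, 0 <= t -> `|flow xi X t w| <= K * expR (- 2 * t)].
Proof.
exists ((hi / lo) ^+ 3); split; first by rewrite exprn_ge0.
  by move=> s t w; exact: (flow_ratio_le reg).
by move=> t w; exact: (flow_le reg).
Qed.

Lemma W_scaled_increments : unif_moments P [set q : R * R | 0 <= q.1 <= q.2]
  (fun q w => (W q.2 w - W q.1 w) / Num.sqrt (q.2 - q.1)).
Proof.
have mWW q : measurable_fun setT (fun w => W q.2 w - W q.1 w).
  by apply: measurable_funB; exact: (W_measurable reg).
split=> [q _|p]; first exact: measurable_funM.
(* The added 1 covers [q.1 = q.2], where the quotient is 0 and its zeroth power is 1. *)
exists (p%:R ^+ p * expR 1 * Num.sqrt 2 + 1) => -[s t] /= /andP[s0].
have C0 : 0 <= p%:R ^+ p * expR 1 * Num.sqrt 2 :> R.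
  by rewrite mulr_ge0 ?sqrtr_ge0// mulr_ge0 ?expR_ge0// exprn_ge0.
rewrite le_eqVlt => /predU1P[<-|st].
  under eq_integral do rewrite subrr mul0r normr0.
  rewrite integral_cst//= (probability_setT P) mule1 lee_fin.
  apply: (@le_trans _ _ 1); last by rewrite lerDr.
  by rewrite expr0n; case: eqP => _; rewrite ?lexx ?ler01.
have sq0 : 0 < Num.sqrt (t - s) by rewrite sqrtr_gt0 subr_gt0.
apply: le_trans (gaussian_moment_le sq0 (mWW (s, t)) (W_increments reg s0 st) p) _.
by rewrite lee_fin lerDl.
Qed.

Lemma W_increment_abs s t w : s <= t ->
  `|W t w - W s w| = Num.sqrt (t - s) * `|(W t w - W s w) / Num.sqrt (t - s)|.
Proof.
rewrite le_eqVlt => /predU1P[->|st]; first by rewrite !subrr mul0r normr0 mulr0.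
have h : 0 < Num.sqrt (t - s) by rewrite sqrtr_gt0 subr_gt0.
by rewrite normrM normfV (gtr0_norm h) mulrC divfK// gt_eqF.
Qed.

Lemma flow_measurableT t : measurable_fun setT (flow xi X t).
Proof.
apply: measurable_funM => //; apply: measurable_funX.
apply: measurable_funM; first exact: (X_measurable reg).
apply: measurable_fun_inv.
exact: ((xi_moments reg (leq0n n)).1 tt).
Qed.

Lemma xi_unif_moments (I : Type) (D : set I) k : (k <= n)%N ->
  unif_moments P D (fun=> xi k).
Proof. by move=> kn; exact: (unif_moments_reindex (f := fun=> tt) (xi_moments reg kn)). Qed.

(** The decay exp (- 2 (t - s)) is split in two. One factor exp (- (t - s)) is the weight of mass at
    most 1 for Jensen's inequality; the other is left to [r], whose moments may then grow like those
    of [W t - W s]. *)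
Lemma flow_integral_moments (r : R -> R -> T -> R) :
  (forall t s, 0 <= t -> measurable_fun setT (r t s)) ->
  (forall t w, 0 <= t -> continuous (fun s => r t s w)) ->
  unif_moments P [set q : R * R | 0 <= q.1 /\ 0 <= q.2 <= q.1]
    (fun q w => expR (- (q.1 - q.2)) * r q.1 q.2 w) ->
  unif_moments P [set t | 0 <= t] (fun t w =>
    \int[lebesgue_measure]_(s in `[0, t]) (flow xi X t w / flow xi X s w * r t s w)).
Proof.
move=> mr cr hr; have [K [K0 ratioK _]] := flow_bounds.
pose k (t s : R) := expR (- t) * expR (1 * s).
pose g t s w := expR (t - s) * (flow xi X t w / flow xi X s w * r t s w).
have -> : (fun t w => \int[lebesgue_measure]_(s in `[0, t])
      (flow xi X t w / flow xi X s w * r t s w)) =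
    (fun t w => \int[lebesgue_measure]_(s in `[0, t]) (k t s * g t s w)).
  apply/funext => t; apply/funext => w; apply: eq_Rintegral => s _.
  rewrite /k /g mulrA -!expRD.
  by rewrite (_ : _ + _ = 0) ?expR0 ?mul1r//; ring.
apply: (unif_moments_integral (a := fun=> 0) (b := fun t => t)).
- by move=> t _; apply: continuous_funM; [exact: continuous_fun_cst|exact: continuous_fun_expR].
- by move=> t s _; rewrite mulr_ge0 ?expR_ge0.
- by move=> t /= t0; exact: Rintegral_expR_le1.
- move=> t s /= t0; apply: measurable_funM => //; apply: measurable_funM; last exact: mr.
  by apply: measurable_funM; [|apply: measurable_fun_inv]; exact: flow_measurableT.
- move=> t w /= t0; apply: continuous_funM.
    have -> : (fun s => expR (t - s)) = (fun s => expR t * expR (- 1 * s)).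
      by apply/funext => s; rewrite -expRD mulN1r.
    by apply: continuous_funM; [exact: continuous_fun_cst|exact: continuous_fun_expR].
  apply: continuous_funM; last exact: cr.
  apply: continuous_funM; first exact: continuous_fun_cst.
  apply: continuous_funV; first exact: (flow_continuous reg).
  by move=> s; exact: (flow_neq0 reg).
- have h := unif_momentsZ K hr.
  apply: unif_moments_le (h) _ _.
    move=> [t s] /= [t0 st]; apply: measurable_funM => //; apply: measurable_funM; last exact: mr.
    by apply: measurable_funM; [|apply: measurable_fun_inv]; exact: flow_measurableT.
  move=> [t s] w /= [t0 st]; move: (ratioK s t w st); rewrite /g.
  move: (flow xi X t w / flow xi X s w) => f hf.
  rewrite !normrM (ger0_norm K0) !(gtr0_norm (expR_gt0 _)) !mulrA ler_wpM2r//.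
  apply: (@le_trans _ _ (expR (t - s) * (K * expR (- 2 * (t - s))))).
    by rewrite ler_wpM2l ?expR_ge0.
  by rewrite mulrCA -expRD ler_wpM2l// ler_expR; lra.
Qed.

(** Strong induction through the representation formulas: [X 0] is bounded, [X 1] integrates noise
    increments and the others integrate polynomials in smaller coefficients, always against the
    decaying flow ratio. *)
Lemma X_unif_moments m : (m <= n)%N -> unif_moments P [set t | 0 <= t] (X m).
Proof.
have [K [K0 _ flowK]] := flow_bounds.
have um0 : unif_moments P [set t | 0 <= t] (X 0).
  apply: (@unif_moments_bounded _ _ _ _ _ _ _ (hi / lo)) => [t _|t w _].
    exact: (X_measurable reg).
  exact: (X0_le reg).
have umflow : unif_moments P [set t | 0 <= t] (flow xi X).
  apply: (@unif_moments_bounded _ _ _ _ _ _ _ K) => [t _|t w /= t0].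
    exact: flow_measurableT.
  apply: le_trans (flowK t w t0) _; rewrite ler_piMr// -expR0 ler_expR.
  by rewrite mulNr oppr_le0 mulr_ge0.
elim/ltn_ind: m => -[//|[_ n1|m IH mn]].
- apply: (@unif_moments_le _ _ _ _ _ _ _ (fun t w =>
    flow xi X t w * (xi 1%N w + Num.sqrt 2 * W t w) +
     \int[lebesgue_measure]_(s in `[0, t]) (flow xi X t w / flow xi X s w *
      (- (1 - 3 * X 0 s w ^+ 2) * (Num.sqrt 2 * (W t w - W s w)))))); last 2 first.
  + by move=> t _; exact: (X_measurable reg).
  + by move=> t w /= t0; rewrite (X1_representation reg).
  have cr w : continuous (fun s => - (1 - 3 * X 0 s w ^+ 2)).
    by apply: continuous_funN; exact: (linear_rate_continuous reg).
  have mr s : measurable_fun setT (fun w => - (1 - 3 * X 0 s w ^+ 2)).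
    apply: (measurable_comp (F := setT) measurableT) => //=.
    apply: measurable_funB => //; apply: measurable_funM => //.
    by apply: measurable_funX; exact: (X_measurable reg).
  have mW := W_measurable reg.
  apply: unif_momentsD; last first.
    apply: (@flow_integral_moments (fun t s w =>
      - (1 - 3 * X 0 s w ^+ 2) * (Num.sqrt 2 * (W t w - W s w)))).
    * move=> t s _; apply: measurable_funM => //; apply: measurable_funM => //.
      exact: measurable_funB.
    * move=> t w _; apply: continuous_funM; first exact: cr.
      apply: continuous_funM; first exact: continuous_fun_cst.
      by apply: continuous_funB; [exact: continuous_fun_cst|exact: (W_continuous reg)].
    * have hW : unif_moments P [set q : R * R | 0 <= q.1 /\ 0 <= q.2 <= q.1]
          (fun q w => (W q.1 w - W q.2 w) / Num.sqrt (q.1 - q.2)).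
        by apply: (unif_moments_reindex (f := fun q => (q.2, q.1)) W_scaled_increments)
          => -[t s] /= [].
      apply: unif_moments_le
        (unif_momentsZ ((1 + 3 * (hi / lo) ^+ 2) * Num.sqrt 2) hW) _ _.
        move=> [t s] /= _; apply: measurable_funM => //; apply: measurable_funM => //.
        by apply: measurable_funM => //; exact: measurable_funB.
      move=> [t s] w /= [t0 /andP[s0 st]].
      rewrite ![in leLHS]normrM (W_increment_abs w st) [leRHS]normrM.
      rewrite (gtr0_norm (expR_gt0 _)) !(ger0_norm (sqrtr_ge0 _)) normrN.
      set N := `|_ / _|.
      have N0 : 0 <= N by exact: normr_ge0.
      have e1 : expR (- (t - s)) * Num.sqrt (t - s) <= 1.
        by apply: sqrt_expR_le1; rewrite subr_ge0.
      have a1 : `|1 - 3 * X 0 s w ^+ 2| <= 1 + 3 * (hi / lo) ^+ 2.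
        apply: le_trans (ler_normB _ _) _; rewrite normr1 lerD2l normrM ger0_norm//.
        rewrite ler_wpM2l// normrX lerXn2r ?nnegrE//; exact: (X0_le reg).
      have q0 : 0 <= Num.sqrt 2 :> R by exact: sqrtr_ge0.
      rewrite [in leRHS]ger0_norm; last first.
        by rewrite mulr_ge0// addr_ge0// mulr_ge0// sqr_ge0.
      have -> : expR (- (t - s)) * (`|1 - 3 * X 0 s w ^+ 2| *
          (Num.sqrt 2 * (Num.sqrt (t - s) * N))) =
        (expR (- (t - s)) * Num.sqrt (t - s)) *
        (`|1 - 3 * X 0 s w ^+ 2| * (Num.sqrt 2 * N)) by ring.
      apply: (@le_trans _ _ (1 * (`|1 - 3 * X 0 s w ^+ 2| * (Num.sqrt 2 * N)))).
        by rewrite ler_wpM2r// !mulr_ge0.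
      by rewrite mul1r -mulrA ler_wpM2r// mulr_ge0.
  have -> : (fun t w => flow xi X t w * (xi 1%N w + Num.sqrt 2 * W t w)) =
      (fun t w => flow xi X t w * xi 1%N w + Num.sqrt 2 * (flow xi X t w * W t w)).
    by apply/funext => t; apply/funext => w; ring.
  apply: unif_momentsD; first by apply: unif_momentsM => //; exact: xi_unif_moments.
  apply: unif_momentsZ.
  have hW : unif_moments P [set t : R | 0 <= t]
      (fun t w => (W t w - W 0 w) / Num.sqrt (t - 0)).
    apply: (unif_moments_reindex (f := fun t => (0, t)) W_scaled_increments) => t /= t0.
    by rewrite lexx t0.
  apply: unif_moments_le (unif_momentsZ K hW) _ _.
    by move=> t _; apply: measurable_funM => //; exact: flow_measurableT.
  move=> t w /= t0; have := W_increment_abs w t0; move: (flowK t w t0).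
  rewrite {1}(W_at0 reg) subr0; move: (flow xi X t w) => f hf.
  move: ((W t w - W 0 w) / Num.sqrt (t - 0)) => N e.
  rewrite normrM e [leRHS]normrM (ger0_norm K0) mulrA ler_wpM2r//.
  apply: (@le_trans _ _ (K * expR (- 2 * t) * Num.sqrt (t - 0))).
    by rewrite ler_wpM2r ?sqrtr_ge0.
  rewrite -mulrA ler_piMr// subr0; apply: le_trans (sqrt_expR_le1 t0).
  by rewrite ler_wpM2r ?sqrtr_ge0// ler_expR; lra.
- apply: (@unif_moments_le _ _ _ _ _ _ _ (fun t w =>
    flow xi X t w * xi m.+2 w + \int[lebesgue_measure]_(s in `[0, t])
    (flow xi X t w / flow xi X s w * drift_rest m.+2 (fun k => X k s w)))); last 2 first.
  + by move=> t _; exact: (X_measurable reg).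
  + by move=> t w /= t0; rewrite (X_representation reg).
  apply: unif_momentsD; first by apply: unif_momentsM => //; exact: xi_unif_moments.
  apply: (@flow_integral_moments (fun t s w => drift_rest m.+2 (fun k => X k s w))).
  + move=> t s _.
    apply: (@subalgebra_class_drift_rest _ _ _ (measurable_class R T) m.+2
      (fun k w => X k s w)) => [|j /andP[_ jm]]; first exact: (X_measurable reg).
    by apply: (X_measurable reg); exact: leq_trans (ltnW jm) mn.
  + by move=> t w _; exact: (drift_rest_continuous reg).
  + have h : unif_moments P [set t | 0 <= t]
        (fun t w => drift_rest m.+2 (fun k => X k t w)).
      apply: (@subalgebra_class_drift_rest _ _ _
        (@unif_moments_class R _ T P R [set t | 0 <= t]) m.+2
        (fun k q => X k q.1 q.2)) => // j /andP[_ jm].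
      by apply: IH => //; exact: leq_trans (ltnW jm) mn.
    have h2 : unif_moments P [set q : R * R | 0 <= q.1 /\ 0 <= q.2 <= q.1]
        (fun q w => drift_rest m.+2 (fun k => X k q.2 w)).
      by apply: (unif_moments_reindex (f := fun q => q.2) h) => -[t s] /= [_ /andP[]].
    apply: unif_moments_le (h2) _ _.
      by move=> q hq; apply: measurable_funM => //; exact: h2.1.
    move=> [t s] w /= [t0 /andP[s0 st]].
    rewrite normrM gtr0_norm ?expR_gt0// ler_piMl// -expR0 ler_expR.
    by rewrite oppr_le0 subr_ge0.
Qed.

Lemma drift_unif_moments m : (m <= n)%N ->
  unif_moments P [set t | 0 <= t] (fun t w => drift m (fun k => X k t w)).
Proof.
move=> mn; apply: (@subalgebra_class_drift _ _ _ m (fun k q => X k q.1 q.2)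
  (@unif_moments_class R _ T P R [set t | 0 <= t])) => j jm.
by apply: X_unif_moments; exact: leq_trans mn.
Qed.

Lemma drift_measurable m s : (m <= n)%N ->
  measurable_fun setT (fun w => drift m (fun k => X k s w)).
Proof.
move=> mn; apply: (@subalgebra_class_drift _ _ _ m (fun k w => X k s w)
  (measurable_class R T)) => j jm.
by apply: (X_measurable reg); exact: leq_trans mn.
Qed.

End moment_bounds.

(** * Expansion of the powers of the series over a short step *)

(** The length is at most 1, so that extra powers of its square root are bounded and can join the
    remainder. *)
Definition step_domain (R : realType) : set (R * R) :=
  [set q | 0 <= q.1 /\ 0 < q.2 <= 1].

Section polynomial_moments.
Context (R : realType) (d : measure_display) (T : measurableType d)
  (P : probability T R) (I : Type) (D : set I).
Implicit Types Q : I -> T -> {poly R}.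

Definition poly_unif_moments Q :=
  forall k, unif_moments P D (fun i w => (Q i w)`_k).

Lemma poly_unif_momentsD Q Q' : poly_unif_moments Q -> poly_unif_moments Q' ->
  poly_unif_moments (fun i w => Q i w + Q' i w).
Proof.
move=> h h' k; under eq_fun do under eq_fun do rewrite coefD.
exact: unif_momentsD.
Qed.

Lemma poly_unif_momentsM Q Q' : poly_unif_moments Q -> poly_unif_moments Q' ->
  poly_unif_moments (fun i w => Q i w * Q' i w).
Proof.
move=> h h' k; under eq_fun do under eq_fun do rewrite coefM.
apply: (@subalgebra_class_sum _ _ _ (unif_moments_class P D) _ _ _
  (fun (j : 'I_k.+1) q => (Q q.1 q.2)`_j * (Q' q.1 q.2)`_(k - j))) => j _.
exact: unif_momentsM.
Qed.

Lemma poly_unif_moments_cst (q : {poly R}) : poly_unif_moments (fun _ _ => q).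
Proof. by move=> k; exact: unif_moments_cst. Qed.

Lemma poly_unif_momentsMn Q k : poly_unif_moments Q ->
  poly_unif_moments (fun i w => Q i w *+ k).
Proof.
move=> h; under eq_fun do under eq_fun do rewrite -mulr_natr.
exact/poly_unif_momentsM/poly_unif_moments_cst.
Qed.

Lemma poly_unif_momentsX Q k : poly_unif_moments Q ->
  poly_unif_moments (fun i w => Q i w ^+ k).
Proof.
move=> h; elim: k => [|k IH]; first exact: poly_unif_moments_cst.
under eq_fun do under eq_fun do rewrite exprS.
exact: poly_unif_momentsM.
Qed.

Lemma poly_unif_momentsC (Z : I -> T -> R) : unif_moments P D Z ->
  poly_unif_moments (fun i w => (Z i w)%:P).
Proof.
move=> h k; under eq_fun do under eq_fun do rewrite coefC.
by case: eqP => _ //; exact: unif_moments_cst.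
Qed.

Lemma poly_unif_moments_tail n (Z : nat -> I -> T -> R) :
  (forall j, (0 < j <= n)%N -> unif_moments P D (Z j)) ->
  poly_unif_moments (fun i w => tail_poly n (fun j => Z j i w)).
Proof.
move=> h k; under eq_fun do under eq_fun do rewrite coef_tail_poly.
by case E : (0 < k <= n)%N; [exact: h|exact: unif_moments_cst].
Qed.

Lemma poly_unif_moments_binomial_rest Q Q' Q'' i :
  poly_unif_moments Q -> poly_unif_moments Q' -> poly_unif_moments Q'' ->
  poly_unif_moments (fun j w => binomial_rest (Q j w) (Q' j w) (Q'' j w) i).
Proof.
move=> h h' h''; elim: i => [|i IH] /=; first exact: poly_unif_moments_cst.
apply: poly_unif_momentsD.
  apply: poly_unif_momentsM => //; apply: poly_unif_momentsD => //.
  exact: poly_unif_momentsM.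
apply: poly_unif_momentsMn; apply: poly_unif_momentsM; exact: poly_unif_momentsX.
Qed.

End polynomial_moments.

Section increments.
Context (R : realType) (d : measure_display) (T : measurableType d)
  (P : probability T R).
Variables (n : nat) (W : R -> T -> R) (xi : nat -> T -> R) (X : nat -> R -> T -> R).
Variables (lo hi : R).
Hypothesis reg : regular_expansion P n W xi X lo hi.

Definition substep_domain : set ((R * R) * R) :=
  [set q | step_domain q.1 /\ q.1.1 <= q.2 <= q.1.1 + q.1.2].

(* Half-Hoelder continuity in every L^p, at scale h rather than |s - t|. *)
Definition half_hoelder (Z : R -> T -> R) :=
  unif_moments P [set t | 0 <= t] Z /\
  unif_moments P substep_domain
    (fun q w => (Z q.2 w - Z q.1.1 w) / Num.sqrt q.1.2).

(** For products, f g - f' g' = (f - f') g + f' (g - g'). *)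
Lemma half_hoelder_class :
  subalgebra_class (fun f : R * T -> R => half_hoelder (fun s w => f (s, w))).
Proof.
split.
- move=> k; split; first exact: unif_moments_cst.
  under eq_fun do under eq_fun do rewrite subrr mul0r.
  exact: unif_moments_cst.
- move=> f g [h1 h2] [h3 h4]; split; first exact: unif_momentsD.
  have -> : (fun (q : R * R * R) w => ((f (q.2, w) + g (q.2, w)) -
        (f (q.1.1, w) + g (q.1.1, w))) / Num.sqrt q.1.2) =
      (fun q w => (f (q.2, w) - f (q.1.1, w)) / Num.sqrt q.1.2 +
        (g (q.2, w) - g (q.1.1, w)) / Num.sqrt q.1.2).
    by apply/funext => q; apply/funext => w; ring.
  exact: unif_momentsD.
- move=> f g [h1 h2] [h3 h4]; split; first exact: unif_momentsM.
  have -> : (fun (q : R * R * R) w => ((f (q.2, w) * g (q.2, w)) -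
        (f (q.1.1, w) * g (q.1.1, w))) / Num.sqrt q.1.2) =
      (fun q w => (f (q.2, w) - f (q.1.1, w)) / Num.sqrt q.1.2 * g (q.2, w) +
        f (q.1.1, w) * ((g (q.2, w) - g (q.1.1, w)) / Num.sqrt q.1.2)).
    by apply/funext => q; apply/funext => w; ring.
  apply: unif_momentsD; apply: unif_momentsM => //.
    apply: (unif_moments_reindex (f := fun q : R * R * R => q.2) h3).
    by move=> [[t h] s] /= [[t0 _] /andP[ts _]]; exact: le_trans ts.
  apply: (unif_moments_reindex (f := fun q : R * R * R => q.1.1) h1).
  by move=> [[t h] s] /= [[t0 _] _].
Qed.

Lemma X_increment m t s w : (m <= n)%N -> 0 <= t -> t <= s ->
  X m s w - X m t w =
  \int[lebesgue_measure]_(u in `[t, s]) drift m (fun k => X k u w) +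
  (if m == 1%N then Num.sqrt 2 * (W s w - W t w) else 0).
Proof.
move=> mn t0 ts; have s0 := le_trans t0 ts.
rewrite {1}(X_equation reg)// {1}(X_equation reg)//.
rewrite -(Rintegral_continuousB _ t0 ts); last exact: (drift_continuous reg).
by case: ifP => _; ring.
Qed.

Lemma Rintegral_inv_length_le1 (t h s : R) : 0 < h -> t <= s <= t + h ->
  \int[lebesgue_measure]_(u in `[t, s]) h^-1 <= 1.
Proof.
move=> h0 /andP[ts sth].
have hd u : t < u < s -> is_derive u 1 (fun y : R => h^-1 * y) h^-1.
  move=> _; apply: (is_derive_eq (is_derive_funZ h^-1 (is_derive_id u (1 : R)))).
  by rewrite mulr1.
rewrite (Rintegral_derive ts _ _ hd).
- rewrite -mulrBr mulrC ler_pdivrMr// mul1r; lra.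
- exact: continuous_fun_cst.
- by apply: continuous_funM; [exact: continuous_fun_cst|move=> y; exact: cvg_id].
Qed.

(** After division by sqrt h the drift contributes at most sqrt h times an average over the step,
    and for [m = 1] the noise contributes a Gaussian of variance at most 2. *)
Lemma X_half_hoelder m : (m <= n)%N -> half_hoelder (X m).
Proof.
move=> mn; split; first exact: (X_unif_moments reg).
have hint : unif_moments P substep_domain (fun q w =>
    \int[lebesgue_measure]_(u in `[q.1.1, q.2])
      (q.1.2^-1 * (Num.sqrt q.1.2 * drift m (fun k => X k u w)))).
  apply: (unif_moments_integral (a := fun q => q.1.1) (b := fun q => q.2)
    (k := fun q _ => q.1.2^-1)
    (g := fun q u w => Num.sqrt q.1.2 * drift m (fun k => X k u w))).
  - by move=> q _; exact: continuous_fun_cst.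
  - by move=> [[t h] s] u /= [[_ /andP[/ltW h0 _]] _]; rewrite invr_ge0.
  - by move=> [[t h] s] /= [[_ /andP[h0 _]]]; exact: Rintegral_inv_length_le1.
  - by move=> q u _; apply: measurable_funM => //; exact: (drift_measurable reg).
  - move=> q w _; apply: continuous_funM; first exact: continuous_fun_cst.
    exact: (drift_continuous reg).
  - have h1 : unif_moments P [set q : (R * R * R) * R | substep_domain q.1 /\
        q.1.1.1 <= q.2 <= q.1.2] (fun q w => drift m (fun k => X k q.2 w)).
      apply: (unif_moments_reindex (f := fun q : (R * R * R) * R => q.2)
        (drift_unif_moments reg mn)).
      by move=> [[[t h] s] u] /= [[[t0 _] _] /andP[tu _]]; exact: le_trans tu.
    apply: unif_moments_le (h1) _ _.
      by move=> q hq; apply: measurable_funM => //; exact: h1.1.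
    move=> [[[t h] s] u] w /= [[[t0 /andP[h0 hl]] _] _].
    rewrite normrM ger0_norm ?sqrtr_ge0// ler_piMl//.
    by rewrite -[leRHS]sqrtr1 ler_wsqrtr.
have hW : unif_moments P substep_domain (fun q w =>
    if m == 1%N then Num.sqrt 2 * ((W q.2 w - W q.1.1 w) / Num.sqrt q.1.2) else 0).
  case E : (m == 1%N); last exact: unif_moments_cst.
  apply: unif_momentsZ.
  have h1 : unif_moments P substep_domain (fun q w =>
     (W q.2 w - W q.1.1 w) / Num.sqrt (q.2 - q.1.1)).
    apply: (unif_moments_reindex (f := fun q : R * R * R => (q.1.1, q.2))
      (W_scaled_increments reg)).
    by move=> [[t h] s] /= [[t0 _] /andP[ts _]]; rewrite t0 ts.
  apply: unif_moments_le (h1) _ _.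
    move=> q _; apply: measurable_funM => //.
    by apply: measurable_funB; exact: (W_measurable reg).
  move=> [[t h] s] w /= [[t0 /andP[h0 hl]] /andP[ts sth]].
  rewrite normrM (W_increment_abs W w ts) mulrAC.
  move: ((W s w - W t w) / _) => N.
  rewrite ler_piMl// normfV ger0_norm ?sqrtr_ge0// ler_pdivrMr ?sqrtr_gt0// mul1r.
  by rewrite ler_wsqrtr// lerBlDl.
apply: unif_moments_le (unif_momentsD hint hW) _ _.
  by move=> q _; apply: measurable_funM => //; apply: measurable_funB;
    exact: (X_measurable reg).
move=> [[t h] s] w /= [[t0 /andP[h0 hl]] /andP[ts sth]].
rewrite X_increment// mulrDl.
rewrite (_ : _ / Num.sqrt h + _ = \int[lebesgue_measure]_(u in `[t, s])
      (h^-1 * (Num.sqrt h * drift m (fun k => X k u w))) +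
  (if m == 1%N then Num.sqrt 2 * ((W s w - W t w) / Num.sqrt h) else 0))//.
congr (_ + _); last by case: ifP => _; rewrite ?mul0r// mulrA.
have sh0 : Num.sqrt h != 0 by rewrite gt_eqF ?sqrtr_gt0.
have -> : \int[lebesgue_measure]_(u in `[t, s])
      (h^-1 * (Num.sqrt h * drift m (fun k => X k u w))) =
    \int[lebesgue_measure]_(u in `[t, s]) ((Num.sqrt h)^-1 * drift m (fun k => X k u w)).
  apply: eq_Rintegral => u _.
  rewrite mulrA -[X in X^-1](sqr_sqrtr (ltW (h0 : 0 < h))); congr (_ * _).
  by field.
rewrite RintegralZl//; first by rewrite mulrC.
by apply: continuous_integrable_itv; exact: (drift_continuous reg).
Qed.

(** The deviation of the drift from its value at the start of the step, integrated and divided by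
    [h * Num.sqrt h]. Written as an average of half-Hoelder quotients, it is visibly of order
    one. *)
Definition drift_error m (q : R * R) (w : T) : R :=
  \int[lebesgue_measure]_(s in `[q.1, q.1 + q.2]) (q.2^-1 *
    ((drift m (fun k => X k s w) - drift m (fun k => X k q.1 w)) / Num.sqrt q.2)).

Lemma drift_error_unif_moments m : (m <= n)%N ->
  unif_moments P (@step_domain R) (drift_error m).
Proof.
move=> mn.
apply: (unif_moments_integral (a := fun q => q.1) (b := fun q => q.1 + q.2)
  (k := fun q _ => q.2^-1) (g := fun q s w =>
    (drift m (fun k => X k s w) - drift m (fun k => X k q.1 w)) / Num.sqrt q.2)).
- by move=> q _; exact: continuous_fun_cst.
- by move=> [t h] s /= [_ /andP[/ltW h0 _]]; rewrite invr_ge0.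
- move=> [t h] /= [_ /andP[h0 _]]; apply: Rintegral_inv_length_le1 => //.
  by rewrite lexx andbT lerDl ltW.
- move=> q s _; apply: measurable_funM => //; apply: measurable_funB;
    exact: (drift_measurable reg).
- move=> q w _; apply: continuous_funM; last exact: continuous_fun_cst.
  apply: continuous_funB; first exact: (drift_continuous reg).
  exact: continuous_fun_cst.
- have [_] : half_hoelder (fun s w => drift m (fun k => X k s w)).
    apply: (@subalgebra_class_drift _ _ _ m (fun k q => X k q.1 q.2)
      half_hoelder_class) => j jm.
    by apply: X_half_hoelder; exact: leq_trans mn.
  exact.
Qed.

Lemma X_step m t h w : (m <= n)%N -> step_domain (t, h) ->
  X m (t + h) w - X m t w =
  (if m == 1%N then Num.sqrt 2 * (W (t + h) w - W t w) else 0) +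
  h * drift m (fun k => X k t w) + h * Num.sqrt h * drift_error m (t, h) w.
Proof.
move=> mn [/= t0 /andP[h0 h1]].
have tth : t <= t + h by rewrite lerDl ltW.
rewrite X_increment// [LHS]addrC -addrA; congr (_ + _).
have sh0 : Num.sqrt h != 0 by rewrite gt_eqF ?sqrtr_gt0.
have hn0 : h != 0 by rewrite gt_eqF.
have cd : continuous (fun s => drift m (fun k => X k s w)) by exact: (drift_continuous reg).
rewrite /drift_error /=.
have -> : \int[lebesgue_measure]_(s in `[t, t + h]) (h^-1 *
      ((drift m (fun k => X k s w) - drift m (fun k => X k t w)) / Num.sqrt h)) =
    \int[lebesgue_measure]_(s in `[t, t + h]) ((h * Num.sqrt h)^-1 *
      (drift m (fun k => X k s w) - drift m (fun k => X k t w))).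
  by apply: eq_Rintegral => s _; rewrite invfM; ring.
have id1 := continuous_integrable_itv t (t + h) cd.
have id2 := continuous_integrable_itv t (t + h)
  (@continuous_fun_cst _ (drift m (fun k => X k t w))).
rewrite RintegralZl//; last first.
  apply: continuous_integrable_itv; apply: continuous_funB => //.
  exact: continuous_fun_cst.
rewrite mulrA divff ?mulf_neq0// mul1r RintegralB//.
have -> : \int[lebesgue_measure]_(s in `[t, t + h]) drift m (fun k => X k t w) =
    h * drift m (fun k => X k t w).
  set c := drift _ _.
  have hd u : t < u < t + h -> is_derive u 1 (fun y : R => c * y) c.
    move=> _; apply: (is_derive_eq (is_derive_funZ c (is_derive_id u (1 : R)))).
    by rewrite mulr1.
  rewrite (Rintegral_derive tth _ _ hd); first by ring.
    exact: continuous_fun_cst.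
  by apply: continuous_funM; [exact: continuous_fun_cst|move=> y; exact: cvg_id].
by rewrite addrC subrK.
Qed.

Definition tail_series t w : {poly R} := tail_poly n (fun k => X k t w).
Definition tail_drift t w : {poly R} :=
  tail_poly n (fun k => drift k (fun j => X j t w)).

(* The substitute for Ito's formula. *)
Lemma series_power_step i : (0 < n)%N -> exists rem : R * R -> T -> {poly R},
  poly_unif_moments P (@step_domain R) rem /\
  forall t h w, step_domain (t, h) ->
  tail_series (t + h) w ^+ i = tail_series t w ^+ i
   + (tail_series t w ^+ i.-1 * ((Num.sqrt 2 * (W (t + h) w - W t w))%:P * 'X)) *+ i
   + (h%:P * (tail_series t w ^+ i.-1 * tail_drift t w)) *+ i
   + (tail_series t w ^+ (i - 2) *
       ((2 * (W (t + h) w - W t w) ^+ 2)%:P * 'X^2)) *+ 'C(i, 2)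
   + (h * Num.sqrt h)%:P * rem (t, h) w.
Proof.
move=> n0.
(* Orders are tracked by s = sqrt h. The increment of the series is s eta = s c + s^2 beta up to
   degree [n], with [c] the normalised noise, present in degree 1 only, and [beta] the drift with
   its error. *)
pose N (q : R * R) w := (W (q.1 + q.2) w - W q.1 w) / Num.sqrt q.2.
pose s (q : R * R) : {poly R} := (Num.sqrt q.2)%:P.
pose c q w : {poly R} := (Num.sqrt 2 * N q w)%:P * 'X.
pose y (q : R * R) w := tail_series q.1 w.
pose rho q w := tail_poly n (fun k => drift_error k q w).
pose Dp (q : R * R) w := tail_drift q.1 w.
pose beta q w := Dp q w + s q * rho q w.
pose eta (q : R * R) w := tail_poly n
  (fun k => (X k (q.1 + q.2) w - X k q.1 w) / Num.sqrt q.2).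
(* What carries s^3: the drift error in the first-order term, the part 2 c beta + s beta^2 of the
   square, and the whole expansion from third order on. *)
exists (fun q w => (y q w ^+ i.-1 * rho q w) *+ i +
  (y q w ^+ (i - 2) * (2 * (c q w * beta q w) + s q * beta q w ^+ 2)) *+ 'C(i, 2) +
  binomial_rest (y q w) (s q) (eta q w) i).
split.
  have us : poly_unif_moments P (@step_domain R) (fun q w => s q).
    apply: poly_unif_momentsC.
    apply: (@unif_moments_bounded _ _ _ _ _ _ _ 1) => [q _|[t h] w /= [_ /andP[h0 h1]]].
      exact: measurable_cst.
    by rewrite ger0_norm ?sqrtr_ge0// -[leRHS]sqrtr1 ler_wsqrtr.
  have uN : unif_moments P (@step_domain R) N.
    have h1 : unif_moments P (@step_domain R) (fun q w =>
        (W (q.1 + q.2) w - W q.1 w) / Num.sqrt (q.1 + q.2 - q.1)).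
      apply: (unif_moments_reindex (f := fun q : R * R => (q.1, q.1 + q.2))
        (W_scaled_increments reg)).
      by move=> [t h] /= [t0 /andP[h0 _]]; rewrite t0 lerDl ltW.
    have -> // : N = (fun q w => (W (q.1 + q.2) w - W q.1 w) / Num.sqrt (q.1 + q.2 - q.1)).
    by apply/funext => q; apply/funext => w; rewrite /N [q.1 + _]addrC addrK.
  have uc : poly_unif_moments P (@step_domain R) c.
    apply: poly_unif_momentsM; last exact: poly_unif_moments_cst.
    by apply: poly_unif_momentsC; exact: unif_momentsZ.
  have uy : poly_unif_moments P (@step_domain R) y.
    apply: (poly_unif_moments_tail (Z := fun k q w => X k q.1 w)) => j /andP[_ jn].
    apply: (unif_moments_reindex (f := fun q : R * R => q.1) (X_unif_moments reg jn)).
    by move=> [t h] /= [].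
  have uD : poly_unif_moments P (@step_domain R) Dp.
    apply: (poly_unif_moments_tail (Z := fun k q w => drift k (fun j => X j q.1 w))).
    move=> j /andP[_ jn].
    apply: (unif_moments_reindex (f := fun q : R * R => q.1) (drift_unif_moments reg jn)).
    by move=> [t h] /= [].
  have ur : poly_unif_moments P (@step_domain R) rho.
    apply: poly_unif_moments_tail => j /andP[_ jn].
    exact: drift_error_unif_moments.
  have ub : poly_unif_moments P (@step_domain R) beta.
    by apply: poly_unif_momentsD => //; exact: poly_unif_momentsM.
  have ue : poly_unif_moments P (@step_domain R) eta.
    apply: (poly_unif_moments_tail (Z := fun k q w =>
       (X k (q.1 + q.2) w - X k q.1 w) / Num.sqrt q.2)) => j /andP[_ jn].
    have [_ h1] := X_half_hoelder jn.
    apply: (unif_moments_reindex (f := fun q : R * R => (q, q.1 + q.2)) h1).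
    move=> [t h] [/= t0 /andP[h0 hl]].
    by rewrite /substep_domain /step_domain /= t0 h0 hl lexx lerDl (ltW h0).
  apply: poly_unif_momentsD; last exact: poly_unif_moments_binomial_rest.
  apply: poly_unif_momentsD; apply: poly_unif_momentsMn; apply: poly_unif_momentsM => //.
  - exact: poly_unif_momentsX.
  - exact: poly_unif_momentsX.
  - apply: poly_unif_momentsD; apply: poly_unif_momentsM => //.
    + exact: poly_unif_moments_cst.
    + exact: poly_unif_momentsM.
    + exact: poly_unif_momentsX.
move=> t h w Dth; have [/= t0 /andP[h0 h1]] := Dth.
have sh0 : Num.sqrt h != 0 by rewrite gt_eqF ?sqrtr_gt0.
have ss : (Num.sqrt h) ^+ 2 = h by rewrite sqr_sqrtr// ltW.
have E1 : tail_series (t + h) w = y (t, h) w + s (t, h) * eta (t, h) w.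
  apply/polyP => k; rewrite coefD coefCM !coef_tail_poly; case: ifP => _.
    by rewrite /= [Num.sqrt h * _]mulrC divfK// addrCA subrr addr0.
  by rewrite mulr0 addr0.
have E2 : s (t, h) * eta (t, h) w =
    s (t, h) * c (t, h) w + s (t, h) ^+ 2 * beta (t, h) w.
  apply/polyP => k.
  rewrite /beta /Dp /c /rho /eta /s -polyC_exp !(coefCM, coefD) !coef_tail_poly coefX /=.
  have [-> | k0] := eqVneq k 0%N.
    by rewrite /= !(mulr0, addr0).
  have k0' : (0 < k)%N by rewrite lt0n.
  have [kn|nk] := leqP k n; last first.
    (* Above degree [n] the series is cut off; [0 < n] guarantees that the noise, in degree 1, is
       not. *)
    rewrite k0'/= (_ : (k == 1%N) = false) ?mulr0 ?addr0//; last first.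
      by apply/eqP => k1; move: nk; rewrite k1 ltnNge n0.
    by rewrite !(mulr0, addr0).
  rewrite k0' /= [LHS]mulrC divfK// X_step// ss.
  have -> : (if k == 1%N then Num.sqrt 2 * (W (t + h) w - W t w) else 0) =
     Num.sqrt h * (Num.sqrt 2 * N (t, h) w * (k == 1%N)%:R).
    rewrite /N /=; case: eqP => _; last by rewrite !mulr0.
    by rewrite mulr1 mulrCA [Num.sqrt h * _]mulrC divfK.
  by ring.
have E3 : (Num.sqrt 2 * (W (t + h) w - W t w))%:P * 'X = s (t, h) * c (t, h) w.
  rewrite /s /c mulrA -polyCM; congr (_%:P * _).
  by rewrite /N /= mulrCA [Num.sqrt h * _]mulrC divfK.
have E4 : (2 * (W (t + h) w - W t w) ^+ 2)%:P * 'X^2 = (s (t, h) * c (t, h) w) ^+ 2.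
  rewrite -E3 exprMn -polyC_exp exprMn sqr_sqrtr//.
have E5 : h%:P = s (t, h) ^+ 2 by rewrite /s -polyC_exp ss.
have E6 : (h * Num.sqrt h)%:P = s (t, h) ^+ 3 by rewrite polyCM E5 [RHS]exprSr.
rewrite E1 binomial_restE E2 E3 E4 E5 E6 -/(y (t, h) w) -/(Dp (t, h) w).
rewrite /beta; move: (binomial_rest _ _ _ _) (y _ _ ^+ i.-1) (y _ _ ^+ (i - 2)) => r0 y1 y2.
rewrite -!(mulr_natr (y1 * _)) -!(mulr_natr (y2 * _)) -!(mulr_natr (s (t,h) ^+ 2 * _)).
by ring.
Qed.

End increments.

(** * Long-time limits *)

Lemma subalgebra_class_coef_tail_polyX (R : realType) (U : Type)
    (Cl : (U -> R) -> Prop) n (x : nat -> U -> R) i m : subalgebra_class Cl ->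
  (forall j, (0 < j <= n)%N -> Cl (x j)) ->
  Cl (fun u => (tail_poly n (fun j => x j u) ^+ i)`_m).
Proof.
move=> clP cx; have [clC clD clM] := clP.
elim: i m => [|i IH] m; first by under eq_fun do rewrite expr0 coef1; exact: clC.
under eq_fun do rewrite exprS coefM.
apply: (@subalgebra_class_sum _ _ _ clP _ _ _ (fun (j : 'I_m.+1) u =>
   (tail_poly n (fun j => x j u))`_j * (tail_poly n (fun j => x j u) ^+ i)`_(m - j))).
move=> j _; apply: clM => //.
under eq_fun do rewrite coef_tail_poly.
by case E : (0 < j <= n)%N; [exact: cx|exact: clC].
Qed.

Section mean_on.
Context (R : realType) (d : measure_display) (T : measurableType d)
  (P : probability T R) (A : set T).
Hypothesis mA : measurable A.

(** Not divided by the probability of [A], so that an event of probability 0 needs no separate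
    treatment. *)
Definition mean_on (Z : T -> R) : R := \int[P]_w (\1_A w * Z w).

Lemma unif_moments_indic (I : Type) (D : set I) (Z : I -> T -> R) :
  unif_moments P D Z -> unif_moments P D (fun i w => \1_A w * Z i w).
Proof.
move=> h; apply: unif_moments_le (h) _ _.
  move=> i Di; apply: measurable_funM; last exact: h.1.
  exact: measurable_indic.
move=> i w _; rewrite normrM ler_piMl// indicE.
by case: (w \in A); rewrite ?normr0 ?normr1.
Qed.

Definition all_moments (Z : T -> R) := unif_moments P [set: unit] (fun _ => Z).

Lemma unif_moments_at (I : Type) (D : set I) (Z : I -> T -> R) i :
  unif_moments P D Z -> D i -> all_moments (Z i).
Proof. by move=> h Di; exact: (unif_moments_reindex (f := fun _ : unit => i) h). Qed.

Lemma all_moments_integrable Z : all_moments Z ->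
  P.-integrable setT (EFin \o (fun w => \1_A w * Z w)).
Proof.
by move=> h; exact: (unif_moments_integrable (i := tt) (unif_moments_indic h)).
Qed.

Lemma mean_onD Z Z' : all_moments Z -> all_moments Z' ->
  mean_on (fun w => Z w + Z' w) = mean_on Z + mean_on Z'.
Proof.
move=> h h'; rewrite /mean_on -RintegralD//; try exact: all_moments_integrable.
by apply: eq_Rintegral => w _; rewrite mulrDr.
Qed.

Lemma mean_onZ k Z : all_moments Z -> mean_on (fun w => k * Z w) = k * mean_on Z.
Proof.
move=> h; rewrite /mean_on -RintegralZl//; last exact: all_moments_integrable.
by apply: eq_Rintegral => w _; rewrite mulrCA.
Qed.

Lemma mean_on_cst k : mean_on (fun=> k) = k * fine (P A).
Proof.
rewrite (_ : fine (P A) = \int[P]_w \1_A w).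
  rewrite -RintegralZl//; last by apply: integrable_indic => //; exact: fin_num_measure.
  by apply: eq_Rintegral => w _; rewrite mulrC.
by rewrite /Rintegral integral_indic// setIT.
Qed.

(** [phi] converges uniformly on [A], and |Z| <= 1 + Z^2 with second moments bounded in time
    controls the product. Convergence of the mean of [Z] is not presupposed. *)
Lemma mean_on_mul_approx (phi Z : R -> T -> R) (c : R) :
  unif_moments P [set t | 0 <= t] phi -> unif_moments P [set t | 0 <= t] Z ->
  (forall e, 0 < e -> exists M, forall t, M <= t -> forall w, A w ->
    `|phi t w - c| <= e) ->
  (mean_on (fun w => phi t w * Z t w) - c * mean_on (Z t))
    @[t --> +oo] --> (0 : R).
Proof.
move=> hphi hZ hc.
have [K hK] := unif_moments_Rintegral (unif_momentsX 2 hZ).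
apply/cvgrPdist_le => e e0.
have K0 : 0 < 1 + `|K| by rewrite ltr_pwDl.
have e1 : 0 < e / (1 + `|K|) by rewrite divr_gt0.
have [M hM] := hc _ e1.
apply: near_pinftyE; exists (Num.max 0 M) => t; rewrite ge_max => /andP[t0 Mt].
rewrite sub0r normrN.
have aphi := unif_moments_at hphi t0; have aZ := unif_moments_at hZ t0.
have aM : all_moments (fun w => (phi t w - c) * Z t w).
  apply: unif_momentsM => //; apply: unif_momentsB => //; exact: unif_moments_cst.
have -> : mean_on (fun w => phi t w * Z t w) - c * mean_on (Z t) =
    mean_on (fun w => (phi t w - c) * Z t w).
  have aPZ : all_moments (fun w => phi t w * Z t w) by exact: unif_momentsM.
  rewrite -mulNr -mean_onZ// -mean_onD//; last exact: unif_momentsZ.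
  by apply: eq_Rintegral => w _; rewrite mulrBl mulNr.
apply: le_trans (le_normr_Rintegral _ _) _ => //.
  exact: all_moments_integrable.
have i2 : P.-integrable setT (EFin \o (fun w => 1 + Z t w ^+ 2)).
  apply: integrable_funD; first exact: integrable_fun_cst.
  exact: (unif_moments_integrable (i := tt) (unif_momentsX 2 aZ)).
apply: (@le_trans _ _ (\int[P]_w (e / (1 + `|K|) * (1 + Z t w ^+ 2)))).
  apply: le_Rintegral => //.
  - exact: integrable_norm (all_moments_integrable aM).
  - exact: integrable_funZ.
  - move=> w _; rewrite indicE; case: (boolP (w \in A)) => [|_]; last first.
      by rewrite mul0r normr0 mulr_ge0 ?(ltW e1)// addr_ge0// sqr_ge0.
    rewrite inE mul1r => /(hM t Mt) h; rewrite normrM ler_pM//.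
    by rewrite -real_normK ?num_real//; have := sqr_ge0 (`|Z t w| - 1); nra.
rewrite RintegralZl// RintegralD//; last 2 first.
- exact: integrable_fun_cst.
- exact: (unif_moments_integrable (i := tt) (unif_momentsX 2 aZ)).
rewrite Rintegral_probability_cst mulrAC ler_pdivrMr// ler_pM2l// lerD2l.
exact: le_trans (ler_norm _) (le_trans (hK t t0) (ler_norm _)).
Qed.

End mean_on.

(** * Convergence of the means on a sign event *)

Section limits.
Context (R : realType) (d : measure_display) (T : measurableType d)
  (P : probability T R).
Variables (n : nat) (W : R -> T -> R) (xi : nat -> T -> R) (X : nat -> R -> T -> R).
Variables (lo hi : R).
Hypothesis reg : regular_expansion P n W xi X lo hi.
Variable sg : R.
Hypothesis sg1 : sg ^+ 2 = 1.

Let A := [set w | 0 < sg * xi 0%N w].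

Lemma sign_event_measurable : measurable A.
Proof.
have [mxi _] := xi_moments reg (leq0n n).
have := measurable_funM (measurable_cst sg) (mxi tt I).
move=> /(_ measurableT _ (measurable_itv `]0, +oo[)); rewrite setTI.
by congr measurable; apply/seteqP; split => w /=; rewrite in_itv/= andbT.
Qed.
Let mA := sign_event_measurable.
Local Notation mean := (mean_on P A).
Local Notation Y := (tail_series n X).

(** [G] is independent of the increment after [t]. The past is given only through the existence of
    some [H], so adaptedness of [G] is stated for every [H] that makes the initial data and the path
    up to [t] measurable. *)
Lemma adapted_increment_mean (t h : R) (G : T -> R) : 0 <= t -> 0 < h ->
  all_moments P G ->
  (forall H : set (set T),
    (forall k, (k <= n)%N ->
      measurable_fun setT (xi k : g_sigma_algebraType H -> R)) ->
    (forall s, 0 <= s <= t ->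
      measurable_fun setT (W s : g_sigma_algebraType H -> R)) ->
    measurable_fun setT (G : g_sigma_algebraType H -> R)) ->
  \int[P]_w (G w * (W (t + h) w - W t w)) = 0 /\
  \int[P]_w (G w * (W (t + h) w - W t w) ^+ 2) = h * \int[P]_w G w.
Proof.
move=> t0 h0 aG hG.
have [H [h1 h2 h3]] := W_filtration reg t0.
have {h1 h2}mGH := hG H h1 h2.
pose N w := W (t + h) w - W t w.
have mN : measurable_fun setT N by apply: measurable_funB; exact: (W_measurable reg).
have sh0 : 0 < Num.sqrt h by rewrite sqrtr_gt0.
have lawN B : measurable B -> P (N @^-1` B) = normal_prob 0 (Num.sqrt h) B.
  have tth : t < t + h by rewrite ltrDl.
  by move=> mB; rewrite (W_increments reg t0 tth mB) addrC addKr.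
have aN : all_moments P N by exact: gaussian_unif_moments_unscaled sh0 mN lawN.
have mG : measurable_fun setT G := aG.1 tt I.
have ind B C : measurable B -> measurable C ->
    P (G @^-1` B `&` N @^-1` C) = (P (G @^-1` B) * P (N @^-1` C))%E.
  move=> mB mC; have := mGH measurableT B mB; rewrite setTI => mGB.
  by have [_] := h3 h C h0 mC _ mGB.
have mN2 : measurable_fun setT (fun w => N w ^+ 2) by exact: measurable_funX.
have ia Z : all_moments P Z -> P.-integrable setT (EFin \o Z).
  by move=> aZ; exact: (unif_moments_integrable (i := tt) aZ).
split.
  rewrite (Rintegral_independentM mG mN ind); try by apply: ia => //; exact: unif_momentsM.
  by rewrite (gaussian_mean sh0 mN lawN) mulr0.
have aN2 : all_moments P (fun w => N w ^+ 2) by exact: unif_momentsX.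
rewrite (Rintegral_independentM mG mN2); try by apply: ia => //; exact: unif_momentsM.
  by rewrite (gaussian_variance sh0 mN lawN) sqr_sqrtr ?(ltW h0)// mulrC.
move=> B C mB mC; apply: (ind B ((fun x => x ^+ 2) @^-1` C)) => //.
have h2 : measurable_fun setT (fun x : R => x ^+ 2) by exact: measurable_funX.
by have := h2 measurableT C mC; rewrite setTI.
Qed.

Lemma series_coef_unif_moments i m :
  unif_moments P [set t | 0 <= t] (fun t w => (Y t w ^+ i)`_m).
Proof.
have := @poly_unif_momentsX _ _ _ P _ [set t : R | 0 <= t] (fun t w => Y t w) i.
apply => //; apply: (poly_unif_moments_tail (Z := fun k t w => X k t w)).
by move=> j /andP[_ jn]; exact: (X_unif_moments reg).
Qed.

(** The indicator of the sign event depends on the initial datum alone, and the coefficients are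
    adapted. The factor ['X^j] accounts for the powers of z carried by the noise. *)
Lemma series_increment_mean t h i j m : 0 <= t -> 0 < h ->
  mean (fun w => (Y t w ^+ i * 'X^j)`_m * (W (t + h) w - W t w)) = 0 /\
  mean (fun w => (Y t w ^+ i * 'X^j)`_m * (W (t + h) w - W t w) ^+ 2) =
    h * mean (fun w => (Y t w ^+ i * 'X^j)`_m).
Proof.
move=> t0 h0; rewrite /mean_on.
under eq_Rintegral do rewrite mulrA.
under [X in _ /\ X = _]eq_Rintegral do rewrite mulrA.
apply: adapted_increment_mean => //.
  apply: (unif_moments_indic mA (Z := fun _ w => (Y t w ^+ i * 'X^j)`_m)).
  under eq_fun do under eq_fun do rewrite coefMXn.
  case E : (m < j)%N; first exact: unif_moments_cst.
  exact: (unif_moments_at (series_coef_unif_moments i (m - j))).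
move=> H mxi mW; apply: measurable_funM.
  apply: measurable_indic.
  have := measurable_funM (measurable_cst sg) (mxi 0%N (leq0n n)).
  move=> /(_ measurableT _ (measurable_itv `]0, +oo[)); rewrite setTI.
  by congr measurable; apply/seteqP; split => w /=; rewrite in_itv/= andbT.
under eq_fun do rewrite coefMXn.
case E : (m < j)%N; first exact: measurable_cst.
apply: (@subalgebra_class_coef_tail_polyX _ _ _ n (fun k w => X k t w) i (m - j)
  (measurable_class R (g_sigma_algebraType H))) => k /andP[_ kn].
apply: (X_measurable_sub reg (e := idfun : g_sigma_algebraType H -> T) (t0 := t)) => //.
by rewrite t0 lexx.
Qed.

Local Notation Dr := (tail_drift n X).

Lemma coef_drift_unif_moments i m :
  unif_moments P [set t | 0 <= t] (fun t w => (Y t w ^+ i * Dr t w)`_m).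
Proof.
have := @poly_unif_momentsM _ _ _ P _ [set t : R | 0 <= t]
  (fun t w => Y t w ^+ i) (fun t w => Dr t w).
apply; first exact: series_coef_unif_moments.
apply: (poly_unif_moments_tail (Z := fun k t w => drift k (fun j => X j t w))).
by move=> j /andP[_ jn]; exact: (drift_unif_moments reg).
Qed.

(** In the mean of the one-step expansion the term linear in the noise vanishes, and the squared
    increment is replaced by its mean [h], which produces the Ito correction. *)
Lemma mean_step i m : (0 < n)%N -> exists C : R, forall t h, step_domain (t, h) ->
  `|mean (fun w => (Y (t + h) w ^+ i)`_m) - mean (fun w => (Y t w ^+ i)`_m)
    - h * (i%:R * mean (fun w => (Y t w ^+ i.-1 * Dr t w)`_m) +
       'C(i, 2)%:R * 2 * mean (fun w => (Y t w ^+ (i - 2) * 'X^2)`_m))|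
  <= C * (h * Num.sqrt h).
Proof.
move=> n0; have [rem [mrem step]] := series_power_step reg i n0.
have [C hC] := unif_moments_Rintegral (unif_moments_indic mA (mrem m)).
exists C => t h Dth; have [/= t0 /andP[h0 h1]] := Dth.
pose N w := W (t + h) w - W t w.
have aY k l : all_moments P (fun w => (Y t w ^+ k)`_l).
  exact: (unif_moments_at (series_coef_unif_moments k l)).
have aN : all_moments P N.
  have sh0 : 0 < Num.sqrt h by rewrite sqrtr_gt0.
  apply: (gaussian_unif_moments_unscaled sh0).
    by apply: measurable_funB; exact: (W_measurable reg).
  have tth : t < t + h by rewrite ltrDl.
  by move=> B mB; rewrite (W_increments reg t0 tth mB) addrC addKr.
have aX k j l : all_moments P (fun w => (Y t w ^+ k * 'X^j)`_l).
  rewrite /all_moments; under eq_fun do under eq_fun do rewrite coefMXn.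
  by case E : (l < j)%N; [exact: unif_moments_cst|exact: aY].
have aD : all_moments P (fun w => (Y t w ^+ i.-1 * Dr t w)`_m).
  exact: (unif_moments_at (coef_drift_unif_moments _ _)).
have ar : all_moments P (fun w => (rem (t, h) w)`_m).
  exact: (unif_moments_at (mrem m)).
pose z1 w := (Y t w ^+ i.-1 * 'X^1)`_m * N w.
pose z2 w := (Y t w ^+ (i - 2) * 'X^2)`_m * N w ^+ 2.
have az1 : all_moments P z1.
  exact: (unif_momentsM (aX i.-1 1%N m) aN).
have az2 : all_moments P z2.
  exact: (unif_momentsM (aX (i - 2)%N 2%N m) (unif_momentsX 2 aN)).
have [m1 _] := series_increment_mean i.-1 1 m t0 h0.
have [_ m2] := series_increment_mean (i - 2) 2 m t0 h0.
have E w : (Y (t + h) w ^+ i)`_m = (Y t w ^+ i)`_m +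
  (i%:R * Num.sqrt 2 * z1 w +
  (h * i%:R * (Y t w ^+ i.-1 * Dr t w)`_m +
  ('C(i, 2)%:R * 2 * z2 w + h * Num.sqrt h * (rem (t, h) w)`_m))).
  rewrite (step _ _ _ Dth) !coefD !coefMn !coefCM mulrCA coefCM mulrCA coefCM.
  rewrite /z1 /z2 /N -!addrA expr1; congr (_ + (_ + (_ + (_ + _)))).
  - by rewrite -mulr_natr; move: (_`_m) => a; ring.
  - by rewrite -mulr_natr; move: (_`_m) => a; ring.
  - by rewrite -mulr_natr; move: (_`_m) => a; ring.
have -> : mean (fun w => (Y (t + h) w ^+ i)`_m) = mean (fun w => (Y t w ^+ i)`_m +
  (i%:R * Num.sqrt 2 * z1 w +
  (h * i%:R * (Y t w ^+ i.-1 * Dr t w)`_m +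
  ('C(i, 2)%:R * 2 * z2 w + h * Num.sqrt h * (rem (t, h) w)`_m)))).
  by congr (mean _); apply/funext => w; exact: E.
have a5 : all_moments P (fun w => h * Num.sqrt h * (rem (t, h) w)`_m).
  exact: unif_momentsZ.
have a4 : all_moments P (fun w => 'C(i, 2)%:R * 2 * z2 w +
   h * Num.sqrt h * (rem (t, h) w)`_m).
  by apply: unif_momentsD => //; exact: unif_momentsZ.
have a3 : all_moments P (fun w => h * i%:R * (Y t w ^+ i.-1 * Dr t w)`_m +
  ('C(i, 2)%:R * 2 * z2 w + h * Num.sqrt h * (rem (t, h) w)`_m)).
  by apply: unif_momentsD => //; exact: unif_momentsZ.
have a2 : all_moments P (fun w => i%:R * Num.sqrt 2 * z1 w +
  (h * i%:R * (Y t w ^+ i.-1 * Dr t w)`_m +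
  ('C(i, 2)%:R * 2 * z2 w + h * Num.sqrt h * (rem (t, h) w)`_m))).
  by apply: unif_momentsD => //; exact: unif_momentsZ.
rewrite mean_onD// mean_onD//; last exact: unif_momentsZ.
rewrite mean_onD//; last exact: unif_momentsZ.
rewrite mean_onD//; last exact: unif_momentsZ.
rewrite !mean_onZ// m1 m2 mulr0 add0r.
move: (hC (t, h) Dth); rewrite -/(mean_on P A (fun w => (rem (t, h) w)`_m)).
move: (mean (fun w => (Y t w ^+ i)`_m)) (mean (fun w => (_ * Dr t w)`_m))
  (mean (fun w => (_ * 'X^2)`_m)) (mean (fun w => (rem _ w)`_m)) => x1 x2 x3 x4 hx.
rewrite (_ : _ - h * _ = h * Num.sqrt h * x4); last by ring.
have hh0 : 0 <= h * Num.sqrt h by rewrite mulr_ge0 ?sqrtr_ge0// ltW.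
by rewrite normrM (ger0_norm hh0) mulrC ler_wpM2r.
Qed.

(** [X 0] stays in one compact interval, on which a continuous function is bounded. *)
Lemma X0_comp_unif_moments (f : R -> R) : continuous f ->
  unif_moments P [set t | 0 <= t] (fun t w => f (X 0 t w)).
Proof.
move=> cf; set r := hi / lo.
have r0 : - r <= r.
  by have := le_trans (normr_ge0 _) (X0_le reg 0 (point : T)); rewrite -/r; lra.
have cn : {within `[- r, r], continuous (fun x => `|f x|)}.
  by apply: continuous_subspaceT; exact: continuous_fun_norm.
have [c _ hc] := EVT_max r0 cn.
apply: (@unif_moments_bounded _ _ _ _ _ _ _ `|f c|) => [t t0|t w t0].
  by apply: measurableT_comp; [exact: continuous_measurable_fun|exact: (X_measurable reg)].
by apply: hc; rewrite in_itv/= -ler_norml; exact: (X0_le reg).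
Qed.

Lemma X0_comp_uniform_limit (f : R -> R) : continuous f ->
  forall e, 0 < e -> exists M, forall t, M <= t -> forall w, A w ->
    `|f (X 0 t w) - f sg| <= e.
Proof.
move=> cf e e0.
have /cvgrPdist_le /(_ e e0) [/= r r0 hr] : f y @[y --> sg] --> f sg by exact: cf.
set K := (hi / lo) ^+ 2.
have K0 : 0 <= K by exact: sqr_ge0.
(* Since exp (2 t) > 2 t, the bound [K * expR (- 2 * t)] is below [r] once [t >= K / r]. *)
exists (Num.max 0 (K / r)) => t; rewrite ge_max => /andP[t0 Kt] w Aw.
rewrite distrC; apply: hr => /=; rewrite distrC.
apply: le_lt_trans (X0_limit reg sg1 Aw t0) _; rewrite -/K.
have E1 : 2 * t < expR (2 * t) by apply: lt_le_trans (expR_ge1Dx _); rewrite ltrDr.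
rewrite mulNr expRN ltr_pdivrMr ?expR_gt0//.
have : K <= t * r by rewrite -ler_pdivrMr.
have : 0 < expR (2 * t) by exact: expR_gt0.
nra.
Qed.

Lemma mean_X0_comp_approx (f : R -> R) (Z : R -> T -> R) : continuous f ->
  unif_moments P [set t | 0 <= t] Z ->
  (mean (fun w => f (X 0 t w) * Z t w) - f sg * mean (Z t)) @[t --> +oo] --> (0 : R).
Proof.
move=> cf hZ; apply: mean_on_mul_approx => //; first exact: X0_comp_unif_moments.
exact: X0_comp_uniform_limit.
Qed.

Lemma mean_X0_comp_cvg (f : R -> R) (Z : R -> T -> R) l : continuous f ->
  unif_moments P [set t | 0 <= t] Z -> mean (Z t) @[t --> +oo] --> l ->
  mean (fun w => f (X 0 t w) * Z t w) @[t --> +oo] --> f sg * l.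
Proof.
move=> cf hZ hl; have h1 := mean_X0_comp_approx cf hZ.
have -> : (fun t => mean (fun w => f (X 0 t w) * Z t w)) = (fun t =>
    mean (fun w => f (X 0 t w) * Z t w) - f sg * mean (Z t) + f sg * mean (Z t)).
  by apply/funext => t; rewrite subrK.
rewrite -[f sg * l]add0r; apply: cvgD => //.
by apply: cvgM => //; exact: cvg_cst.
Qed.

(** The conventions of the recursion are the boundary cases: for [i > m] the coefficient vanishes,
    and for [i = 0] the power is 1, so that only degree 0 contributes. In the remaining cases
    [discrete_relaxation] applies with rate 2 i. *)
Lemma mean_series_cvg i m : (m <= n)%N ->
  mean (fun w => (Y t w ^+ i)`_m) @[t --> +oo] --> fine (P A) * limit_coef sg m i.
Proof.
elim/ltn_ind: m i => m IHm i mn.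
(* [N] drives the backward induction in [i]: at [N = 0] the index is already beyond [m]. *)
suff H N : forall i, (m < i + N)%N ->
    mean (fun w => (Y t w ^+ i)`_m) @[t --> +oo] --> fine (P A) * limit_coef sg m i.
  by apply: (H m.+1); rewrite addnS ltnS leq_addl.
elim: N => [|N IHN] {}i; first rewrite addn0 => mi.
  under eq_fun do under [X in mean X]eq_fun do rewrite coef_tail_polyX_small//.
  rewrite limit_coef0 ?mulr0; last 2 first.
  - by rewrite (leqNgt i) mi andbF.
  - by rewrite xpair_eqE negb_and -(lt0n i) (leq_ltn_trans (leq0n _) mi) orbT.
  by rewrite mean_on_cst// mul0r; exact: cvg_cst.
move=> hi'.
have [i0|i0] := posnP i.
  rewrite {}i0; under eq_fun do under [X in mean X]eq_fun do rewrite expr0 coef1.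
  rewrite mean_on_cst// mulrC.
  have -> : limit_coef sg m 0 = (m == 0%N)%:R.
    by have [->|m0] := eqVneq m 0%N; rewrite ?limit_coef00// limit_coef0// xpair_eqE (negbTE m0).
  exact: cvg_cst.
have [mi|im] := ltnP m i.
  under eq_fun do under [X in mean X]eq_fun do rewrite coef_tail_polyX_small//.
  rewrite limit_coef0 ?mulr0; last 2 first.
  - by rewrite (leqNgt i) mi andbF.
  - by rewrite xpair_eqE negb_and -(lt0n i) (leq_ltn_trans (leq0n _) mi) orbT.
  by rewrite mean_on_cst// mul0r; exact: cvg_cst.
have n0 : (0 < n)%N by exact: leq_trans i0 (leq_trans im mn).
have L1 := IHN i.+1; have L2 := IHN i.+2.
have {}L1 := L1 ltac:(by rewrite addSnnS).
have {}L2 := L2 ltac:(by rewrite addSn addSnnS; exact: leq_trans hi' (leqnSn _)).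
pose u t := mean (fun w => (Y t w ^+ i)`_m).
pose v t := mean (fun w => (Y t w ^+ (i - 2) * 'X^2)`_m).
(* For [i = 1] the truncated [i - 2] is 0 and would point to the zeroth power; the test removes that
   value, in accordance with the binomial coefficient being 0. *)
pose l2 := if (1 < i)%N then limit_coef sg (m - 2) (i - 2) else 0.
have L3 : 'C(i, 2)%:R * 2 * v t @[t --> +oo] -->
    'C(i, 2)%:R * 2 * (fine (P A) * l2).
  rewrite /l2; case: ltnP => [i1|]; last first.
    by move=> i1; rewrite bin_small// !mul0r; under eq_fun do rewrite !mul0r; exact: cvg_cst.
  apply: cvgM; first exact: cvg_cst.
  rewrite /v; under eq_fun do under [X in mean X]eq_fun do rewrite coefMXn.
  rewrite ltnNge (leq_trans i1 im)/=; apply: IHm; last exact: leq_trans (leq_subr _ _) mn.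
  by rewrite ltn_subrL /= (leq_trans i0 im).
have [Mu hMu] := unif_moments_Rintegral
  (unif_moments_indic mA (series_coef_unif_moments i m)).
have [C hC] := mean_step i m n0.
(* 3 (1 - x^2) is the linear rate 1 - 3 x^2 plus 2; it vanishes at [sg]. *)
have Y0 : continuous (fun x : R => 3 * (1 - x ^+ 2)).
  apply: continuous_funM; first exact: continuous_fun_cst.
  apply: continuous_funB; first exact: continuous_fun_cst.
  by apply: continuous_funX => x; exact: cvg_id.
have cid : continuous (fun x : R => x) by move=> x; exact: cvg_id.
pose g1 t := mean (fun w => 3 * (1 - X 0 t w ^+ 2) * (Y t w ^+ i)`_m).
have hYi k := series_coef_unif_moments k m.
have G1 : g1 t @[t --> +oo] --> (0 : R).
  have := mean_X0_comp_approx Y0 (hYi i).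
  by under eq_fun do rewrite sg1 subrr mulr0 mul0r subr0.
have G2 := mean_X0_comp_cvg cid (hYi i.+1) L1.
have ir0 : (0 : R) < 2 * i%:R by rewrite mulr_gt0// ltr0n.
pose g2 t := mean (fun w => X 0 t w * (Y t w ^+ i.+1)`_m).
pose g3 t := mean (fun w => (Y t w ^+ i.+2)`_m).
(* The derivative of [u] without its relaxation term - 2 i u. *)
pose g t := i%:R * (g1 t - 3 * g2 t - g3 t) + 'C(i, 2)%:R * 2 * v t.
have Hg : g t @[t --> +oo] --> i%:R * (0 - 3 * (sg * (fine (P A) * limit_coef sg m i.+1))
     - fine (P A) * limit_coef sg m i.+2) + 'C(i, 2)%:R * 2 * (fine (P A) * l2).
  apply: cvgD => //; apply: cvgM; first exact: cvg_cst.
  apply: cvgB => //; apply: cvgB => //.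
  by apply: cvgM => //; exact: cvg_cst.
have -> : fine (P A) * limit_coef sg m i =
    (i%:R * (0 - 3 * (sg * (fine (P A) * limit_coef sg m i.+1))
     - fine (P A) * limit_coef sg m i.+2) +
     'C(i, 2)%:R * 2 * (fine (P A) * l2)) / (2 * i%:R).
  rewrite [in LHS]limit_coefE ?i0// -/l2.
  (* Division of i (i - 1) by 2 i yields the factor (i - 1) / 2 of the recursion. *)
  have -> : 'C(i, 2)%:R * 2 = i%:R * (i%:R - 1) :> R.
    have := bin_ffact i 2; rewrite ffactnS ffactn1 => /(congr1 (fun k => k%:R : R)).
    by rewrite !natrM => ->; rewrite -subn1 natrB.
  have ine : i%:R != 0 :> R by rewrite pnatr_eq0 -lt0n.
  by field.
apply: (@discrete_relaxation R u g (2 * i%:R) _ C Mu) => // t h t0 h01.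
have aY k : all_moments P (fun w => (Y t w ^+ k)`_m) by exact: (unif_moments_at (hYi k)).
have aX f : continuous f -> all_moments P (fun w => f (X 0 t w)).
  by move=> /X0_comp_unif_moments cf; exact: (unif_moments_at cf).
have -> : - (2 * i%:R) * u t + g t =
    i%:R * mean (fun w => (Y t w ^+ i.-1 * Dr t w)`_m) + 'C(i, 2)%:R * 2 * v t.
  rewrite /g addrA; congr (_ + _).
  have -> : mean (fun w => (Y t w ^+ i.-1 * Dr t w)`_m) =
     mean (fun w => - 2 * (Y t w ^+ i)`_m + (3 * (1 - X 0 t w ^+ 2) * (Y t w ^+ i)`_m +
       (- 3 * (X 0 t w * (Y t w ^+ i.+1)`_m) + - 1 * (Y t w ^+ i.+2)`_m))).
    congr (mean _); apply/funext => w.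
    by rewrite drift_coefM// prednK//; ring.
  have a1 := unif_momentsM (aX _ Y0) (aY i).
  have a2 := unif_momentsM (aX _ cid) (aY i.+1).
  have a3 := unif_momentsZ (-3) a2.
  have a4 := unif_momentsZ (-1) (aY i.+2).
  have a5 := unif_momentsD a3 a4.
  rewrite (mean_onD mA (unif_momentsZ (-2) (aY i)) (unif_momentsD a1 a5)).
  rewrite (mean_onD mA a1 a5) (mean_onD mA a3 a4).
  rewrite (mean_onZ mA _ (aY i)) (mean_onZ mA _ a2) (mean_onZ mA _ (aY i.+2)).
  by rewrite -/(u t) -/(g1 t) -/(g2 t) -/(g3 t); ring.
exact: hC.
Qed.

Lemma mean_composition_sum_cvg m i : (0 < i)%N -> (m <= n)%N ->
  mean (fun w => composition_sum m i (fun k => X k t w)) @[t --> +oo] -->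
    fine (P A) * limit_coef sg m i.
Proof.
move=> i0 mn; have := @mean_series_cvg i m mn.
by under eq_fun do under [X in mean X]eq_fun do rewrite coef_tail_polyX//.
Qed.

Lemma mean_X0_comp_composition_sum_cvg (f : R -> R) m i : continuous f ->
  (0 < i)%N -> (m <= n)%N ->
  mean (fun w => f (X 0 t w) * composition_sum m i (fun k => X k t w)) @[t --> +oo]
    --> f sg * (fine (P A) * limit_coef sg m i).
Proof.
move=> cf i0 mn; have := mean_X0_comp_cvg cf (series_coef_unif_moments i m)
  (mean_series_cvg (i := i) mn).
by under eq_fun do under [X in mean X]eq_fun do rewrite coef_tail_polyX//.
Qed.

End limits.

(** * Transfer to a version without exceptional paths *)

(** The path is composed with the 1-Lipschitz map [Num.max s 0], whose values lie in the half-line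
    where the path is continuous. *)
Lemma continuous_frozen (R : realType) (f : R -> R) :
  {within `[0, +oo[, continuous f} -> continuous (fun s : R => f (Num.max s 0)).
Proof.
move=> /subspace_continuousP cf s.
have h0 : `[0, +oo[%classic (Num.max s 0) by rewrite /= in_itv/= andbT le_max lexx orbT.
apply/cvgrPdist_le => e e0.
have /cvgrPdist_le/(_ e e0) := cf _ h0.
rewrite near_withinE => -[/= r r0 hr]; exists r => //= y sy.
apply: hr; last by rewrite /= in_itv/= andbT le_max lexx orbT.
apply: le_lt_trans sy => /=.
by rewrite !maxElt; do 2 case: ifPn; rewrite -?leNgt => *; rewrite ler_norml;
  apply/andP; split; have := ler_norm (s - y); have := ler_normr 0 (s - y);
  have := ler_norm (- (s - y)); rewrite normrN; lra.
Qed.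

Lemma exprn_le1D_powR (R : realType) (y : R) (p : nat) :
  `|y| ^+ p <= 1 + `|y| `^ (2 * p.+1%:R).
Proof.
have [y1|y1] := leP `|y| 1.
  apply: (@le_trans _ _ 1); last by rewrite lerDl powR_ge0.
  exact: exprn_ile1.
rewrite -powR_mulrn//; apply: le_trans (_ : `|y| `^ (2 * p.+1%:R) <= _); last first.
  by rewrite lerDr.
by apply: ler_powR; [exact: ltW|rewrite -natrM ler_nat mul2n -addnn; lia].
Qed.

(** A1 controls the exponents 2 p with p >= 1; a natural moment of order p is dominated by 1 plus
    the moment of order 2 (p + 1). *)
Lemma powR_all_moments (R : realType) d (T : measurableType d)
    (P : probability T R) (Z : T -> R) : measurable_fun setT Z ->
  (forall p : nat, ('E_P[(fun w => `|Z w| `^ (2 * p.+1%:R))%R] < +oo)%E) ->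
  all_moments P Z.
Proof.
move=> mZ hE; split => // p.
have := hE p; set E := ('E_P[_])%E => Eoo.
have E0 : (0 <= E)%E by apply: expectation_ge0 => w; exact: powR_ge0.
have Efin : E \is a fin_num by rewrite ge0_fin_numE.
have mp : measurable_fun setT (fun w => (`|Z w| `^ (2 * p.+1%:R))%:E).
  apply/measurable_EFinP; apply: (measurableT_comp (measurable_powR (2 * p.+1%:R : R))).
  exact: measurableT_comp.
exists (1 + fine E) => _ _; rewrite EFinD fineK//.
have -> : (1%:E = \int[P]_w (1 : R)%:E)%E.
  by rewrite -EFin_Rintegral ?Rintegral_probability_cst//; exact: integrable_fun_cst.
rewrite /E unlock -ge0_integralD//=.
apply: ge0_le_integral => //=.
- exact: measurable_normX.
- exact: emeasurable_funD.
- by move=> w _; rewrite -EFinD lee_fin; exact: exprn_le1D_powR.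
Qed.

Section modification.
Context (R : realType) (d : measure_display) (T : measurableType d) (N : set T).
Hypothesis mN : measurable N.

Definition modification (c : R) (Z : T -> R) w := if w \in N then c else Z w.

Lemma modification_out c Z w : ~ N w -> modification c Z w = Z w.
Proof. by move=> Nw; rewrite /modification memNset. Qed.

Lemma modification_in c Z w : N w -> modification c Z w = c.
Proof. by move=> Nw; rewrite /modification mem_set. Qed.

Lemma measurable_modification c Z : measurable_fun setT Z ->
  measurable_fun setT (modification c Z).
Proof.
move=> mZ; apply: measurable_fun_ifT => //.
apply: (measurable_fun_bool true).
rewrite setTI (_ : _ @^-1` _ = N)//.
by apply/seteqP; split => w /=; [move/set_mem|move/mem_set].
Qed.

End modification.

Lemma composition_sum0 (R : realType) m i (x : nat -> R) :
  (0 < i)%N -> (forall k, (0 < k)%N -> x k = 0) -> composition_sum m i x = 0.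
Proof.
move=> i0 x0; rewrite -(coef_tail_polyX x i0 (leqnn m)).
have -> : tail_poly m x = 0.
  apply/polyP => k; rewrite coef_tail_poly coef0.
  by case: ifP => // /andP[k0 _]; exact: x0.
by rewrite expr0n eqn0Ngt i0 coef0.
Qed.

Section regular_version.
Context (R : realType) (d : measure_display) (T : measurableType d)
  (P : probability T R) (n : nat)
  (W : R -> {RV P >-> R})
  (xieps : R -> {RV P >-> R}) (xi : nat -> {RV P >-> R})
  (X : nat -> R -> {RV P >-> R}).
Hypotheses (hW : brownian_motion W)
  (hindep : initial_data_independent n W xieps xi)
  (hA1 : assumption_A1 n xieps xi)
  (hA2 : assumption_A2 xi)
  (hX : expansion_coefficients n W xi X).

Lemma exceptional_set : exists N rmin rmax, [/\ measurable N, P N = 0%E,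
  0 < rmin < rmax &
  forall w, ~ N w -> [/\ W 0 w = 0, {within `[0, +oo[, continuous (fun t => W t w)},
    rmin < `|xi 0%N w| < rmax &
    forall m, (m <= n)%N -> {within `[0, +oo[, continuous (fun t => X m t w)} /\
      forall t, 0 <= t ->
        X m t w = xi m w
          + \int[lebesgue_measure]_(s in `[0, t]) drift m (fun k => X k s w)
          + (if m == 1%N then Num.sqrt 2 * W t w else 0)]].
Proof.
have [W0 _ _ Wc] := hW; have [rmin [rmax [r0 rr hr]]] := hA2.
have hX' : {ae P, forall w, forall m : 'I_n.+1,
      {within `[0, +oo[, continuous (fun t => X m t w)} /\
      forall t, 0 <= t ->
        X m t w = xi m w
          + \int[lebesgue_measure]_(s in `[0, t]) drift m (fun k => X k s w)
          + (if m == 1%N :> nat then Num.sqrt 2 * W t w else 0)}.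
  by apply: filter_forall => m; apply: hX; rewrite -ltnS.
have [N [mN PN hN]] := filterI (filterI W0 Wc) (filterI hr hX').
exists N, rmin, rmax; split => //; first by rewrite r0.
move=> w Nw.
have [[h1 h2] [h3 h4]] : (W 0 w = 0 /\ {within `[0, +oo[, continuous (fun t => W t w)}) /\
   (rmin < `|xi 0%N w| < rmax /\ forall m : 'I_n.+1,
      {within `[0, +oo[, continuous (fun t => X m t w)} /\
      forall t, 0 <= t ->
        X m t w = xi m w
          + \int[lebesgue_measure]_(s in `[0, t]) drift m (fun k => X k s w)
          + (if m == 1%N :> nat then Num.sqrt 2 * W t w else 0)).
  by apply: contrapT => h; apply: Nw; apply: hN.
by split => // m mn; exact: (h4 (Ordinal (mn : (m < n.+1)%N))).
Qed.

Lemma regular_version : exists N W' xi' X' lo hi,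
  [/\ measurable N, P N = 0%E, regular_expansion P n W' xi' X' lo hi &
    forall w, ~ N w ->
      (forall k, xi' k w = xi k w) /\
      (forall m t, 0 <= t -> X' m t w = X m t w)].
Proof.
have [N [rmin [rmax [mN PN0 /andP[r0 rr] hN]]]] := exceptional_set.
(* On the exceptional set the data become the noiseless equilibrium: [xi' 0] and [X' 0] are 1,
   everything else is 0. This solves all the equations, which therefore hold on every path. *)
pose W' s := modification N 0 (W (Num.max s 0)).
pose xi' k := modification N (k == 0%N)%:R (xi k).
pose X' m s := modification N (m == 0%N)%:R (X m (Num.max s 0)).
have W'E s w : ~ N w -> 0 <= s -> W' s w = W s w.
  by move=> Nw s0; rewrite /W' modification_out// max_l.
have xi'E k w : ~ N w -> xi' k w = xi k w.
  by move=> Nw; rewrite /xi' modification_out.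
have X'E m s w : ~ N w -> 0 <= s -> X' m s w = X m s w.
  by move=> Nw s0; rewrite /X' modification_out// max_l.
have X'0 m s w : N w -> X' m s w = (m == 0%N)%:R.
  by move=> Nw; rewrite /X' modification_in.
have mW' s : measurable_fun setT (W' s) by exact: measurable_modification.
have mxi' k : measurable_fun setT (xi' k) by exact: measurable_modification.
have mX' m s : measurable_fun setT (X' m s) by exact: measurable_modification.
(* The bounds are widened to enclose 1, as required by the double-well estimates and by the
   replacement value 1. *)
exists N, W', xi', X', (Num.min rmin 1), (Num.max rmax 1); split => //; last first.
  by move=> w Nw; split => [k|m t t0]; [exact: xi'E|exact: X'E].
split => //.
- by rewrite lt_min r0 ltr01.
- by rewrite ge_min lexx orbT.
- by rewrite le_max lexx orbT.
- move=> w; have [Nw|Nw] := pselect (N w).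
    by rewrite /xi' modification_in// normr1 ge_min le_max lexx !orbT.
  rewrite xi'E//; have [_ _ /andP[h1 h2] _] := hN w Nw.
  by rewrite ge_min le_max (ltW h1) (ltW h2).
- move=> k kn.
  have axi : all_moments P (xi k).
    by apply: powR_all_moments => // p; have [] := hA1 (p := p.+1%:R) (k := k);
      rewrite ?ler1n.
  apply: unif_moments_le (unif_momentsD (unif_moments_cst P [set: unit] 1)
    (unif_momentsX 2 axi)) _ _ => [_ _|_ w _]; first exact: mxi'.
  have x0 := sqr_ge0 (xi k w); rewrite [leRHS]ger0_norm ?addr_ge0//.
  rewrite /xi' /modification; case: ifP => _.
    by case: (k == 0%N); rewrite ?normr1 ?normr0 ?lerDl// addr_ge0.
  rewrite -real_normK ?num_real//; have := sqr_ge0 (`|xi k w| - 1).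
  by have := normr_ge0 (xi k w); nra.
- move=> w.
  have [Nw|Nw] := pselect (N w).
    rewrite (_ : W'^~ w = cst 0); first by move=> s; exact: cvg_cst.
    by apply/funext => s; rewrite /W' modification_in.
  have [_ cW _ _] := hN w Nw.
  rewrite (_ : W'^~ w = fun s => W (Num.max s 0) w); first exact: (continuous_frozen cW).
  by apply/funext => s; rewrite /W' modification_out.
- move=> w; have [Nw|Nw] := pselect (N w); first by rewrite /W' modification_in.
  by rewrite W'E//; have [-> _ _ _] := hN w Nw.
- move=> s t s0 st A mA; have [_ hinc _ _] := hW.
  rewrite -hinc//; apply: (measure_ae_eq _ _ mN PN0).
  + by rewrite -[X in measurable X]setTI; apply: measurable_funB.
  + by rewrite -[X in measurable X]setTI; apply: measurable_funB.
  + by move=> w Nw /=; rewrite !W'E// (le_trans s0 (ltW st)).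
- move=> m w mn; have [Nw|Nw] := pselect (N w).
    rewrite (_ : X' m ^~ w = cst (m == 0%N)%:R); first by move=> s; exact: cvg_cst.
    by apply/funext => s; exact: X'0.
  have [_ _ _ /(_ m mn)[cX _]] := hN w Nw.
  rewrite (_ : X' m ^~ w = fun s => X m (Num.max s 0) w); first exact: (continuous_frozen cX).
  by apply/funext => s; rewrite /X' modification_out.
- by move=> m s w _ s0; rewrite /X' max_r// max_l.
- move=> m t w mn t0; have [Nw|Nw] := pselect (N w).
    rewrite X'0// /xi' /W' !modification_in// mulr0 if_same addr0.
    have -> : (fun s => drift m (fun k => X' k s w)) = cst 0.
      apply/funext => s; under [X in drift _ X]eq_fun do rewrite X'0//.
      case: m mn => [|m] mn; first by rewrite /drift expr1n subrr.
      rewrite driftE// /= mulr0 add0r /drift_rest !composition_sum0//.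
        by rewrite mulr0 subrr.
      + by case.
      + by case.
    by rewrite Rintegral_cst// mul0r addr0.
  rewrite X'E// xi'E// W'E//.
  have [_ _ _ /(_ m mn)[_ ->//]] := hN w Nw.
  congr (_ + _ + _); apply: eq_Rintegral => s; rewrite inE/= in_itv/= => /andP[s0 _].
  by congr drift; apply/funext => k; rewrite X'E.
(* The modified variables agree with the original ones only outside [N]; their events belong to
   [history] because it allows changes on null sets. *)
- move=> t t0; exists (history n W xieps xi t); split.
  + move=> k kn _ B mB; rewrite setTI; apply: sub_gen_smallest.
    apply: (@history_initial _ _ _ _ n W xieps xi t _ N k B kn mB) => //.
      by rewrite -[X in measurable X]setTI; exact: mxi'.
    by move=> w Nw /=; rewrite xi'E.
  + move=> s /andP[s0 st] _ B mB; rewrite setTI; apply: sub_gen_smallest.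
    apply: (@history_path _ _ _ _ n W xieps xi t _ N s B) => //; first by rewrite s0.
      by rewrite -[X in measurable X]setTI; exact: mW'.
    move=> w Nw /=; rewrite W'E//.
    by have [-> _ _ _] := hN w Nw; rewrite subr0.
  + move=> h B h0 mB A hA.
    have [mA indA] := history_independent hW hindep t0 h0 mB hA.
    split => //.
    have th0 : 0 <= t + h by rewrite addr_ge0// ltW.
    have mI : measurable [set w | B (W' (t + h) w - W' t w)].
      by rewrite -[X in measurable X]setTI; apply: measurable_funB.
    have mI' := measurable_increment_event W t h mB.
    have -> : P [set w | B (W' (t + h) w - W' t w)] = P (increment_event W t h B).
      apply: (measure_ae_eq mI mI' mN PN0) => w Nw /=.
      by rewrite /increment_event/= !W'E.
    rewrite -indA; apply: (measure_ae_eq _ _ mN PN0); try exact: measurableI.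
    by move=> w Nw /=; rewrite /increment_event/= !W'E.
Qed.

End regular_version.

Lemma cvg_pinfty_eq (R : realType) (V : topologicalType) (u v : R -> V) (l : V) :
  (forall t, 0 <= t -> u t = v t) -> u t @[t --> +oo] --> l ->
  v t @[t --> +oo] --> l.
Proof.
move=> uv hu; apply: cvg_trans hu; apply: near_eq_cvg.
by apply: near_pinftyE; exists 0 => t t0; rewrite uv.
Qed.

Lemma cvg_EFin_comp (R : realType) (u : R -> R) (l : R) :
  u t @[t --> +oo] --> l -> (u t)%:E @[t --> +oo] --> l%:E.
Proof. by move=> ul; apply: cvg_comp ul _; exact: cvg_id. Qed.

(** * Integrals that agree off a null set *)

Section null_sets.
Import HBNNSimple.
Context (R : realType) (d : measure_display) (T : measurableType d)
  (P : probability T R) (N : set T).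
Hypotheses (mN : measurable N) (PN0 : P N = 0%E).

Local Notation simple_sup f := (ereal_sup [set sintegral P h |
  h in [set h : {nnsfun T >-> R} | forall w, ((h w)%:E <= f w)%E]]).

(** A simple function below [f], once set to 0 on [N], lies below [g], which is nonnegative there;
    its integral is unchanged. *)
Lemma simple_sup_null_set_le (f g : T -> \bar R) : (forall w, 0 <= g w)%E ->
  (forall w, ~ N w -> f w = g w) -> (simple_sup f <= simple_sup g)%E.
Proof.
move=> g0 fg; apply: ub_ereal_sup => _ [h /= hf <-].
apply: ereal_sup_ubound; exists (proj_nnsfun h (measurableC mN)) => /= [w|].
  rewrite mindicE; case: (boolP (w \in ~` N)) => [|_]; last by rewrite mulr0.
  by rewrite inE => Nw; rewrite mulr1 -fg.
rewrite -!integralT_nnsfun; apply: ae_eq_integral => //.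
- by apply/measurable_EFinP.
- by apply/measurable_EFinP.
- exists N; split => // w /= hw; apply: contrapT => Nw; apply: hw => _.
  by rewrite mindicE mem_set// mulr1.
Qed.

(* No measurability of f and g is assumed. *)
Lemma integral_null_set (f g : T -> \bar R) : (forall w, ~ N w -> f w = g w) ->
  (\int[P]_w f w = \int[P]_w g w)%E.
Proof.
move=> fg; rewrite /integral !patch_setT.
by congr (_ - _)%E; apply/eqP; rewrite eq_le !simple_sup_null_set_le// => w Nw;
  rewrite ?funeposE ?funenegE fg.
Qed.

Lemma integral_null_set_mean_on (A B : set T) (Z Z' : T -> R) : measurable A ->
  all_moments P Z' -> (forall w, ~ N w -> (B w <-> A w) /\ Z w = Z' w) ->
  (\int[P]_(w in B) (Z w)%:E = (mean_on P A Z')%:E)%E.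
Proof.
move=> mA aZ h; rewrite EFin_Rintegral; last exact: all_moments_integrable.
rewrite integral_mkcond; apply: integral_null_set => w Nw.
have [AB ZE] := h w Nw.
rewrite patchE indicE ZE.
have -> : (w \in B) = (w \in A) by apply/idP/idP; rewrite !inE => /AB.
by case: ifP; rewrite ?mul1r ?mul0r.
Qed.

End null_sets.

Section sums.
Context (R : realType) (d : measure_display) (T : measurableType d)
  (P : probability T R) (A : set T).
Hypothesis mA : measurable A.

Lemma mean_on_sum_cvg (J : eqType) (r : seq J) (Z : J -> R -> T -> R) (l : J -> R) :
  (forall j, j \in r -> unif_moments P [set t | 0 <= t] (Z j) /\
     mean_on P A (Z j t) @[t --> +oo] --> l j) ->
  unif_moments P [set t | 0 <= t] (fun t w => \sum_(j <- r) Z j t w) /\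
  mean_on P A (fun w => \sum_(j <- r) Z j t w) @[t --> +oo] --> \sum_(j <- r) l j.
Proof.
elim: r => [|j r IH] h.
  have e0 : (fun t w => \sum_(j <- [::]) Z j t w) = (fun _ _ => 0).
    by apply/funext => t; apply/funext => w; rewrite big_nil.
  rewrite big_nil e0; split; first exact: unif_moments_cst.
  rewrite (_ : (fun t => _) = fun=> 0); first exact: cvg_cst.
  apply/funext => t; rewrite -[LHS]/(mean_on P A ((fun t w => \sum_(j <- [::]) Z j t w) t)).
  by rewrite e0 mean_on_cst// mul0r.
have [u1 c1] := h j (mem_head _ _).
have [k kr|u2 c2] := IH; first by apply: h; rewrite inE kr orbT.
split.
  rewrite (_ : (fun t w => _) = fun t w => Z j t w + \sum_(j <- r) Z j t w).
    exact: unif_momentsD.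
  by apply/funext => t; apply/funext => w; rewrite big_cons.
rewrite big_cons; apply: cvg_pinfty_eq (cvgD c1 c2) => t t0.
rewrite [LHS](_ : _ = mean_on P A (Z j t) + mean_on P A (fun w => \sum_(j <- r) Z j t w))//.
rewrite -mean_onD//; last 2 first.
- exact: (unif_moments_at u1).
- exact: (unif_moments_at u2).
by congr (mean_on _ _ _); apply/funext => w; rewrite big_cons.
Qed.

End sums.

(** * Means over both sign events and sums with derivatives of the test function *)

Section weak_limits.
Context (R : realType) (d : measure_display) (T : measurableType d)
  (P : probability T R).
Variables (n : nat) (W : R -> T -> R) (xi : nat -> T -> R) (X : nat -> R -> T -> R).
Variables (lo hi : R).
Hypothesis reg : regular_expansion P n W xi X lo hi.
Let A (sg : R) := [set w | 0 < sg * xi 0%N w].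
Let mA sg : measurable (A sg) := sign_event_measurable reg sg.

(** [xi 0] is bounded away from 0 on every path, so the two sign events partition the sample
    space. *)
Lemma sign_event_split Z : all_moments P Z ->
  (\int[P]_w (Z w)%:E = (mean_on P (A 1) Z + mean_on P (A (-1)) Z)%:E)%E.
Proof.
move=> aZ; rewrite -EFin_Rintegral; last exact: (unif_moments_integrable (i := tt) aZ).
congr EFin; rewrite /mean_on -RintegralD//; last 2 first.
- exact: all_moments_integrable.
- exact: all_moments_integrable.
apply: eq_Rintegral => w _; rewrite -mulrDl.
have /andP[lw _] := xi0_bounds reg w; have lo0 := lo_gt0 reg.
suff -> : \1_(A 1) w + \1_(A (-1)) w = 1 :> R by rewrite mul1r.
rewrite !indicE.
have [w0|w0|w0] := ltgtP (xi 0%N w) 0.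
- by rewrite memNset ?mem_set ?add0r//= /A /=; lra.
- by rewrite mem_set ?memNset ?addr0//= /A /=; lra.
- by move: lw; rewrite w0 normr0; lra.
Qed.

Lemma X0_comp_cvg (sg : R) (f : R -> R) w : sg ^+ 2 = 1 -> continuous f -> A sg w ->
  f (X 0 t w) @[t --> +oo] --> f sg.
Proof.
move=> sg1 cf Aw; apply/cvgrPdist_le => e e0.
have [M hM] := X0_comp_uniform_limit reg sg1 cf e0.
by apply: near_pinftyE; exists M => t Mt; rewrite distrC; exact: hM.
Qed.

Lemma composition_sum_unif_moments m i : (0 < i)%N -> (m <= n)%N ->
  unif_moments P [set t | 0 <= t] (fun t w => composition_sum m i (fun k => X k t w)).
Proof.
move=> i0 mn; rewrite (_ : (fun t w => _) = fun t w => (tail_series n X t w ^+ i)`_m).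
  exact: (series_coef_unif_moments reg).
by apply/funext => t; apply/funext => w; rewrite coef_tail_polyX.
Qed.

Lemma mean_weak_sum_cvg (sg : R) (f : nat -> R -> R) m : sg ^+ 2 = 1 -> (m <= n)%N ->
  (forall i, (0 < i <= m)%N -> continuous (f i)) ->
  unif_moments P [set t | 0 <= t] (fun t w => \sum_(1 <= i < m.+1)
    (i`!%:R)^-1 * (f i (X 0 t w) * composition_sum m i (fun k => X k t w))) /\
  mean_on P (A sg) (fun w => \sum_(1 <= i < m.+1)
    (i`!%:R)^-1 * (f i (X 0 t w) * composition_sum m i (fun k => X k t w)))
  @[t --> +oo] -->
  fine (P (A sg)) * \sum_(1 <= i < m.+1) limit_coef sg m i / i`!%:R * f i sg.
Proof.
move=> sg1 mn cf; rewrite mulr_sumr.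
apply: (mean_on_sum_cvg (mA sg) (Z := fun i t w =>
  (i`!%:R)^-1 * (f i (X 0 t w) * composition_sum m i (fun k => X k t w)))).
move=> i; rewrite mem_index_iota ltnS => im; have /andP[i0 _] := im.
have um : unif_moments P [set t | 0 <= t] (fun t w =>
    f i (X 0 t w) * composition_sum m i (fun k => X k t w)).
  apply: unif_momentsM; first exact: (X0_comp_unif_moments reg (cf i im)).
  exact: composition_sum_unif_moments.
split; first exact: unif_momentsZ.
have h := mean_X0_comp_composition_sum_cvg reg sg1 (cf i im) i0 mn.
rewrite (_ : _ * _ = (i`!%:R)^-1 * (f i sg * (fine (P (A sg)) * limit_coef sg m i))); last first.
  by ring.
apply: (@cvg_pinfty_eq _ _ (fun t => (i`!%:R)^-1 * mean_on P (A sg) (fun w =>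
  f i (X 0 t w) * composition_sum m i (fun k => X k t w)))); last first.
  by apply: cvgM => //; exact: cvg_cst.
move=> t t0; rewrite [RHS]mean_onZ//; exact: (unif_moments_at um).
Qed.

End weak_limits.

(** * The limits for the original processes *)

Theorem theorem1p3 (R : realType) (d : measure_display) (T : measurableType d)
  (P : probability T R) (n : nat)
  (W : R -> {RV P >-> R})
  (xieps : R -> {RV P >-> R}) (xi : nat -> {RV P >-> R})
  (X : nat -> R -> {RV P >-> R})
  (hW : brownian_motion W)
  (hindep : initial_data_independent n W xieps xi)
  (hA1 : assumption_A1 n xieps xi)
  (hA2 : assumption_A2 xi)
  (hX : expansion_coefficients n W xi X)
  (F : R -> R) (hF : C_class n.+1 F) (hFgrowth : poly_growth n.+1 F) :
  let Pos := [set w | 0 < xi 0%N w] in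
  let Neg := [set w | xi 0%N w < 0] in
  let S (m i : nat) (t : R) (w : T) :=
    composition_sum m i (fun k => X k t w) in
  exists (b : nat -> R) (c cbar : int -> int -> R),
  [/\ (* (i) *)
      [/\ weak_coefficient X 0 t F @[t --> +oo] --> (b 0%N)%:E,
          {ae P, forall w, cvg (F (X 0%N t w) @[t --> +oo])},
          (b 0%N)%:E = 'E_P[(fun w => lim (F (X 0%N t w) @[t --> +oo]))%R]%E &
          (b 0%N)%:E = ((F 1)%:E * P Pos + (F (-1))%:E * P Neg)%E],
      (* (ii) *)
      [/\ determined_by_recursion 1 n c,
          determined_by_recursion (-1) n cbar &
          forall m i : nat, (1 <= m <= n)%N -> (1 <= i <= m)%N ->
            ((0 < P Pos)%E ->
               cond_expectation P (S m i t) Pos @[t --> +oo]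
                 --> (c m i)%:E) /\
            ((0 < P Neg)%E ->
               cond_expectation P (S m i t) Neg @[t --> +oo]
                 --> (cbar m i)%:E)] &
      (* (iii) *)
      forall m : nat, (1 <= m <= n)%N ->
        [/\ weak_coefficient X m t F @[t --> +oo] --> (b m)%:E,
            (b m)%:E =
              (P Pos * (\sum_(1 <= i < m.+1) c m i / i`!%:R * derive1n i F 1)%:E
               + P Neg *
                 (\sum_(1 <= i < m.+1) cbar m i / i`!%:R * derive1n i F (-1))%:E)%E &
            odd m -> b m = 0]].
Proof.
move=> Pos Neg S.
have [N [W' [xi' [X' [lo [hi [mN PN0 reg hN]]]]]]] := regular_version hW hindep hA1 hA2 hX.
pose A sg := [set w | 0 < sg * xi' 0%N w].
have mA sg : measurable (A sg) := sign_event_measurable reg sg.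
have cF i : (i <= n.+1)%N -> continuous (derive1n i F).
  have [dF cFn] := hF; rewrite leq_eqVlt => /predU1P[->//|/dF h] x.
  by apply: differentiable_continuous; exact/derivable1_diffP/h.
have PosA w : ~ N w -> Pos w <-> A 1 w.
  by move=> /hN[x0 _]; rewrite /Pos /A /= x0 mul1r.
have NegA w : ~ N w -> Neg w <-> A (-1) w.
  by move=> /hN[x0 _]; rewrite /Neg /A /= x0 mulN1r oppr_gt0.
have mPos : measurable Pos.
  rewrite (_ : Pos = xi 0%N @^-1` `]0, +oo[); last first.
    by apply/seteqP; split => w /=; rewrite in_itv/= andbT.
  by rewrite -[X in measurable X]setTI; exact: (measurable_funPT (xi 0%N)).
have mNeg : measurable Neg.
  rewrite (_ : Neg = xi 0%N @^-1` `]-oo, 0[); last first.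
    by apply/seteqP; split => w /=; rewrite in_itv/=.
  by rewrite -[X in measurable X]setTI; exact: (measurable_funPT (xi 0%N)).
have PPos : P Pos = P (A 1) by exact: (measure_ae_eq mPos (mA 1) mN PN0).
have PNeg : P Neg = P (A (-1)) by exact: (measure_ae_eq mNeg (mA (-1)) mN PN0).
pose p sg := fine (P (A sg)).
have PE sg : P (A sg) = (p sg)%:E by rewrite /p fineK// fin_num_measure.
pose D sg m := \sum_(1 <= i < m.+1) limit_coef sg m i / i`!%:R * derive1n i F sg.
pose b m := if m is 0%N then F 1 * p 1 + F (-1) * p (-1)
  else p 1 * D 1 m + p (-1) * D (-1) m.
have sq1 : 1 ^+ 2 = 1 :> R by rewrite expr1n.
have sqN1 : (-1) ^+ 2 = 1 :> R by rewrite sqrrN expr1n.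
have cF0 : continuous F by exact: (cF 0%N).
(* A measurable function defined everywhere through the modified initial datum; outside [N] it is
   the pointwise limit. *)
pose g w := if w \in A 1 then F 1 else F (-1).
have limF w : ~ N w -> F (X 0%N t w) @[t --> +oo] --> g w.
  move=> Nw; have [_ XE] := hN w Nw.
  have X'F : F (X' 0%N t w) @[t --> +oo] --> g w.
    rewrite /g; case: ifPn => [|].
      by rewrite inE; exact: (X0_comp_cvg reg sq1 cF0).
    rewrite notin_setE => nA; apply: (X0_comp_cvg reg sqN1 cF0).
    have /andP[lw _] := xi0_bounds reg w; have lo0 := lo_gt0 reg.
    rewrite /= mulN1r oppr_gt0 ltNge le_eqVlt; apply/negP => /predU1P[x0|x0].
      by move: lw; rewrite -x0 normr0 leNgt lo0.
    by apply: nA; rewrite /A /= mul1r.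
  by apply: cvg_pinfty_eq X'F => t t0; rewrite XE.
exists b, (limit_coefz 1), (limit_coefz (-1)); split.
- split.
  + have h sg : sg ^+ 2 = 1 -> mean_on P (A sg) (fun w => F (X' 0%N t w) * 1)
        @[t --> +oo] --> F sg * p sg.
      move=> sg1; apply: (mean_X0_comp_cvg reg sg1 (Z := fun _ _ => 1) cF0).
        exact: unif_moments_cst.
      have -> : (fun _ : R => mean_on P [set w | 0 < sg * xi' 0%N w] (fun=> 1)) = fun=> p sg.
        by apply/funext => t; rewrite (mean_on_cst _ (mA sg)) mul1r.
      exact: cvg_cst.
    apply: (cvg_pinfty_eq (u := fun t =>
      (mean_on P (A 1) (fun w => F (X' 0%N t w) * 1) +
       mean_on P (A (-1)) (fun w => F (X' 0%N t w) * 1))%:E)); last first.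
      by apply: cvg_EFin_comp; apply: cvgD; exact: h.
    move=> t t0; rewrite /weak_coefficient expectation.unlock.
    rewrite -(sign_event_split reg); last first.
      apply: (unif_momentsM (Z := fun _ w => F (X' 0%N t w)) (Z' := fun _ _ => 1)).
        exact: (unif_moments_at (X0_comp_unif_moments reg cF0) t0).
      exact: unif_moments_cst.
    by apply: (integral_null_set mN PN0) => w Nw; rewrite mulr1 (hN w Nw).2.
  + by exists N; split => // w /= hw; apply: contrapT => Nw; apply: hw;
      apply/cvg_ex; exists (g w); exact: limF.
  (* The comparison with [g] asks no measurability of the [lim] and ignores its values on [N]. *)
  + rewrite expectation.unlock (integral_null_set mN PN0 (g := fun w => (g w)%:E)); last first.
      by move=> w Nw; congr EFin; apply: norm_cvg_lim; exact: limF.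
    have ag : all_moments P g.
      apply: (@unif_moments_bounded _ _ _ _ _ _ _ (`|F 1| + `|F (-1)|)) => [_ _|_ w _].
        exact: (measurable_modification (mA 1) (F 1) (measurable_cst (F (-1)))).
      by rewrite /g; case: ifP => _; rewrite ?lerDl ?lerDr.
    rewrite (sign_event_split reg ag) /b.
    have -> : mean_on P (A 1) g = mean_on P (A 1) (fun=> F 1).
      apply: eq_Rintegral => w _; rewrite indicE /g.
      by case: ifP; rewrite ?mul0r.
    have -> : mean_on P (A (-1)) g = mean_on P (A (-1)) (fun=> F (-1)).
      apply: eq_Rintegral => w _; rewrite indicE /g.
      case: (boolP (w \in A (-1))) => [|_]; last by rewrite !mul0r.
      rewrite inE /A /= => wm; rewrite memNset//= /A /=; lra.
    by rewrite !mean_on_cst.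
  + by rewrite PPos PNeg !PE.
- split.
  + split; first exact: limit_coefz_recursion.
    by move=> c' hc'; exact: (coeff_recursion_unique (limit_coefz_recursion 1 n)).
  + split; first exact: limit_coefz_recursion.
    by move=> c' hc'; exact: (coeff_recursion_unique (limit_coefz_recursion (-1) n)).
  + move=> m i /andP[_ mn] /andP[i0 im].
    have condlim sg B : sg ^+ 2 = 1 -> (forall w, ~ N w -> B w <-> A sg w) ->
        P B = P (A sg) -> (0 < P B)%E ->
        cond_expectation P (S m i t) B @[t --> +oo] --> (limit_coef sg m i)%:E.
      move=> sg1 BA PB PB0.
      (* Only here is the probability of the conditioning event divided by. *)
      have p0 : p sg != 0.
        by move: PB0; rewrite PB PE lte_fin => /gt_eqF ->.
      apply: (cvg_pinfty_eq (u := fun t => ((p sg)^-1 *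
        mean_on P (A sg) (fun w => composition_sum m i (fun k => X' k t w)))%:E)); last first.
        apply: cvg_EFin_comp; rewrite -[limit_coef sg m i](mulKf p0).
        apply: cvgM; first exact: cvg_cst.
        exact: (mean_composition_sum_cvg reg sg1 i0 mn).
      move=> t t0; rewrite /cond_expectation PB EFinM; congr (_ * _)%E.
      apply/esym/(integral_null_set_mean_on mN PN0 (mA sg)).
        exact: (unif_moments_at (composition_sum_unif_moments reg i0 mn) t0).
      move=> w Nw; split; first exact: BA.
      by rewrite /S; congr composition_sum; apply/funext => k; rewrite (hN w Nw).2.
    rewrite !limit_coefz_nat; split; first exact: condlim.
    exact: condlim.
- move=> m /andP[m0 mn]; split.
  + have h1 := mean_weak_sum_cvg reg sq1 mn (f := fun i => derive1n i F).
    have hN1 := mean_weak_sum_cvg reg sqN1 mn (f := fun i => derive1n i F).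
    have cFm i : (0 < i <= m)%N -> continuous (derive1n i F).
      by move=> /andP[_ im]; apply: cF; exact: leq_trans im (leq_trans mn (leqnSn n)).
    have [um {}h1] := h1 cFm; have [_ {}hN1] := hN1 cFm.
    have -> : (b m)%:E = (p 1 * D 1 m + p (-1) * D (-1) m)%:E.
      by rewrite /b; case: (m) m0.
    apply: cvg_pinfty_eq (cvg_EFin_comp (cvgD h1 hN1)) => t t0.
    rewrite [LHS](_ : _ = (mean_on P (A 1) (fun w => \sum_(1 <= i < m.+1)
        (i`!%:R)^-1 * (derive1n i F (X' 0%N t w) * composition_sum m i (fun k => X' k t w)))
      + mean_on P (A (-1)) (fun w => \sum_(1 <= i < m.+1)
        (i`!%:R)^-1 * (derive1n i F (X' 0%N t w) * composition_sum m i (fun k => X' k t w))))%:E)//.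
    rewrite -(sign_event_split reg (unif_moments_at um t0)).
    have -> : weak_coefficient X m t F = 'E_P[(fun w => \sum_(1 <= i < m.+1) (i`!%:R)^-1 *
         \sum_(j in compositions m i)
            derive1n i F (X 0%N t w) * \prod_(k < i) X (j k) t w)%R]%E.
      by case: (m) m0.
    rewrite expectation.unlock; apply: (integral_null_set mN PN0) => w Nw; congr EFin.
    apply: eq_bigr => i _; congr (_ * _); rewrite (hN w Nw).2// -mulr_sumr.
    congr (_ * _); apply: eq_bigr => j _; apply: eq_bigr => k _.
    by rewrite (hN w Nw).2.
  + have -> : (b m)%:E = (p 1 * D 1 m + p (-1) * D (-1) m)%:E.
      by rewrite /b; case: (m) m0.
    rewrite PPos PNeg !PE -!EFinM -EFinD /D.
    congr ((_ * _ + _ * _)%:E); apply: eq_bigr => i _; by rewrite limit_coefz_nat.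
  + move=> om; rewrite /b; case: m m0 mn om => // m _ _ om.
    by rewrite /D !big1 ?mulr0 ?addr0// => i _; rewrite limit_coef_odd// !mul0r.
Qed.
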